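(* Let $(\psi,\bar\psi)$ be a specification of a non-degenerate homogeneous two-spin system, and let $G_n$ be a uniformly sparse sequence of random graphs converging locally to the $d$-regular tree $\mathbb{T}_d$ ($d\ge 3$ fixed). (a) If the system is ferromagnetic, then the limit $\phi=\lim_{n\to\infty}\frac1n\mathbb{E}_n[\log Z_{G_n}]$ exists and equals $\Phi_{\{\mathbb T\}}=\sup\{\Phi_1(h): h\in\Delta,\ \mathsf F(h)=h\}$. Moreover, letting $h^+$ (resp. $h^-$) be the fixed point of $\mathsf F$ in $\Delta$ maximizing (resp. minimizing) $h(+)$, one has $\Phi_{\{\mathbb T\}}=\Phi_1(h^+)$ if $\psi(+,+)\bar\psi(+)^{2/d}\ge\psi(-,-)\bar\psi(-)^{2/d}$ and $\Phi_{\{\mathbb T\}}=\Phi_1(h^-)$ otherwise. (b) If the system is anti-ferromagnetic and the $G_n$ are moreover nearly bipartite, then $\phi$ exists and equals $\Phi_{\{\mathbb T_\pm\}}=\sup\{\Phi_2(h_+,h_-): h_+=\mathsf F(h_-),\ h_-=\mathsf F(h_+)\}$; moreover $\Phi_{\{\mathbb T_\pm\}}=\Phi_2(h^+)=\Phi_2(h^-)$, where $h^+$ (resp. $h^-$) is the fixed pair $(h_+,h_-)$ maximizing $h_+(+)$ (resp. maximizing $h_-(+)$).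
   Context: Spins take values in $\{+1,-1\}$ (written $\pm$). A specification is a pair $(\psi,\bar\psi)$ with $\psi:\{\pm\}^2\to[0,\infty)$ symmetric and $\bar\psi:\{\pm\}\to(0,\infty)$; on a finite graph $G=(V,E)$ the partition function is $Z_G=\sum_{\sigma\in\{\pm\}^V}\prod_{(ij)\in E}\psi(\sigma_i,\sigma_j)\prod_{i\in V}\bar\psi(\sigma_i)$. Following the paper's classification, the system is non-degenerate if $\psi(+,-)>0$ and $\max(\psi(+,+),\psi(-,-))>0$; it is ferromagnetic if $\psi(+,+)\psi(-,-)\ge\psi(+,-)^2$ and anti-ferromagnetic if $\psi(+,+)\psi(-,-)<\psi(+,-)^2$ (non-degenerate systems reduce to Ising models, or to the hard-core model in the anti-ferromagnetic case). Graph sequences: $G_n$ is a random graph on vertex set $[n]$ with law $\mathbb P_n$ (expectation $\mathbb E_n$), and $I_n$ is a uniformly random vertex. $B_t(v)$ is the subgraph induced by vertices within graph distance $t$ of $v$. $G_n$ converges locally to $\mathbb T_d$ if for every $t\ge0$, $\mathbb P_n(B_t(I_n)\cong\mathbb T_d^t)\to1$, where $\mathbb T_d^t$ is the depth-$t$ ball around the root $o$ of the infinite $d$-regular tree. It is uniformly sparse if $\lim_{L\to\infty}\limsup_n\mathbb E_n[|\partial I_n|\mathbf 1\{|\partial I_n|\ge L\}]=0$. Let $\mathbb T_+$ be $\mathbb T_d$ with vertices colored $+$ or $-$ according to whether their distance from $o$ is even or odd, and $\mathbb T_-$ the same with colors reversed. $G_n$ is nearly bipartite if there exist (not necessarily proper)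 colorings $\tau:[n]\to\{\pm\}$ such that for every $t$, the colored rooted ball $B_t(I_n)$ converges in distribution to the colored depth-$t$ ball of $\mathbf T$, where $\mathbf T$ equals $\mathbb T_+$ or $\mathbb T_-$ with probability $1/2$ each. Bethe quantities: $\Delta$ is the set of probability measures on $\{\pm\}$. Define $\mathsf F:\Delta\to\Delta$ by $\mathsf F(h)(\sigma)\propto\bar\psi(\sigma)\big(\sum_{\sigma'}\psi(\sigma,\sigma')h(\sigma')\big)^{d-1}$. For $h\in\Delta$, $\Phi_1(h)=\log\sum_\sigma\bar\psi(\sigma)\big(\sum_{\sigma'}\psi(\sigma,\sigma')h(\sigma')\big)^d-\frac d2\log\sum_{\sigma,\sigma'}h(\sigma)\psi(\sigma,\sigma')h(\sigma')$. For $h_+,h_-\in\Delta$, $\Phi_2(h_+,h_-)=\frac12\log\sum_\sigma\bar\psi(\sigma)\big(\sum_{\sigma'}\psi(\sigma,\sigma')h_-(\sigma')\big)^d+\frac12\log\sum_\sigma\bar\psi(\sigma)\big(\sum_{\sigma'}\psi(\sigma,\sigma')h_+(\sigma')\big)^d-\frac d2\log\sum_{\sigma,\sigma'}h_+(\sigma)\psi(\sigma,\sigma')h_-(\sigma')$. *)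

(* Defs.v *)
(* Spins: true = +, false = -. *)
From HB Require Import structures.
From mathcomp Require Import all_boot all_order all_algebra.
From mathcomp Require Import all_classical all_reals all_analysis.
Set Implicit Arguments. Unset Strict Implicit. Unset Printing Implicit Defensive.
Import Order.TTheory GRing.Theory Num.Theory.
Import numFieldNormedType.Exports.
Local Open Scope ring_scope.
Local Open Scope classical_set_scope.

Definition graph (n : nat) := {ffun 'I_n * 'I_n -> bool}.
Definition adj n (G : graph n) (i j : 'I_n) : bool := G (i, j).
Definition simple_graph n (G : graph n) : Prop :=
  (forall i j, adj G i j = adj G j i) /\ (forall i, ~~ adj G i i).
Definition deg n (G : graph n) (v : 'I_n) : nat := #|[set u | adj G v u]|.

Definition spec_ok (R : realType) (psi : bool -> bool -> R) (psib : bool -> R) : Prop :=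
  [/\ forall s s', psi s s' = psi s' s,
      forall s s', 0 <= psi s s' &
      forall s, 0 < psib s].
Definition spin_nondegenerate (R : realType) (psi : bool -> bool -> R) : Prop :=
  0 < psi true false /\ 0 < Num.max (psi true true) (psi false false).
Definition spin_ferromagnetic (R : realType) (psi : bool -> bool -> R) : Prop :=
  psi true false ^+ 2 <= psi true true * psi false false.
Definition spin_antiferromagnetic (R : realType) (psi : bool -> bool -> R) : Prop :=
  psi true true * psi false false < psi true false ^+ 2.

(* Z_G = sum_sigma prod_{edges (ij)} psi(s_i,s_j) prod_i psib(s_i);
   each undirected edge {i,j} is counted once (as the pair with i < j). *)
Definition Zpart (R : realType) (psi : bool -> bool -> R) (psib : bool -> R)
  n (G : graph n) : R :=
  \sum_(s : {ffun 'I_n -> bool})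
     ((\prod_(e : 'I_n * 'I_n | (nat_of_ord e.1 < nat_of_ord e.2)%N && adj G e.1 e.2)
         psi (s e.1) (s e.2)) * \prod_(i : 'I_n) psib (s i)).

Fixpoint ballset n (G : graph n) (t : nat) (v : 'I_n) : {set 'I_n} :=
  match t with
  | 0 => [set v]
  | t'.+1 => ballset G t' v :|: [set u | [exists w in ballset G t' v, adj G w u]]
  end.

(* ---------- the infinite d-regular tree T_d ----------
   vertices: words; the root is [::]; the root has children a < d,
   every other vertex has children a < d-1.  Depth = size of the word. *)
Definition tree_vertex (d : nat) (w : seq nat) : bool :=
  if w is a :: s then (a < d)%N && all (fun b => (b < d.-1)%N) s else true.
Definition tree_child (u w : seq nat) : bool :=
  (size w == (size u).+1) && (take (size u) w == u).
Definition tree_adj (u w : seq nat) : bool := tree_child u w || tree_child w u.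

Definition ball_iso_tree n (G : graph n) (d t : nat) (v : 'I_n) : Prop :=
  exists f : 'I_n -> seq nat,
    [/\ f v = [::],
        {in ballset G t v &, injective f},
        (forall u, u \in ballset G t v -> tree_vertex d (f u) && (size (f u) <= t)%N),
        (forall w, tree_vertex d w -> (size w <= t)%N ->
           exists2 u, u \in ballset G t v & f u = w) &
        (forall u u', u \in ballset G t v -> u' \in ballset G t v ->
           adj G u u' = tree_adj (f u) (f u'))].

Definition ball_iso_ctree n (G : graph n) (col : 'I_n -> bool) (d t : nat)
  (colT : seq nat -> bool) (v : 'I_n) : Prop :=
  exists f : 'I_n -> seq nat,
    [/\ f v = [::],
        {in ballset G t v &, injective f},
        (forall u, u \in ballset G t v -> tree_vertex d (f u) && (size (f u) <= t)%N),
        (forall w, tree_vertex d w -> (size w <= t)%N ->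
           exists2 u, u \in ballset G t v & f u = w) &
        (forall u u', u \in ballset G t v -> u' \in ballset G t v ->
           adj G u u' = tree_adj (f u) (f u'))]
    /\ (forall u, u \in ballset G t v -> col u = colT (f u)).

Definition colTplus (w : seq nat) : bool := ~~ odd (size w).
Definition colTminus (w : seq nat) : bool := odd (size w).

Definition graph_law (R : realType) n (Pn : graph n -> R) : Prop :=
  [/\ forall G, 0 <= Pn G,
      \sum_(G : graph n) Pn G = 1 &
      forall G, 0 < Pn G -> simple_graph G].

(* P_n(E(G_n, I_n)) with I_n uniform on [n], independent of G_n *)
Definition prob_vertex (R : realType) n (Pn : graph n -> R)
  (E : graph n -> 'I_n -> Prop) : R :=
  \sum_(G : graph n) Pn G * ((#|[set v | `[< E G v >] ]|)%:R / n%:R).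

Definition sparse_tail (R : realType) n (Pn : graph n -> R) (L : nat) : R :=
  \sum_(G : graph n) Pn G *
     ((\sum_(v : 'I_n) (if (L <= deg G v)%N then (deg G v)%:R else 0)) / n%:R).

(* lim_{L->oo} limsup_n E_n[...] = 0, written out with epsilons *)
Definition uniformly_sparse (R : realType) (P : forall n, graph n -> R) : Prop :=
  forall eps : R, 0 < eps -> exists L0 : nat, forall L : nat, (L0 <= L)%N ->
    exists N : nat, forall n : nat, (N <= n)%N -> sparse_tail (P n) L <= eps.

Definition converges_locally_to_Td (R : realType) (P : forall n, graph n -> R)
  (d : nat) : Prop :=
  forall t : nat,
    (fun n : nat => prob_vertex (P n) (fun G v => ball_iso_tree G d t v)) @ \oo --> (1 : R).

(* colorings tau (may depend on n and on the realized graph) such that the colored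
   ball converges in distribution to the colored ball of T = T_+ or T_- w.p. 1/2 each *)
Definition nearly_bipartite (R : realType) (P : forall n, graph n -> R) (d : nat) : Prop :=
  exists tau : forall n, graph n -> 'I_n -> bool,
    forall t : nat,
      (fun n : nat => prob_vertex (P n)
          (fun G v => ball_iso_ctree G (tau n G) d t colTplus v)) @ \oo --> (1 / 2 : R)
      /\
      (fun n : nat => prob_vertex (P n)
          (fun G v => ball_iso_ctree G (tau n G) d t colTminus v)) @ \oo --> (1 / 2 : R).

Definition free_energy_n (R : realType) (psi : bool -> bool -> R) (psib : bool -> R)
  (P : forall n, graph n -> R) (n : nat) : R :=
  (n%:R)^-1 * \sum_(G : graph n) P n G * ln (Zpart psi psib G).

Definition Delta (R : realType) (h : bool -> R) : Prop :=
  (forall s, 0 <= h s) /\ h true + h false = 1.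

Definition msg (R : realType) (psi : bool -> bool -> R) (h : bool -> R) (s : bool) : R :=
  psi s true * h true + psi s false * h false.

Definition BP (R : realType) (d : nat) (psi : bool -> bool -> R) (psib : bool -> R)
  (h : bool -> R) : bool -> R :=
  fun s => psib s * msg psi h s ^+ d.-1 /
    (psib true * msg psi h true ^+ d.-1 + psib false * msg psi h false ^+ d.-1).

Definition Phi1 (R : realType) (d : nat) (psi : bool -> bool -> R) (psib : bool -> R)
  (h : bool -> R) : R :=
  ln (psib true * msg psi h true ^+ d + psib false * msg psi h false ^+ d)
  - (d%:R / 2) * ln (h true * msg psi h true + h false * msg psi h false).

Definition Phi2 (R : realType) (d : nat) (psi : bool -> bool -> R) (psib : bool -> R)
  (hp hm : bool -> R) : R :=
  (1 / 2) * ln (psib true * msg psi hm true ^+ d + psib false * msg psi hm false ^+ d)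
  + (1 / 2) * ln (psib true * msg psi hp true ^+ d + psib false * msg psi hp false ^+ d)
  - (d%:R / 2) * ln (hp true * msg psi hm true + hp false * msg psi hm false).

Definition BP_fixed (R : realType) d psi psib (h : bool -> R) : Prop :=
  Delta h /\ forall s, BP d psi psib h s = h s.

Definition BP_fixed_pair (R : realType) d psi psib (hp hm : bool -> R) : Prop :=
  [/\ Delta hp, Delta hm,
      forall s, hp s = BP d psi psib hm s &
      forall s, hm s = BP d psi psib hp s].

Definition PhiT (R : realType) d psi psib : R :=
  sup [set Phi1 d psi psib h | h in [set h | BP_fixed d psi psib h]].

Definition PhiTpm (R : realType) d psi psib : R :=
  sup [set x : R | exists hp hm, BP_fixed_pair d psi psib hp hm /\ x = Phi2 d psi psib hp hm].

(* Main.v *)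
(* Absorbing the vertex weights into the edges leaves three edge weights p, s, q
   (for ++, +-, --), and a Bethe fixed point is a solution of F(y) = y (or a
   2-cycle of F) for a rational map F of the message ratio y. At such a point the
   Bethe functional is ln(E y)/2 for an explicit function E on (0, oo), and
   Hoelder's inequality gives E(F y) >= E(y). Hence E is maximal at an extremal
   fixed point (ferromagnet) or at the extremal 2-cycle (anti-ferromagnet): on the
   relevant interval F (resp. F o F) pushes every point towards it, in the second
   case because F transforms cross ratios as y |-> y^(d-1) does.

   For the graphs, p and q are fixed and s varies. The derivative of ln Z in ln s
   is the mean number of disagreeing edges. On a tree-like ball the messages
   entering a star lie between the iterates of F from its extreme values, and AM-GM
   bounds the disagreement around the center by its value at the extremal fixed
   points. Both ln Z and ln(E y) are convex in ln s, so these slope bounds can be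
   summed over a finite grid without differentiating anything, and compare the
   growth of ln Z with that of max ln E. The comparison starts from the product
   measure s^2 = pq, where the upper bound is immediate; in the opposite limit
   (s -> 0, or s -> oo) one constant or alternating configuration gives the lower
   bound. *)
Require Import Defs.
From HB Require Import structures.
From mathcomp Require Import all_boot all_order all_algebra.
From mathcomp Require Import all_classical all_reals all_analysis.
From mathcomp Require Import ring lra zify.
Set Implicit Arguments. Unset Strict Implicit. Unset Printing Implicit Defensive.
Import Order.TTheory GRing.Theory Num.Theory.
Import numFieldNormedType.Exports.
Local Open Scope ring_scope.
Local Open Scope classical_set_scope.

(** * The Bethe recursion and its maximum *)

(** AM-GM controls the disagreement around a vertex from one side only: it bounds [p * q - s ^+ 2]
    times the disagreement from below. Hence, when [s] moves towards the product point
    [s ^+ 2 = p * q], from below or from above, the increment of [ln Z] per vertex is asymptotically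
    at least that of the Bethe maximum, and no opposite estimate is at hand. This single inequality
    yields both bounds because the two ends of the path are known: the upper bound at the product
    end is carried back to the given [s], the lower bound at the far end is carried forward to it.
    Near-bipartiteness therefore enters only at the far end [s -> oo]. Along the path the sign of
    [p * q - s ^+ 2] is fixed, and with it the monotonicity of [F]. The maximiser of [E] may jump as
    [s] varies. Only the maximal value and the slope at some maximiser are used, and that value is a
    maximum of functions convex in [ln s], so jumps do no harm. *)

Section PowerSums.
Variable R : realFieldType.
Implicit Types a b c e u v x y : R.

Lemma lerXn n x y : 0 <= x -> x <= y -> x ^+ n <= y ^+ n.
Proof. by move=> x0 xy; apply: lerXn2r; rewrite ?nnegrE // (le_trans x0). Qed.

Lemma ltrXn n x y : (0 < n)%N -> 0 <= x -> x < y -> x ^+ n < y ^+ n.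
Proof. by move=> n0 x0 xy; rewrite ltrXn2r // -lt0n. Qed.

(** The cofactor of [x - y] in [x ^+ n - y ^+ n], in the form given by [subrXX]. *)
Definition hsum n x y := \sum_(i < n) x ^+ (n.-1 - i) * y ^+ i.

Lemma hsum_gt0 n x y : (0 < n)%N -> 0 < x -> 0 < y -> 0 < hsum n x y.
Proof.
case: n => // n _ x0 y0; rewrite /hsum big_ord_recl ltr_wpDr //; last first.
  by rewrite mulr_gt0 // exprn_gt0.
by apply: sumr_ge0 => i _; rewrite mulr_ge0 // exprn_ge0 // ltW.
Qed.

Lemma hsum_le n x y x' y' : 0 <= x -> 0 <= y -> x <= x' -> y <= y' ->
  hsum n x y <= hsum n x' y'.
Proof.
move=> x0 y0 xx yy; apply: ler_sum => i _.
by apply: ler_pM; rewrite ?exprn_ge0 // lerXn.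
Qed.

(** Twice the sum is the sum of the symmetrised terms [T i j + T j i]. *)
Lemma sum_antisym_pos n (T : 'I_n -> 'I_n -> R) i0 j0 :
  (forall i j, 0 <= T i j + T j i) -> 0 < T i0 j0 + T j0 i0 ->
  0 < \sum_i \sum_j T i j.
Proof.
move=> Tge Tgt; set s := (X in 0 < X).
suff : 0 < s + s by lra.
rewrite {2}/s exchange_big /s -big_split /=.
under eq_bigr do rewrite -big_split /=.
rewrite (bigD1 i0) //= ltr_pwDl //; last first.
  by apply: sumr_ge0 => i _; apply: sumr_ge0.
rewrite (bigD1 j0) //= ltr_pwDl //.
by apply: sumr_ge0.
Qed.

(* [hsum n] is strictly log-submodular: the antisymmetrised double sum has
   terms of one sign. *)
Lemma hsum_submod n a b c e : (1 < n)%N -> 0 < a -> a < e -> 0 < b -> b < c ->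
  hsum n a b * hsum n e c < hsum n a c * hsum n e b.
Proof.
move=> n1 a0 ae b0 bc.
have e0 : 0 < e by lra.
have c0 : 0 < c by lra.
rewrite -subr_gt0 /hsum !big_distrlr /= -sumrB.
under eq_bigr do rewrite -sumrB.
case: n n1 => // m m0.
have key (i j : 'I_m.+1) : (i < j)%N ->
    0 < (a ^+ (m - i) * c ^+ i * (e ^+ (m - j) * b ^+ j) -
         a ^+ (m - i) * b ^+ i * (e ^+ (m - j) * c ^+ j)) +
        (a ^+ (m - j) * c ^+ j * (e ^+ (m - i) * b ^+ i) -
         a ^+ (m - j) * b ^+ j * (e ^+ (m - i) * c ^+ i)).
  move=> ij.
  have jm : (j <= m)%N by rewrite -ltnS.
  have -> : (m - i = (m - j) + (j - i))%N by lia.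
  have -> : (j : nat) = (i + (j - i))%N by rewrite subnKC // ltnW.
  rewrite addKn !exprD.
  set k := (j - i)%N; set l := (m - _)%N.
  have k0 : (0 < k)%N by rewrite subn_gt0.
  have h1 : a ^+ k < e ^+ k by rewrite ltrXn // ltW.
  have h2 : b ^+ k < c ^+ k by rewrite ltrXn // ltW.
  have -> : forall A E K1 K2 B C K3 K4 : R,
    (A * K1 * C * (E * (B * K3)) - A * K1 * B * (E * (C * K4))) +
    (A * (C * K4) * (E * K2 * B) - A * (B * K3) * (E * K2 * C)) =
    (A * E * B * C) * ((K2 - K1) * (K4 - K3)) by move=> *; ring.
  by rewrite !mulr_gt0 ?exprn_gt0 // subr_gt0.
apply: (@sum_antisym_pos _ _ ord0 ord_max) => [i j|]; last exact: key.
have [ij|ji|ij] := ltngtP i j; first exact/ltW/key.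
- by rewrite addrC; exact/ltW/key.
- by rewrite (val_inj ij); lra.
Qed.

(** Jensen for the power [n.+1], cleared of the division by [a + b] so that both weights may vanish.
    The induction step loses [a * b * (u - v) * (u ^+ n.+1 - v ^+ n.+1)]. *)
Lemma convex_pow n a b u v : 0 <= a -> 0 <= b -> 0 <= u -> 0 <= v ->
  (a * u + b * v) ^+ n.+1 <= (a + b) ^+ n * (a * u ^+ n.+1 + b * v ^+ n.+1).
Proof.
move=> a0 b0 u0 v0; elim: n => [|n IH]; first by rewrite !expr1 expr0 mul1r.
have ab0 : 0 <= a + b by lra.
rewrite exprS (le_trans (ler_wpM2l _ IH)) ?addr_ge0 ?mulr_ge0 //.
rewrite mulrCA [(a + b) ^+ n.+1]exprS -mulrA [leRHS]mulrCA.
rewrite ler_wpM2l ?exprn_ge0 // [u ^+ n.+2]exprS [v ^+ n.+2]exprS.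
have : 0 <= (u - v) * (u ^+ n.+1 - v ^+ n.+1).
  have [uv|/ltW vu] := leP u v.
    by rewrite mulr_le0 // subr_le0 // lerXn.
  by rewrite mulr_ge0 // subr_ge0 // lerXn.
move: (u ^+ n.+1) (v ^+ n.+1) => U V h.
have := mulr_ge0 (mulr_ge0 a0 b0) h; lra.
Qed.

(** Hoelder for the vectors [(u, v)] and [(1, y ^+ n)], obtained from Jensen with weights [1],
    [y ^+ n.+1] at the points [u], [v / y]. *)
Lemma holder_pow n u v y : 0 <= u -> 0 <= v -> 0 < y ->
  (u + v * y ^+ n) ^+ n.+1 <= (u ^+ n.+1 + v ^+ n.+1) * (1 + y ^+ n.+1) ^+ n.
Proof.
move=> u0 v0 y0.
have yn0 : y != 0 by rewrite gt_eqF.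
have := @convex_pow n 1 (y ^+ n.+1) u (v / y).
have -> : 1 * u + y ^+ n.+1 * (v / y) = u + v * y ^+ n.
  by rewrite exprS; field.
have -> : 1 * u ^+ n.+1 + y ^+ n.+1 * (v / y) ^+ n.+1 = u ^+ n.+1 + v ^+ n.+1.
  by rewrite mul1r -exprMn mulrC divfK.
by move=> h; rewrite [leRHS]mulrC; apply: h; rewrite ?exprn_ge0 ?divr_ge0 // ltW.
Qed.

Lemma sum_pow_le n u v : 0 <= u -> 0 <= v -> u ^+ n.+1 + v ^+ n.+1 <= (u + v) ^+ n.+1.
Proof.
move=> u0 v0; elim: n => [|n IH]; first by rewrite !expr1.
rewrite [(u + v) ^+ _]exprS (le_trans _ (ler_wpM2l (addr_ge0 u0 v0) IH)) //.
rewrite [u ^+ n.+2]exprS [v ^+ n.+2]exprS.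
have := mulr_ge0 u0 (exprn_ge0 n.+1 v0); have := mulr_ge0 v0 (exprn_ge0 n.+1 u0).
lra.
Qed.

(** Weak majorization for two terms: when [y2 > x2], the gain [x1 - y1] is at least the loss
    [y2 - x2] and is multiplied by a larger cofactor. *)
Lemma pow_majorize n x1 x2 y1 y2 : 0 <= x2 -> 0 <= y1 -> 0 <= y2 ->
  y1 <= x1 -> y2 <= x1 -> y1 + y2 <= x1 + x2 ->
  y1 ^+ n + y2 ^+ n <= x1 ^+ n + x2 ^+ n.
Proof.
wlog y21 : y1 y2 / y2 <= y1.
  move=> wl x20 y10 y20 y1x y2x sum.
  have [h|/ltW h] := leP y2 y1; first exact: wl.
  by rewrite addrC; apply: wl => //; rewrite addrC.
move=> x20 y10 y20 y1x y2x sum.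
have x10 : 0 <= x1 by lra.
have [h|/ltW h] := leP y2 x2; first by rewrite lerD // lerXn.
rewrite -subr_ge0.
have -> : x1 ^+ n + x2 ^+ n - (y1 ^+ n + y2 ^+ n) =
  (x1 ^+ n - y1 ^+ n) - (y2 ^+ n - x2 ^+ n) by ring.
rewrite !subrXX subr_ge0; apply: ler_pM; [lra| |lra|].
  by apply: sumr_ge0 => i _; rewrite mulr_ge0 // exprn_ge0.
by apply: hsum_le => //; lra.
Qed.

End PowerSums.

(* [y] is the ratio (minus over plus) of the messages sent to a vertex along one of its
   edges, and [D] is [d - 1]. *)
Definition bpF (R : realType) (p s q : R) (D : nat) (y : R) : R :=
  (s + q * y ^+ D) / (p + s * y ^+ D).

(** With [z = (1, y ^+ D)] and the symmetric matrix [A] of rows [(p, s)], [(s, q)], this is the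
    power [D.+1] of the ratio of the l^(D+1) norm of [A z] to the l^((D+1)/D) norm of [z]. Its
    maximum is thus a power of an operator norm, and [bpF] is one step of the nonlinear power
    iteration for it. *)
Definition bpE (R : realType) (p s q : R) (D : nat) (y : R) : R :=
  ((p + s * y ^+ D) ^+ D.+1 + (s + q * y ^+ D) ^+ D.+1) / (1 + y ^+ D.+1) ^+ D.

(** * Monotone improvement under an iteration *)

Section IterationMax.
Variable R : realType.
Implicit Types T E : R -> R.

(** Instead of following the iterates of [T] to a limit, take the infimum of the points of [[L, y]]
    where [E] is at least [E y]. Continuity of [E] puts it in the set, and [T] would move it further
    left unless it is [L]. *)
Lemma improve_left_max T E (L c : R) :
  (forall y, L < y < c -> L <= T y < y) ->
  (forall y, L <= y < c -> {for y, continuous E}) ->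
  (forall y, L < y < c -> E y <= E (T y)) ->
  forall y, L <= y < c -> E y <= E L.
Proof.
move=> Tlt Ec ET y Lyc.
have [yL|] := leP y L; first by have -> : y = L by lra.
move=> Ly.
pose A := [set x | L <= x <= y /\ E y <= E x].
have hA : has_inf A.
  by split; [exists y; split; rewrite ?lexx ?andbT ?ltW | exists L => x [/andP[]]].
pose m := inf A.
have Lm : L <= m by apply: lb_le_inf => [|x [/andP[]]]; first by case: hA.
have my : m <= y.
  by apply: ge_inf; [case: hA | split; rewrite ?lexx ?andbT ?ltW].
have Em : E y <= E m.
  rewrite leNgt; apply/negP => Emy.
  have cm : {for m, continuous E} by apply: Ec; lra.
  have [e /= e0 He] := cvgr_lt _ cm _ Emy.
  have [x [Lx Ex] xm] := inf_adherent e0 hA.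
  have mx : m <= x by apply: ge_inf => //; case: hA.
  have : E x < E y.
    by apply: He; rewrite /ball_ /= ler0_norm ?subr_le0 //; rewrite -/m in xm; lra.
  by rewrite ltNge Ex.
have [mL|Lm'] := leP m L; first by have <- : m = L by lra.
have mc : L < m < c by lra.
have /andP[LT Tm] := Tlt m mc.
suff : m <= T m by lra.
apply: ge_inf; first by case: hA.
by split; [lra | apply: le_trans Em (ET m mc)].
Qed.

Lemma improve_right_max T E (c H : R) :
  (forall y, c < y < H -> y < T y <= H) ->
  (forall y, c < y <= H -> {for y, continuous E}) ->
  (forall y, c < y < H -> E y <= E (T y)) ->
  forall y, c < y <= H -> E y <= E H.
Proof.
move=> Tgt Ec ET y yH.
have := @improve_left_max (fun x => - T (- x)) (fun x => E (- x)) (- H) (- c).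
move=> /(_ _ _ _ (- y)); rewrite !opprK; apply; last by lra.
- by move=> x hx; have := Tgt (- x); lra.
- move=> x hx; apply: (@continuous_comp _ _ _ (@GRing.opp R) E).
    exact: opp_continuous.
  by apply: Ec; lra.
- by move=> x hx; rewrite opprK; apply: ET; lra.
Qed.

End IterationMax.

Section BetheMap.
Variables (R : realType) (p s q : R) (D : nat).
Hypotheses (p0 : 0 <= p) (s0 : 0 < s) (q0 : 0 <= q).
Local Notation F := (bpF p s q D).
Local Notation E := (bpE p s q D).
Implicit Types y u v : R.

Lemma bpU_gt0 y : 0 < y -> 0 < p + s * y ^+ D.
Proof. by move=> y0; rewrite ltr_wpDl // mulr_gt0 // exprn_gt0. Qed.

Lemma bpV_gt0 y : 0 < y -> 0 < s + q * y ^+ D.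
Proof. by move=> y0; rewrite ltr_pwDl // mulr_ge0 // exprn_ge0 // ltW. Qed.

Lemma bpF_gt0 y : 0 < y -> 0 < F y.
Proof. by move=> y0; rewrite divr_gt0 ?bpU_gt0 ?bpV_gt0. Qed.

Lemma bpE_gt0 y : 0 < y -> 0 < E y.
Proof.
move=> y0; rewrite divr_gt0 ?addr_gt0 ?exprn_gt0 ?bpU_gt0 ?bpV_gt0 //.
by rewrite addr_gt0 // exprn_gt0.
Qed.

Lemma bpF_eq y v : 0 < y -> (F y = v) <-> (s + q * y ^+ D = v * (p + s * y ^+ D)).
Proof.
move=> y0; have U0 := bpU_gt0 y0; split => [<-|e].
  by rewrite /bpF divfK // gt_eqF.
by rewrite /bpF e mulfK // gt_eqF.
Qed.

Lemma bpF_sub u v : 0 < u -> 0 < v ->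
  F u - F v = (p * q - s ^+ 2) * (u ^+ D - v ^+ D) /
              ((p + s * u ^+ D) * (p + s * v ^+ D)).
Proof.
move=> u0 v0; have := bpU_gt0 u0; have := bpU_gt0 v0; rewrite /bpF.
move: (u ^+ D) (v ^+ D) => a b h1 h2.
by field; rewrite !gt_eqF.
Qed.

Lemma bpF_homo : s ^+ 2 <= p * q -> forall u v, 0 < u -> u <= v -> F u <= F v.
Proof.
move=> k u v u0 uv; have v0 : 0 < v by lra.
rewrite -subr_ge0 bpF_sub // divr_ge0 ?mulr_ge0 ?subr_ge0 // ?lerXn // ?ltW ?bpU_gt0 //.
Qed.

Lemma bpF_nhomo : p * q <= s ^+ 2 -> forall u v, 0 < u -> u <= v -> F v <= F u.
Proof.
move=> k u v u0 uv; have v0 : 0 < v by lra.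
rewrite -subr_le0 bpF_sub // pmulr_lle0 ?invr_gt0 ?mulr_gt0 ?bpU_gt0 //.
by rewrite mulr_le0_ge0 ?subr_le0 ?subr_ge0 // lerXn // ltW.
Qed.

(** With [w = (U ^+ D, V ^+ D)], symmetry of the weight matrix [A] turns the pairing of
    [z = (1, y ^+ D)] with [A w] into that of [A z = (U, V)] with [w], which is
    [U ^+ D.+1 + V ^+ D.+1] (the equation [e]). Hoelder bounds the former by the norms of [A w] and
    [z]. *)
Lemma bpE_bpF y : 0 < y -> E y <= E (F y).
Proof.
move=> y0; have U0 := bpU_gt0 y0; have V0 := bpV_gt0 y0.
set U := p + s * y ^+ D; set V := s + q * y ^+ D.
have y1 : 0 < 1 + y ^+ D.+1 by rewrite addr_gt0 // exprn_gt0.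
have UV0 : 0 < U ^+ D.+1 + V ^+ D.+1 by rewrite addr_gt0 ?exprn_gt0.
have Un : U != 0 by rewrite gt_eqF.
have -> : E (F y) = ((p * U ^+ D + s * V ^+ D) ^+ D.+1 +
    (s * U ^+ D + q * V ^+ D) ^+ D.+1) / (U ^+ D.+1 + V ^+ D.+1) ^+ D.
  rewrite /bpE /bpF -/U -/V.
  have e1 a b : a + b * (V / U) ^+ D = (a * U ^+ D + b * V ^+ D) / U ^+ D.
    by rewrite expr_div_n; field; rewrite expf_neq0.
  have -> : 1 + (V / U) ^+ D.+1 = (U ^+ D.+1 + V ^+ D.+1) / U ^+ D.+1.
    by rewrite expr_div_n mulrDl divff // expf_neq0.
  rewrite !e1 !expr_div_n -mulrDl -!exprM mulnC.
  by field; rewrite !expf_neq0 // gt_eqF.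
rewrite /bpE -/U -/V ler_pdivrMr ?exprn_gt0 // mulrAC ler_pdivlMr ?exprn_gt0 //.
rewrite -exprS.
have e : p * U ^+ D + s * V ^+ D + (s * U ^+ D + q * V ^+ D) * y ^+ D =
         U ^+ D.+1 + V ^+ D.+1.
  have -> : U ^+ D.+1 = (p + s * y ^+ D) * U ^+ D by rewrite exprS.
  have -> : V ^+ D.+1 = (s + q * y ^+ D) * V ^+ D by rewrite exprS.
  by move: (U ^+ D) (V ^+ D) (y ^+ D) => a b c; ring.
rewrite -{1}e holder_pow // addr_ge0 ?mulr_ge0 ?exprn_ge0 // ltW //.
Qed.

Lemma bpF_continuous y : 0 < y -> {for y, continuous F}.
Proof.
move=> y0; have U0 := bpU_gt0 y0; apply: continuousM.
  apply: continuousD; first exact: cst_continuous.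
  by apply: continuousM; [exact: cst_continuous | exact: exprn_continuous].
apply: continuousV; first by rewrite gt_eqF.
apply: continuousD; first exact: cst_continuous.
by apply: continuousM; [exact: cst_continuous | exact: exprn_continuous].
Qed.

Lemma bpE_continuous y : 0 < y -> {for y, continuous E}.
Proof.
move=> y0.
have cp (a b : R) (n : nat) : {for y, continuous (fun x : R => (a + b * x ^+ D) ^+ n)}.
  apply: (@continuous_comp _ _ _ (fun x : R => a + b * x ^+ D) (fun x : R => x ^+ n)).
    apply: continuousD; first exact: cst_continuous.
    by apply: continuousM; [exact: cst_continuous | exact: exprn_continuous].
  exact: exprn_continuous.
apply: continuousM; first by apply: continuousD; exact: cp.
apply: continuousV; first by rewrite gt_eqF // exprn_gt0 // addr_gt0 // exprn_gt0.
apply: (@continuous_comp _ _ _ (fun x : R => 1 + x ^+ D.+1) (fun x : R => x ^+ D)).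
  by apply: continuousD; [exact: cst_continuous | exact: exprn_continuous].
exact: exprn_continuous.
Qed.

End BetheMap.

(** Exchanging the two spins swaps [p] with [q] and inverts the message ratio; each regime is
    thereby reduced to one order of [p] and [q]. *)
Lemma bpE_flip (R : realType) (p s q : R) D (y : R) : 0 < y ->
  bpE p s q D y^-1 = bpE q s p D y.
Proof.
move=> y0; have yn : y != 0 by rewrite gt_eqF.
rewrite /bpE.
have e (a b : R) : a + b * y^-1 ^+ D = (b + a * y ^+ D) / y ^+ D.
  by rewrite exprVn; field; rewrite expf_neq0.
have -> : 1 + y^-1 ^+ D.+1 = (1 + y ^+ D.+1) / y ^+ D.+1.
  by rewrite exprVn mulrDl divff ?expf_neq0 // mul1r addrC.
rewrite !e !expr_div_n -mulrDl -!exprM mulnC [X in _ = X / _]addrC.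
field; rewrite !expf_neq0 // gt_eqF // addr_gt0 // exprn_gt0 //.
Qed.

Lemma bpF_flip (R : realType) (p s q : R) D (y : R) : 0 < y ->
  bpF p s q D y^-1 = (bpF q s p D y)^-1.
Proof.
move=> y0; have yn : y != 0 by rewrite gt_eqF.
have e (a b : R) : a + b * y^-1 ^+ D = (b + a * y ^+ D) / y ^+ D.
  by rewrite exprVn; field; rewrite expf_neq0.
by rewrite /bpF !e invf_div [in RHS]invf_div mulrA divfK // expf_neq0.
Qed.

(** * Iterates of the Bethe map from its extreme values *)

Section FerroBox.
Variables (R : realType) (p s q : R) (D : nat).
Hypotheses (p0 : 0 < p) (s0 : 0 < s) (q0 : 0 < q) (ferro : s ^+ 2 <= p * q).
Local Notation F := (bpF p s q D).

(** The bounds are the values of [F] at [y = 0] and [y = +oo]. *)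
Lemma bpF_ferro_range (y : R) : 0 < y -> s / p <= F y <= q / s.
Proof.
move=> y0; rewrite /bpF; have := bpU_gt0 D (ltW p0) s0 y0.
have : 0 < y ^+ D by rewrite exprn_gt0.
move: (y ^+ D) => z z0 U0.
rewrite ler_pdivrMr // mulrAC ler_pdivlMr // ler_pdivrMr // mulrAC ler_pdivlMr //.
have := mulr_ge0 (ltW z0) (_ : 0 <= p * q - s ^+ 2); rewrite subr_ge0 => /(_ ferro).
by nra.
Qed.

(** [F] is increasing, so its iterates from the ends of its range converge monotonically to the
    extremal fixed points. Extremality is stated for all [y] with [F y <= y] or [y <= F y], since
    this also tells in which direction [F] moves the points beyond [L] and [H]. *)
Lemma ferro_box : exists (l h : R^nat) (L H : R),
  [/\ l 0%N = s / p /\ h 0%N = q / s,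
      (forall t, l t.+1 = F (l t)) /\ (forall t, h t.+1 = F (h t)),
      (forall t, 0 < l t <= h t) /\ 0 < L <= H,
      (l @ \oo --> L) /\ (h @ \oo --> H) &
      [/\ F L = L, F H = H,
          (forall y : R, 0 < y -> F y <= y -> L <= y) &
          (forall y : R, 0 < y -> y <= F y -> y <= H)]].
Proof.
pose l t := iter t F (s / p); pose h t := iter t F (q / s).
have sp0 : 0 < s / p by rewrite divr_gt0.
have qs0 : 0 < q / s by rewrite divr_gt0.
have spqs : s / p <= q / s.
  by rewrite ler_pdivrMr // mulrAC ler_pdivlMr // -expr2 mulrC.
have l0 t : 0 < l t by case: t => //= t; elim: t => [|t IH] /=; apply: bpF_gt0 => //; exact: ltW.
have h0 t : 0 < h t by case: t => //= t; elim: t => [|t IH] /=; apply: bpF_gt0 => //; exact: ltW.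
have Fm (u v : R) : 0 < u -> u <= v -> F u <= F v by apply: bpF_homo => //; exact: ltW.
have lE t : l t.+1 = F (l t) by [].
have hE t : h t.+1 = F (h t) by [].
have lh t : l t <= h t by elim: t => //= t IH; apply: Fm.
have lS t : l t <= l t.+1.
  elim: t => [|t IH]; first by have /andP[] := bpF_ferro_range sp0.
  by rewrite (lE t) (lE t.+1); apply: Fm.
have hS t : h t.+1 <= h t.
  elim: t => [|t IH]; first by have /andP[] := bpF_ferro_range qs0.
  by rewrite (hE t) (hE t.+1); apply: Fm.
have lm : nondecreasing_seq l by apply/nondecreasing_seqP.
have hm : nonincreasing_seq h by apply/nonincreasing_seqP.
have lc : cvgn l.
  apply: nondecreasing_is_cvgn => //; exists (q / s) => _ [t _ <-].
  by apply: le_trans (lh t) _; apply: (hm 0%N t).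
have hc : cvgn h.
  by apply: nonincreasing_is_cvgn => //; exists 0 => _ [t _ <-]; exact: ltW.
have lL t : l t <= limn l by exact: nondecreasing_cvgn_le.
have hH t : limn h <= h t by exact: nonincreasing_cvgn_ge.
have L0 : 0 < limn l by apply: lt_le_trans (lL 0%N).
have LH : limn l <= limn h by apply: ler_lim => //; apply: nearW.
have fixl (u : R^nat) : cvgn u -> 0 < limn u -> (forall t, u t.+1 = F (u t)) -> F (limn u) = limn u.
  move=> uc u0 uS.
  have c1 : (fun t => u t.+1) @ \oo --> limn u by rewrite cvg_shiftS.
  have c2 : (fun t => u t.+1) @ \oo --> F (limn u).
    have -> : (fun t => u t.+1) = F \o u by apply/funext => t; rewrite uS.
    apply: continuous_cvg => //; apply: bpF_continuous => //; exact: ltW.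
  exact: (cvg_unique _ c2 c1).
have LH0 : 0 < limn h by apply: lt_le_trans LH.
exists l, h, (limn l), (limn h); split=> //.
- by split=> [t|]; rewrite ?l0 ?L0 ?lh ?LH.
- split; [exact: fixl | exact: fixl | |] => y y0 Fy.
  + suff ly t : l t <= y by apply: limr_le => //; apply: nearW.
    elim: t => [|t IH]; first by have /andP[h1 _] := bpF_ferro_range y0; apply: le_trans Fy.
    by apply: le_trans Fy; apply: Fm.
  + suff ly t : y <= h t by apply: limr_ge => //; apply: nearW.
    elim: t => [|t IH]; first by have /andP[_ h1] := bpF_ferro_range y0; apply: le_trans h1.
    by apply: le_trans Fy _; apply: Fm.
Qed.

End FerroBox.

Section AntiBox.
Variables (R : realType) (p s q : R) (D : nat).
Hypotheses (p0 : 0 <= p) (s0 : 0 < s) (q0 : 0 < q) (anti : p * q < s ^+ 2).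
Local Notation F := (bpF p s q D).

Lemma bpF_anti_lb (y : R) : 0 < y -> q / s <= F y.
Proof.
move=> y0; rewrite /bpF; have := bpU_gt0 D p0 s0 y0.
move: (y ^+ D) => z U0.
rewrite ler_pdivlMr // mulrAC ler_pdivrMr // -subr_ge0.
have -> : (s + q * z) * s - q * (p + s * z) = s ^+ 2 - p * q by ring.
by rewrite subr_ge0 ltW.
Qed.

(** [F] is decreasing, so lower and upper bounds produce each other. When [p = 0] the range of [F]
    is unbounded above, whence the upper sequence starts one step later, at [F (q / s)]. *)
Fixpoint anti_seq (t : nat) : R * R :=
  if t is t'.+1 then (F (anti_seq t').2, F (anti_seq t').1) else (q / s, F (q / s)).

Lemma anti_box : exists (l h : R^nat) (L H : R),
  [/\ l 0%N = q / s /\ h 0%N = F (q / s),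
      (forall t, l t.+1 = F (h t)) /\ (forall t, h t.+1 = F (l t)),
      (forall t, 0 < l t <= h t) /\ 0 < L <= H,
      (l @ \oo --> L) /\ (h @ \oo --> H) &
      [/\ F L = H, F H = L,
          (forall y : R, 0 < y -> F (F y) <= y -> L <= y) &
          (forall y : R, 0 < y -> y <= F (F y) -> y <= H)]].
Proof.
pose l t := (anti_seq t).1; pose h t := (anti_seq t).2.
have qs0 : 0 < q / s by rewrite divr_gt0.
have Fp (y : R) : 0 < y -> 0 < F y by move=> ?; apply: bpF_gt0 => //; exact: ltW.
have lh0 t : (0 < l t) && (0 < h t).
  elim: t => [|t /andP[IH1 IH2]]; first by rewrite qs0 Fp.
  by rewrite !Fp.
have l0 t : 0 < l t by have /andP[] := lh0 t.
have h0 t : 0 < h t by have /andP[] := lh0 t.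
have Fm (u v : R) : 0 < u -> u <= v -> F v <= F u by apply: bpF_nhomo => //; exact: ltW.
have lE t : l t.+1 = F (h t) by [].
have hE t : h t.+1 = F (l t) by [].
have lh t : l t <= h t.
  elim: t => [|t IH]; first exact: bpF_anti_lb.
  by rewrite lE hE; apply: Fm.
have lhS t : (l t <= l t.+1) && (h t.+1 <= h t).
  elim: t => [|t /andP[IH1 IH2]].
    by apply/andP; split; [exact/bpF_anti_lb/Fp | exact: lexx].
  by rewrite (lE t.+1) (hE t.+1) (lE t) (hE t); apply/andP; split; apply: Fm; rewrite -?lE -?hE.
have lS t : l t <= l t.+1 by have /andP[] := lhS t.
have hS t : h t.+1 <= h t by have /andP[] := lhS t.
have lm : nondecreasing_seq l by apply/nondecreasing_seqP.
have hm : nonincreasing_seq h by apply/nonincreasing_seqP.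
have lc : cvgn l.
  apply: nondecreasing_is_cvgn => //; exists (h 0%N) => _ [t _ <-].
  by apply: le_trans (lh t) _; apply: (hm 0%N t).
have hc : cvgn h.
  by apply: nonincreasing_is_cvgn => //; exists 0 => _ [t _ <-]; exact: ltW.
have lL t : l t <= limn l by exact: nondecreasing_cvgn_le.
have hH t : limn h <= h t by exact: nonincreasing_cvgn_ge.
have L0 : 0 < limn l by apply: lt_le_trans (lL 0%N).
have LH : limn l <= limn h by apply: ler_lim => //; apply: nearW.
have H0 : 0 < limn h by apply: lt_le_trans LH.
have fixl (u v : R^nat) : cvgn u -> cvgn v -> 0 < limn u -> (forall t, v t.+1 = F (u t)) -> F (limn u) = limn v.
  move=> uc vc u0 uS.
  have c1 : (fun t => v t.+1) @ \oo --> limn v by rewrite cvg_shiftS.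
  have c2 : (fun t => v t.+1) @ \oo --> F (limn u).
    have -> : (fun t => v t.+1) = F \o u by apply/funext => t; rewrite uS.
    apply: continuous_cvg => //; apply: bpF_continuous => //; exact: ltW.
  exact: (cvg_unique _ c2 c1).
exists l, h, (limn l), (limn h); split=> //.
- by split=> [t|]; rewrite ?l0 ?L0 ?lh ?LH.
- split; [exact: fixl | exact: fixl | |] => y y0 Gy; have Fy0 := Fp _ y0.
  (* A bound on [y] alone does not propagate under a decreasing map, so [F y] is carried along. *)
  + suff ly t : l t <= y /\ F y <= h t.
      by apply: limr_le => //; apply: nearW => t; case: (ly t).
    elim: t => [|t [h1 h2]].
      have h1 : q / s <= y by apply: le_trans Gy; exact: bpF_anti_lb.
      by split=> //; apply: Fm.
    by rewrite lE hE; split; [apply: le_trans Gy; apply: Fm | apply: Fm].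
  + suff ly t : y <= h t /\ l t <= F y.
      by apply: limr_ge => //; apply: nearW => t; case: (ly t).
    elim: t => [|t [h1 h2]].
      have h1 := bpF_anti_lb y0.
      by split=> //; apply: le_trans Gy _; apply: Fm.
    by rewrite lE hE; split; [apply: le_trans Gy _; apply: Fm | apply: Fm].
Qed.

End AntiBox.

(** * Location of the maximum of the Bethe function *)

Section GeometricSums.
Variable R : realFieldType.
Implicit Types u v x y : R.

Lemma hsumC n x y : hsum n x y = hsum n y x.
Proof.
rewrite /hsum (reindex_inj rev_ord_inj) /=; apply: eq_bigr => i _.
have -> : (n.-1 - (n - i.+1) = i)%N by have := ltn_ord i; lia.
by rewrite mulrC; congr (_ ^+ _ * _); have := ltn_ord i; lia.
Qed.

(** Once each sum is added to its reversal, the difference consists of the terms [(u ^+ i - u ^+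
    (n.-1 - i)) * (v ^+ i - v ^+ (n.-1 - i))], whose two factors have the same sign because
    [u, v < 1]. *)
Lemma hsum_lt_geom n u v : (1 < n)%N -> 0 < u -> u < 1 -> 0 < v -> v < 1 ->
  hsum n u v < \sum_(i < n) (u * v) ^+ i.
Proof.
move=> n1 u0 u1 v0 v1.
set A := hsum _ _ _; set B := (X in _ < X).
suff : 0 < (B + B) - (A + A) by lra.
rewrite {2}/B (reindex_inj rev_ord_inj) /= {2}/A hsumC /A /B /hsum.
rewrite -!big_split -sumrB /=.
have e (i : 'I_n) : (u * v) ^+ i + (u * v) ^+ (n - i.+1) -
    (u ^+ (n.-1 - i) * v ^+ i + v ^+ (n.-1 - i) * u ^+ i) =
    (u ^+ i - u ^+ (n.-1 - i)) * (v ^+ i - v ^+ (n.-1 - i)).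
  have -> : (n - i.+1 = n.-1 - i)%N by lia.
  by rewrite !exprMn; ring.
under eq_bigr do rewrite e.
have n0 : (0 < n)%N by lia.
rewrite (bigD1 (Ordinal n0)) //= ltr_pwDl //.
  rewrite subn0 !expr0 mulr_gt0 // subr_gt0 exprn_ilt1 ?ltW //; lia.
apply: sumr_ge0 => i _.
have [h|/ltW h] := leP (i : nat) (n.-1 - i)%N.
  by rewrite mulr_ge0 // subr_ge0 ler_wiXn2l // ltW.
by rewrite mulr_le0 // subr_le0 ler_wiXn2l // ltW.
Qed.

(* The sign of [F y - y] on the branch [y < 1]: the fixed-point equation reads
   [s = (p y - q y^n) / (1 - y^(n+1))], whose right-hand side increases. *)
Lemma fixed_ratio_lt n p q u v : (1 < n)%N -> 0 < q -> q <= p ->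
  0 < u -> u < v -> v < 1 ->
  (p * u - q * u ^+ n) * (1 - v ^+ n.+1) < (p * v - q * v ^+ n) * (1 - u ^+ n.+1).
Proof.
move=> n1 q0 qp u0 uv v1; have v0 : 0 < v by lra.
have u1 : u < 1 by lra.
have key : (v ^+ n - u ^+ n) * (1 - u * v) < (v - u) * (1 - (u * v) ^+ n).
  have -> : 1 - (u * v) ^+ n = (1 - u * v) * \sum_(i < n) (u * v) ^+ i.
    by rewrite -[X in X - _](expr1n _ n) subrXX; congr (_ * _); apply: eq_bigr => i _; rewrite expr1n mul1r.
  rewrite subrXX -/(hsum n v u) mulrAC [ltRHS]mulrA ltr_pM2l; last first.
    by rewrite mulr_gt0 // ?subr_gt0 // mulr_ilt1 // ltW.
  by rewrite hsumC hsum_lt_geom.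
have un : u ^+ n <= v ^+ n by rewrite lerXn // ltW.
rewrite !exprS exprMn in key *; move: key un.
have h1 : 0 < u ^+ n by rewrite exprn_gt0.
move: (u ^+ n) (v ^+ n) h1 => a b a0 key un.
rewrite -subr_gt0.
have -> : (p * v - q * b) * (1 - u * a) - (p * u - q * a) * (1 - v * b) =
  (p - q) * ((v - u) + u * v * (b - a)) + q * ((v - u) * (1 - a * b) - (b - a) * (1 - u * v)) by ring.
rewrite ltr_wpDl //; last by rewrite mulr_gt0 // subr_gt0.
rewrite mulr_ge0 ?subr_ge0 // addr_ge0 ?mulr_ge0 ?subr_ge0 // ltW //.
Qed.

End GeometricSums.

Lemma continuous_le_right (R : realType) (E : R -> R) (a b M : R) :
  a < b -> {for a, continuous E} -> (forall y, a < y < b -> E y <= M) -> E a <= M.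
Proof.
move=> ab Ec h; rewrite leNgt; apply/negP => hM.
have [e /= e0 He] := cvgr_gt _ Ec _ hM.
pose x := Num.min (a + e / 2) ((a + b) / 2).
have xa : a < x by rewrite lt_min; apply/andP; split; lra.
have xe : x <= a + e / 2 by rewrite ge_min lexx.
have xb : x <= (a + b) / 2 by rewrite ge_min lexx orbT.
have := h x; rewrite leNgt He /=; last first.
  by rewrite /ball_ /= ltr0_norm ?subr_lt0 //; lra.
by move=> /(_ _); apply/implyP; lra.
Qed.

Lemma continuous_le_left (R : realType) (E : R -> R) (a b M : R) :
  b < a -> {for a, continuous E} -> (forall y, b < y < a -> E y <= M) -> E a <= M.
Proof.
move=> ab Ec h.
have := @continuous_le_right R (fun x => E (- x)) (- a) (- b) M.
rewrite opprK; apply; first by lra.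
  apply: (@continuous_comp _ _ _ (@GRing.opp R) E); first exact: opp_continuous.
  by rewrite opprK.
by move=> y hy; apply: h; lra.
Qed.

Section FerroMax.
Variables (R : realType) (p s q : R) (D : nat).
Hypotheses (D1 : (1 < D)%N) (s0 : 0 < s) (q0 : 0 < q) (qp : q <= p).
Hypothesis (ferro : s ^+ 2 <= p * q).
Local Notation F := (bpF p s q D).
Local Notation E := (bpE p s q D).

Let p0 : 0 < p := lt_le_trans q0 qp.

Lemma ferro_sp : s <= p.
Proof.
have : s ^+ 2 <= p ^+ 2 by rewrite (le_trans ferro) // [leRHS]expr2 ler_pM2l.
by rewrite ler_pXn2r // nnegrE ltW.
Qed.

(** The left side is [E y^-1] by [bpE_flip], so the maximum may be sought below 1. The denominators
    agree, and [(q + s z, s + p z)] is weakly majorized by [(p + s z, s + q z)] for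
    [z = y ^+ D <= 1]. *)
Lemma bpE_reflect (y : R) : 0 < y -> y <= 1 -> bpE q s p D y <= E y.
Proof.
move=> y0 y1; rewrite /bpE ler_wpM2r //.
  by rewrite invr_ge0 exprn_ge0 // addr_ge0 // exprn_ge0 // ltW.
have sp := ferro_sp.
have : 0 < y ^+ D by rewrite exprn_gt0.
have : y ^+ D <= 1 by rewrite exprn_ile1 // ltW.
move: (y ^+ D) => z z1 z0.
have sz := mulr_ge0 (ltW s0) (ltW z0); have qz := mulr_ge0 (ltW q0) (ltW z0).
have pz := mulr_ge0 (ltW p0) (ltW z0).
have h1 : 0 <= (p - s) * (1 - z) by rewrite mulr_ge0 // subr_ge0.
have h2 : 0 <= (p - q) * (1 - z) by rewrite mulr_ge0 // subr_ge0.
move: s0 q0 qp p0 => s0' q0' qp' p0'.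
by apply: pow_majorize; [lra|lra|lra|lra| |]; rewrite -subr_ge0; [move: h1|move: h2]; rewrite mulrBr mulrBl => ?; lra.
Qed.

(** Below [L] minimality makes [F] increase points, and on [(L, 1)] [fixed_ratio_lt] makes it
    decrease them, so [E] improves towards [L] from both sides. Above 1 there may be further fixed
    points; there [bpE_reflect] compares with [y^-1]. *)
Lemma ferro_max (L : R) : 0 < L -> F L = L ->
  (forall y : R, 0 < y -> F y <= y -> L <= y) ->
  L <= 1 /\ forall y : R, 0 < y -> E y <= E L.
Proof.
move=> L0 FL Lmin.
have Ec (y : R) : 0 < y -> {for y, continuous E}.
  by move=> y0; apply: bpE_continuous => //; exact: ltW.
have EF (y : R) : 0 < y -> E y <= E (F y) by move=> y0; apply: bpE_bpF => //; exact: ltW.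
have Fm (u v : R) : 0 < u -> u <= v -> F u <= F v by apply: bpF_homo => //; exact: ltW.
have L1 : L <= 1.
  apply: Lmin => //; rewrite /bpF !expr1n !mulr1 ler_pdivrMr ?mul1r ?addr_gt0 //.
  by rewrite addrC lerD2r.
have lowE (y : R) : 0 < y -> y <= L -> E y <= E L.
  move=> y0 yL; apply: (@improve_right_max _ F E 0 L); last by lra.
  - move=> x xL; have x0 : 0 < x by lra.
    rewrite -[X in _ <= X]FL Fm //; last by lra.
    by rewrite andbT ltNge; apply/negP => /(Lmin _ x0); lra.
  - by move=> x xL; apply: Ec; lra.
  - by move=> x xL; apply: EF; lra.
have midE (y : R) : L <= y < 1 -> E y <= E L.
  apply: (@improve_left_max _ F E L 1).
  - move=> x xL; have x0 : 0 < x by lra.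
    rewrite -[X in X <= _]FL Fm //=; last by lra.
    have /andP[Lx x1] := xL.
    have := fixed_ratio_lt D1 q0 qp L0 Lx x1.
    have hL : p * L - q * L ^+ D = s * (1 - L ^+ D.+1).
      have := FL; rewrite bpF_eq //; last exact: ltW.
      by rewrite exprS => e; lra.
    rewrite hL -mulrA [X in _ * X]mulrC mulrA ltr_pM2r; last first.
      by rewrite subr_gt0 exprn_ilt1 // ?ltW //; lra.
    have U0 := bpU_gt0 D (ltW p0) s0 x0.
    by rewrite exprS /bpF ltr_pdivrMr //; lra.
  - by move=> x xL; apply: Ec; lra.
  - by move=> x xL; apply: EF; lra.
have leE (y : R) : 0 < y -> y <= 1 -> E y <= E L.
  move=> y0 y1; have [yL|Ly] := leP y L; first exact: lowE.
  have [y1'|y1'] := ltP y 1; first by apply: midE; lra.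
  have -> : y = 1 by lra.
  apply: (@continuous_le_left _ _ _ L); [lra | exact: Ec | move=> x xL; apply: midE; lra].
split=> // y y0; have [y1|y1] := leP y 1; first exact: leE.
have yV : 0 < y^-1 by rewrite invr_gt0.
rewrite -[y]invrK bpE_flip // (le_trans (bpE_reflect _ _)) // ?leE //.
  by rewrite invf_le1 // ltW.
by rewrite invf_le1 // ltW.
Qed.

End FerroMax.

Section AntiMax.
Variables (R : realType) (p s q : R) (D : nat).
Hypotheses (D1 : (1 < D)%N) (p0 : 0 <= p) (s0 : 0 < s) (q0 : 0 < q).
Hypothesis (anti : p * q < s ^+ 2).
Local Notation F := (bpF p s q D).
Local Notation E := (bpE p s q D).

Lemma bpF_nhomo_lt (u v : R) : 0 < u -> u < v -> F v < F u.
Proof.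
move=> u0 uv; have v0 : 0 < v by lra.
rewrite -subr_lt0 (@bpF_sub _ p s q D p0 s0) //.
rewrite pmulr_llt0 ?invr_gt0 ?mulr_gt0 ?bpU_gt0 //.
by rewrite nmulr_rlt0 ?subr_lt0 // subr_gt0 ltrXn ?ltW // ltnW.
Qed.

(* [F] is a Moebius map composed with [y |-> y^D], so it transforms cross ratios
   as [y |-> y^D] does. *)
Lemma bpF_cross (L H y0 y : R) : 0 < L -> 0 < H -> 0 < y0 -> 0 < y ->
  F L = H -> F H = L -> F y0 = y0 ->
  (H - F y) * (y0 - L) ^+ 2 * (H - y) * (hsum D L y0 * hsum D H y) =
  (F y - L) * (H - y0) ^+ 2 * (y - L) * (hsum D L y * hsum D H y0).
Proof.
move=> L0 H0 y00 yy0 FL FH Fy0.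
have sub := @bpF_sub _ p s q D p0 s0.
have e1 := sub L y L0 yy0; have e2 := sub y H yy0 H0.
have e3 := sub y0 H y00 H0; have e4 := sub L y0 L0 y00.
rewrite FL in e1; rewrite FH in e2; rewrite Fy0 FH in e3; rewrite FL Fy0 in e4.
have hU u : 0 < u -> p + s * u ^+ D != 0 by move=> u0; rewrite gt_eqF // bpU_gt0.
have f1 : L ^+ D - y0 ^+ D = (L - y0) * hsum D L y0 by rewrite subrXX.
have f2 : H ^+ D - y ^+ D = (H - y) * hsum D H y by rewrite subrXX.
have f3 : L ^+ D - y ^+ D = (L - y) * hsum D L y by rewrite subrXX.
have f4 : H ^+ D - y0 ^+ D = (H - y0) * hsum D H y0 by rewrite subrXX.
transitivity (- (H - F y) * (y0 - L) * ((L ^+ D - y0 ^+ D) * (H ^+ D - y ^+ D))).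
  by rewrite f1 f2; ring.
transitivity (- (F y - L) * (H - y0) * ((L ^+ D - y ^+ D) * (H ^+ D - y0 ^+ D))); last first.
  by rewrite f3 f4; ring.
rewrite e1 e2 e3 e4.
have := hU L L0; have := hU H H0; have := hU y yy0; have := hU y0 y00.
move: (L ^+ D) (H ^+ D) (y ^+ D) (y0 ^+ D) => a b c e n1 n2 n3 n4.
by field; rewrite n1 n2 n3 n4.
Qed.

(** Let [r x = (x - L) * (H - y0) / ((H - x) * (y0 - L))], an increasing function on [(L, H)]. By
    [bpF_cross] and [hsum_submod], [r y * r w < 1] because [y > y0] (this is [k1]), and
    [r w * r w' > 1] because [w < y0] (this is [k3]). Hence [r w' > r y]. *)
Lemma bpF2_gt (L H y0 y : R) : 0 < L -> L < y0 -> y0 < y -> y < H ->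
  F L = H -> F H = L -> F y0 = y0 -> y < F (F y).
Proof.
move=> L0 Ly0 y0y yH FL FH Fy0.
have y00 : 0 < y0 by lra.
have yy0 : 0 < y by lra.
have H0 : 0 < H by lra.
set w := F y.
have w1 : L < w by rewrite -FH bpF_nhomo_lt.
have w2 : w < y0 by rewrite -Fy0 bpF_nhomo_lt.
have w0 : 0 < w by lra.
set w' := F w.
have w'1 : w' < H by rewrite -FL bpF_nhomo_lt.
have c1 := bpF_cross L0 H0 y00 yy0 FL FH Fy0.
have c2 := bpF_cross L0 H0 y00 w0 FL FH Fy0.
rewrite -/w in c1; rewrite -/w' in c2.
have s1 := @hsum_submod _ D L y0 y H D1 L0 ltac:(lra) y00 y0y.
have s2 := @hsum_submod _ D L w y0 H D1 L0 ltac:(lra) w0 w2.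
have D0 : (0 < D)%N := ltnW D1.
have k1 : (w - L) * (H - y0) ^+ 2 * (y - L) < (H - w) * (y0 - L) ^+ 2 * (H - y).
  set a := (X in X < _); set b := (X in _ < X).
  rewrite -/a -/b in c1.
  have a0 : 0 < a by rewrite !mulr_gt0 ?exprn_gt0 ?subr_gt0 //; lra.
  rewrite ltNge; apply/negP => ba.
  have h0 : 0 < hsum D L y0 * hsum D H y by rewrite mulr_gt0 // hsum_gt0.
  have : b * (hsum D L y0 * hsum D H y) < a * (hsum D L y * hsum D H y0).
    apply: le_lt_trans (_ : a * (hsum D L y0 * hsum D H y) < _).
      by rewrite ler_pM2r.
    by rewrite ltr_pM2l.
  by rewrite c1 ltxx.
have k2 : y0 < w' by rewrite -Fy0 bpF_nhomo_lt.
have k3 : (H - w') * (y0 - L) ^+ 2 * (H - w) < (w' - L) * (H - y0) ^+ 2 * (w - L).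
  set b := (X in X < _); set a := (X in _ < X).
  rewrite -/a -/b in c2.
  have b0 : 0 < b by rewrite !mulr_gt0 ?exprn_gt0 ?subr_gt0 //; lra.
  rewrite ltNge; apply/negP => ab.
  have h0 : 0 < hsum D L w * hsum D H y0 by rewrite mulr_gt0 // hsum_gt0.
  have : a * (hsum D L w * hsum D H y0) < b * (hsum D L y0 * hsum D H w).
    apply: le_lt_trans (_ : b * (hsum D L w * hsum D H y0) < _).
      by rewrite ler_pM2r.
    by rewrite ltr_pM2l.
  by rewrite c2 ltxx.
rewrite ltNge; apply/negP => w'y.
have A0 : 0 < (y0 - L) ^+ 2 * (H - w) by rewrite mulr_gt0 ?exprn_gt0 ?subr_gt0 //; lra.
have B0 : 0 < (H - y0) ^+ 2 * (w - L) by rewrite mulr_gt0 ?exprn_gt0 ?subr_gt0 //; lra.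
have := ler_wpM2l (ltW A0) (_ : H - y <= H - w').
have := ler_wpM2l (ltW B0) (_ : w' - L <= y - L).
move=> /(_ ltac:(lra)) i1 /(_ ltac:(lra)) i2; lra.
Qed.

(** Outside [[L, H]] extremality makes [F o F] push points towards the cycle. Inside, the
    intermediate value theorem gives a fixed point [z] of [F]; above [z], [bpF2_gt] pushes towards
    [H], and below [z] one application of [F] lands above it. [F] only improves [E], so [E] agrees
    at both ends of the cycle. *)
Lemma anti_max (L H : R) : 0 < L -> L <= H -> F L = H -> F H = L ->
  (forall y : R, 0 < y -> F (F y) <= y -> L <= y) ->
  (forall y : R, 0 < y -> y <= F (F y) -> y <= H) ->
  E L = E H /\ forall y : R, 0 < y -> E y <= E H.
Proof.
move=> L0 LH FL FH Lmin Hmax; have H0 : 0 < H by lra.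
have Ec (y : R) : 0 < y -> {for y, continuous E}.
  by move=> y0; apply: bpE_continuous => //; exact: ltW.
have Fp (y : R) : 0 < y -> 0 < F y by move=> y0; apply: bpF_gt0 => //; exact: ltW.
have EF (y : R) : 0 < y -> E y <= E (F y) by move=> y0; apply: bpE_bpF => //; exact: ltW.
have EG (y : R) : 0 < y -> E y <= E (F (F y)).
  by move=> y0; apply: le_trans (EF _ y0) (EF _ (Fp _ y0)).
have Fm (u v : R) : 0 < u -> u <= v -> F v <= F u.
  by apply: bpF_nhomo => //; exact: ltW.
have Gm (u v : R) : 0 < u -> u <= v -> F (F u) <= F (F v).
  by move=> u0 uv; apply: (Fm); [apply: Fp; lra | exact: Fm].
have ELH : E L = E H.
  by have h1 := EF _ L0; have h2 := EF _ H0; rewrite FL FH in h1 h2; apply: le_anti; rewrite h1 h2.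
have GL : F (F L) = L by rewrite FL.
have GH : F (F H) = H by rewrite FH.
have hiE (y : R) : H <= y -> E y <= E H.
  move=> Hy; apply: (@improve_left_max _ (F \o F) E H (y + 1)); last by lra.
  - move=> x hx; have x0 : 0 < x by lra.
    rewrite /= -[X in X <= _]GH Gm //=; last by lra.
    by rewrite ltNge; apply/negP => /(Hmax _ x0); lra.
  - by move=> x hx; apply: Ec; lra.
  - by move=> x hx; apply: EG; lra.
have loE (y : R) : 0 < y -> y <= L -> E y <= E H.
  move=> y0 yL; rewrite -ELH.
  apply: (@improve_right_max _ (F \o F) E 0 L); last by lra.
  - move=> x hx; have x0 : 0 < x by lra.
    rewrite /= -[X in _ <= X]GL Gm //; last by lra.
    by rewrite andbT ltNge; apply/negP => /(Lmin _ x0); lra.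
  - by move=> x hx; apply: Ec; lra.
  - by move=> x hx; apply: EG; lra.
split=> // y y0.
have [yL|Ly] := leP y L; first exact: loE.
have [Hy|yH] := leP H y; first exact: hiE.
have [z zLH Fz] : exists2 z : R, z \in `[L, H]%R & F z - z = 0.
  apply: (@IVT R (fun x => F x - x) L H 0 LH); last first.
    by rewrite FL FH ge_min le_max; apply/andP; split; apply/orP; [right|left]; lra.
  apply: continuous_in_subspaceT => x; rewrite inE /= in_itv /= => hx.
  apply: continuousB; last exact: cvg_id.
  by apply: bpF_continuous => //; lra.
have {}Fz : F z = z by lra.
move: zLH; rewrite in_itv /= => zLH.
have zL : z != L by apply/eqP => e; move: Fz; rewrite e FL; lra.
have Lz : L < z by rewrite lt_neqAle eq_sym zL; lra.
have zH : z < H.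
  by rewrite -Fz -FL bpF_nhomo_lt.
have z0 : 0 < z by lra.
have rE (x : R) : z < x <= H -> E x <= E H.
  apply: (@improve_right_max _ (F \o F)).
  - move=> t ht /=; rewrite (@bpF2_gt L H z) //; try lra.
    by rewrite -[X in _ <= X]GH Gm //; lra.
  - by move=> t ht; apply: Ec; lra.
  - by move=> t ht; apply: EG; lra.
have zE : E z <= E H.
  by apply: (@continuous_le_right _ _ _ H) => // [|x hx]; [exact: Ec | apply: rE; lra].
have rE' (x : R) : z <= x <= H -> E x <= E H.
  by move=> hx; have [xz|xz] := leP x z; [have -> : x = z by lra | apply: rE; lra].
have [yz|zy] := leP y z; last by apply: rE; lra.
apply: le_trans (EF _ y0) _; apply: rE'.
by rewrite -[X in X <= _]Fz -FL !Fm //; lra.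
Qed.

End AntiMax.

(* Where [x] is the geometric mean of the message ratios at a star, [bpg] is the value
   of the disagreement sum minimised by AM-GM in [star_bound]. *)
Definition bpg (R : realType) (p q : R) (D : nat) (x : R) : R :=
  (p * x + q * x ^+ D) / (1 + x ^+ D.+1).

(* The derivative of [ln (bpE p s q D y) / 2] in [ln s]. *)
Definition bpslope (R : realType) (p s q : R) (D : nat) (y : R) : R :=
  (D.+1)%:R / 2 *
  (s * ((p + s * y ^+ D) ^+ D * y ^+ D + (s + q * y ^+ D) ^+ D) /
   ((p + s * y ^+ D) ^+ D.+1 + (s + q * y ^+ D) ^+ D.+1)).

(** * Disagreement at a star and the Bethe slope *)

Section EdgeFunction.
Variables (R : realType) (p q : R) (D : nat).
Hypotheses (D0 : (0 < D)%N) (p0 : 0 <= p) (q0 : 0 <= q).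
Local Notation g := (bpg p q D).

Let den (x : R) : 0 < x -> 0 < 1 + x ^+ D.+1.
Proof. by move=> x0; rewrite addr_gt0 // exprn_gt0. Qed.

Lemma bpg_ge0 (x : R) : 0 < x -> 0 <= g x.
Proof.
move=> x0; apply: divr_ge0; last exact/ltW/den.
by rewrite addr_ge0 // mulr_ge0 // ?exprn_ge0 // ltW.
Qed.

Lemma bpg_sub (u v : R) : 0 < u -> 0 < v ->
  g u - g v = (u - v) * (p * (1 - u * v * hsum D u v) + q * (hsum D u v - u ^+ D * v ^+ D)) /
    ((1 + u ^+ D.+1) * (1 + v ^+ D.+1)).
Proof.
move=> u0 v0; have hu := den u0; have hv := den v0.
have e : u ^+ D - v ^+ D = (u - v) * hsum D u v by rewrite subrXX.
transitivity ((p * ((u - v) - u * v * (u ^+ D - v ^+ D)) +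
    q * ((u ^+ D - v ^+ D) - u ^+ D * v ^+ D * (u - v))) / ((1 + u ^+ D.+1) * (1 + v ^+ D.+1))).
  move: hu hv; rewrite /bpg !exprS; move: (u ^+ D) (v ^+ D) => a b hu hv.
  by field; rewrite !gt_eqF.
by congr (_ / _); rewrite e; ring.
Qed.

(** Were [g x] below both ends, the bracket in [bpg_sub] would be negative for the pair [(x, l)] and
    positive for [(h, x)]. Divided by its factor [hsum], however, the bracket decreases from the
    first pair to the second. *)
Lemma bpg_quasiconcave (l x h : R) : 0 < l -> l <= x -> x <= h ->
  Num.min (g l) (g h) <= g x.
Proof.
move=> l0 lx xh; have x0 : 0 < x by lra.
have h0 : 0 < h by lra.
rewrite leNgt; apply/negP; rewrite lt_min => /andP[gl gh].
have nlx : x != l by apply/eqP => e; rewrite e ltxx in gl.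
have nxh : h != x by apply/eqP => e; rewrite e ltxx in gh.
have {nlx} lx' : 0 < x - l by rewrite subr_gt0 lt_neqAle eq_sym nlx.
have {nxh} xh' : 0 < h - x by rewrite subr_gt0 lt_neqAle eq_sym nxh.
have dn (u v : R) : 0 < u -> 0 < v -> 0 < ((1 + u ^+ D.+1) * (1 + v ^+ D.+1))^-1.
  by move=> u0 v0; rewrite invr_gt0 mulr_gt0 // den.
move: gl gh; rewrite -subr_lt0 bpg_sub // pmulr_llt0 ?dn // pmulr_rlt0 //.
rewrite -[g x < _]subr_gt0 bpg_sub // pmulr_lgt0 ?dn // pmulr_rgt0 //.
set S1 := hsum D x l; set S2 := hsum D h x.
have S10 : 0 < S1 by rewrite hsum_gt0.
have S20 : 0 < S2 by rewrite hsum_gt0.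
have S12 : S1 <= S2 by rewrite hsum_le // ltW.
have lS : l ^+ D * S2 <= h ^+ D * S1.
  rewrite /S1 hsumC /S2 /hsum !mulr_sumr; apply: ler_sum => i _.
  rewrite !mulrA ler_wpM2r ?exprn_ge0 ?(ltW x0) //.
  have e (a b : R) : a ^+ D * b ^+ (D.-1 - i) = a ^+ i.+1 * (a * b) ^+ (D.-1 - i).
    by rewrite exprMn mulrA -exprD; congr (_ ^+ _ * _); have := ltn_ord i; clear -D0; lia.
  rewrite e [leRHS]e [h * l]mulrC ler_wpM2r ?exprn_ge0 ?mulr_ge0 ?(ltW l0) ?(ltW h0) //.
  by rewrite lerXn ?(ltW l0) //; lra.
have xD0 : 0 < x ^+ D by rewrite exprn_gt0.
move: lS xD0; move: (l ^+ D) (x ^+ D) (h ^+ D) => a b c lS b0 m1 m2.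
have {m1} : (p * (1 - x * l * S1) + q * (S1 - b * a)) * S2 < 0 by rewrite pmulr_llt0.
have {m2} : 0 < (p * (1 - h * x * S2) + q * (S2 - c * b)) * S1 by rewrite mulr_gt0.
have t1 : 0 <= p * (S2 - S1) by rewrite mulr_ge0 // subr_ge0.
have t2 : 0 <= p * (x * (h - l) * (S1 * S2)).
  by rewrite !mulr_ge0 // ?ltW //; lra.
have t3 : 0 <= q * (b * (c * S1 - a * S2)).
  by apply: mulr_ge0 => //; apply: mulr_ge0; [exact: ltW | rewrite subr_ge0].
move=> *; lra.
Qed.

Lemma AGM_pow n (x : 'I_n -> R) (X : R) : (0 < n)%N -> (forall i, 0 < x i) -> 0 < X ->
  X ^+ n = \prod_i x i -> n%:R * X <= \sum_i x i.
Proof.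
move=> n0 x0 X0 Xn.
have := (leif_AGM (A := [pred i : 'I_n | true]) (E := x) (fun i _ => ltW (x0 i))).1.
rewrite /= card_ord.
have -> : \prod_(i in [pred i : 'I_n | true]) x i = X ^+ n by rewrite Xn; apply: eq_bigl.
have -> : \sum_(i in [pred i : 'I_n | true]) x i = \sum_i x i by apply: eq_bigl.
have s0 : 0 <= \sum_i x i by apply: sumr_ge0 => i _; exact: ltW.
rewrite ler_pXn2r ?nnegrE ?(ltW X0) ?divr_ge0 //.
by rewrite ler_pdivlMr ?ltr0n // mulrC.
Qed.

Lemma nth_root_exists n (a : R) : (0 < n)%N -> 0 < a -> exists2 X : R, 0 < X & X ^+ n = a.
Proof.
move=> n0 a0; exists (expR (ln a / n%:R)); first exact: expR_gt0.
by rewrite -expRM_natl mulrC divfK ?lnK ?posrE // pnatr_eq0 -lt0n.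
Qed.

(* The conditional law of a vertex and its neighbours given the outside has
   messages [(a i, b i)]. By AM-GM the number of disagreeing edges is extremal
   when all ratios [V i / U i] agree. *)
Lemma star_bound (s l h : R) (a b : 'I_D.+1 -> R) :
  let U i := p * a i + s * b i in let V i := s * a i + q * b i in
  0 < s -> 0 < l -> (forall i, 0 <= a i) -> (forall i, 0 <= b i) ->
  (forall i, l * U i <= V i) -> (forall i, V i <= h * U i) ->
  (D.+1)%:R * (s * (Num.min (g l) (g h) - s)) * (\prod_i U i + \prod_i V i) <=
  (p * q - s ^+ 2) * \sum_i (s * b i * \prod_(j | j != i) U j +
                             s * a i * \prod_(j | j != i) V j).
Proof.
move=> U V s0 l0 a0 b0 lo hi.
have U0 i : 0 <= U i by rewrite addr_ge0 // mulr_ge0 // ltW.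
have V0 i : 0 <= V i by rewrite addr_ge0 // mulr_ge0 // ltW.
(* If some [U k] vanishes then so do [V k] and both messages at [k], and each side of the inequality
   is zero. *)
have [[k Uk]|allU] := pselect (exists k, U k = 0).
  have Vk : V k = 0 by apply: le_anti; rewrite V0 (le_trans (hi k)) // Uk mulr0.
  have bk : s * b k = 0.
    have h1 := mulr_ge0 p0 (a0 k); have h2 := mulr_ge0 (ltW s0) (b0 k).
    by apply: le_anti; rewrite h2 andbT; move: Uk; rewrite /U; lra.
  have ak : s * a k = 0.
    have h1 := mulr_ge0 q0 (b0 k); have h2 := mulr_ge0 (ltW s0) (a0 k).
    by apply: le_anti; rewrite h2 andbT; move: Vk; rewrite /V; lra.
  rewrite (bigD1 k) //= Uk mul0r (bigD1 k) //= Vk mul0r addr0 mulr0.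
  rewrite big1 ?mulr0 // => i _.
  have [->|ik] := eqVneq i k; first by rewrite bk ak !mul0r addr0.
  by rewrite (bigD1 k) 1?eq_sym //= Uk mul0r (bigD1 k) 1?eq_sym //= Vk mul0r !mulr0 addr0.
have {}U0 i : 0 < U i.
  by rewrite lt_neqAle U0 andbT eq_sym; apply/eqP => e; apply: allU; exists i.
have {}V0 i : 0 < V i by apply: lt_le_trans (lo i); rewrite mulr_gt0.
pose x i := V i / U i.
have x0 i : 0 < x i by rewrite divr_gt0.
have lx i : l <= x i by rewrite ler_pdivlMr.
have xh i : x i <= h by rewrite ler_pdivrMr.
have PU0 : 0 < \prod_i U i by apply: prodr_gt0.
have Px0 : 0 < \prod_i x i by apply: prodr_gt0.
have [X X0 Xn] := nth_root_exists (ltn0Sn D) Px0.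
have PV : \prod_i V i = X ^+ D.+1 * \prod_i U i.
  by rewrite Xn -big_split /=; apply: eq_bigr => i _; rewrite /x divfK // gt_eqF.
have constn (c : R) : \prod_(i < D.+1) c = c ^+ D.+1 by rewrite prodr_const card_ord.
have lX : l <= X.
  suff : l ^+ D.+1 <= X ^+ D.+1 by rewrite ler_pXn2r // nnegrE ltW.
  by rewrite Xn -constn; apply: ler_prod => i _; rewrite lx ltW.
have h0 : 0 < h by apply: lt_le_trans (x0 ord0) (xh ord0).
have Xh : X <= h.
  suff : X ^+ D.+1 <= h ^+ D.+1 by rewrite ler_pXn2r // nnegrE ltW.
  by rewrite Xn -constn; apply: ler_prod => i _; rewrite xh ltW.
have gX := bpg_quasiconcave l0 lX Xh.
set c := Num.min _ _ in gX *.
have A1 := AGM_pow (ltn0Sn D) x0 X0 Xn.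
have A2 : (D.+1)%:R * X^-1 <= \sum_i (x i)^-1.
  apply: AGM_pow => //; first by move=> i; rewrite invr_gt0.
    by rewrite invr_gt0.
  by rewrite exprVn Xn prodfV.
have -> : (p * q - s ^+ 2) * \sum_i (s * b i * \prod_(j | j != i) U j +
                             s * a i * \prod_(j | j != i) V j) =
   s * (p * \prod_i U i * \sum_i x i + q * \prod_i V i * \sum_i (x i)^-1
        - s * (D.+1)%:R * (\prod_i U i + \prod_i V i)).
  (* The determinant inverts the passage from messages to [U], [V]: [(p * q - s ^+ 2) * b i = p * V
     i - s * U i], and likewise for [a i]. Keeping it as a factor serves both signs at once. *)
  have e i : (p * q - s ^+ 2) * (s * b i * \prod_(j | j != i) U j +
                             s * a i * \prod_(j | j != i) V j) =
     s * (p * \prod_i U i * x i + q * \prod_i V i * (x i)^-1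
        - s * (\prod_i U i + \prod_i V i)).
    rewrite [\prod_i U i](bigD1 i) //= [\prod_i V i](bigD1 i) //= /x.
    move: (\prod_(j | j != i) U j) (\prod_(j | j != i) V j) => PU' PV'.
    have Un : U i != 0 by rewrite gt_eqF.
    have Vn : V i != 0 by rewrite gt_eqF.
    transitivity (s * ((p * V i - s * U i) * PU' + (q * U i - s * V i) * PV')).
      by rewrite /U /V; ring.
    by move: (U i) (V i) Un Vn => u v un vn; field; rewrite un vn.
  rewrite mulr_sumr (eq_bigr _ (fun i _ => e i)) -mulr_sumr sumrB big_split /=.
  by rewrite -!mulr_sumr sumr_const card_ord -mulr_natl; ring.
have PV0 : 0 < \prod_i V i by apply: prodr_gt0.
have i1 := ler_wpM2l (mulr_ge0 p0 (ltW PU0)) A1.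
have i2 := ler_wpM2l (mulr_ge0 q0 (ltW PV0)) A2.
have -> : (D.+1)%:R * (s * (c - s)) * (\prod_i U i + \prod_i V i) =
  s * ((D.+1)%:R * (c - s) * (\prod_i U i + \prod_i V i)).
  by move: (\prod_i U i) (\prod_i V i) (D.+1%:R) => *; ring.
rewrite ler_pM2l //.
have i3 : c * (1 + X ^+ D.+1) <= p * X + q * X ^+ D.
  by rewrite -ler_pdivlMr ?den.
have i4 := ler_wpM2l (mulr_ge0 (ler0n R D.+1) (ltW PU0)) i3.
have e5 : q * \prod_i V i * ((D.+1)%:R * X^-1) = (D.+1)%:R * \prod_i U i * (q * X ^+ D).
  by rewrite PV exprS; field; rewrite gt_eqF.
rewrite e5 in i2; rewrite PV in i2 *; move: i1 i2 i4.
move: (\prod_i U i) (X ^+ D.+1) (X ^+ D) (\sum_i x i) (\sum_i (x i)^-1) (D.+1%:R) => *.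
lra.
Qed.

End EdgeFunction.

(** Multiplied by [p + s * v ^+ D], numerator and denominator of [bpg] at [u] become symmetric in
    the two points of the cycle. Both ends of the limiting box thus give the same AM-GM bound. *)
Lemma bpg_anti (R : realType) (p s q : R) D (y1 y2 : R) : 0 <= p -> 0 < s -> 0 <= q ->
  0 < y1 -> 0 < y2 -> bpF p s q D y1 = y2 -> bpF p s q D y2 = y1 ->
  bpg p q D y1 = bpg p q D y2.
Proof.
move=> p0 s0 q0.
suff key (u v : R) : 0 < u -> 0 < v -> bpF p s q D v = u ->
    bpg p q D u = (p * s + p * q * (u ^+ D + v ^+ D) + q * s * (u ^+ D * v ^+ D)) /
                  (p + s * (u ^+ D + v ^+ D) + q * (u ^+ D * v ^+ D)).
  move=> h1 h2 e1 e2; rewrite (key y1 y2) // (key y2 y1) //.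
  by rewrite [y1 ^+ D + _]addrC [y1 ^+ D * _]mulrC.
move=> u0 v0; rewrite bpF_eq // /bpg exprS.
have : 0 < u ^+ D by rewrite exprn_gt0.
have : 0 < v ^+ D by rewrite exprn_gt0.
move: (u ^+ D) (v ^+ D) => a b b0 a0 e.
have M0 : 0 < p + s * (a + b) + q * (a * b).
  by have := mulr_gt0 s0 (addr_gt0 a0 b0); have := mulr_ge0 q0 (mulr_ge0 (ltW a0) (ltW b0)); lra.
have Mn : p + s * (a + b) + q * (a * b) != 0 by rewrite gt_eqF.
have Nn : 1 + u * a != 0 by rewrite gt_eqF // addr_gt0 // mulr_gt0.
apply/eqP; rewrite eqr_div //; apply/eqP.
have U0 : 0 < p + s * b by rewrite ltr_wpDl // mulr_gt0.
have -> : p + s * (a + b) + q * (a * b) = (p + s * b) * (1 + u * a).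
  have -> : (p + s * b) * (1 + u * a) = (p + s * b) + a * (u * (p + s * b)) by ring.
  by rewrite -e; ring.
have -> : p * s + p * q * (a + b) + q * s * (a * b) = (p + s * b) * (p * u + q * a).
  have -> : (p + s * b) * (p * u + q * a) = p * (u * (p + s * b)) + q * a * (p + s * b) by ring.
  by rewrite -e; ring.
by ring.
Qed.

(** At a fixed point, [bpg] squared equals [s ^+ 2 + 4 * (p * q - s ^+ 2) * w / (1 + w) ^+ 2] with
    [w = y ^+ D.+1], where [w / (1 + w) ^+ 2] is invariant under inversion and increasing up to
    [w = 1]. As [F H^-1 <= H^-1] gives [L * H <= 1], the maximiser [L] is the end that determines
    the minimum in [star_bound]. *)
Lemma bpg_ferro (R : realType) (p s q : R) D (L H : R) : 0 < s -> 0 < q -> q <= p ->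
  s ^+ 2 <= p * q -> 0 < L -> L <= H -> bpF p s q D L = L -> bpF p s q D H = H ->
  (forall y : R, 0 < y -> bpF p s q D y <= y -> L <= y) ->
  bpg p q D L <= bpg p q D H.
Proof.
move=> s0 q0 qp k L0 LH FL FH Lmin; have H0 : 0 < H by lra.
have p0 : 0 < p by lra.
have eH : s + q * H ^+ D = H * (p + s * H ^+ D) by apply/bpF_eq => //; exact: ltW.
have LH1 : L <= H^-1.
  apply: Lmin; first by rewrite invr_gt0.
  have F0 : 0 < bpF q s p D H by apply: bpF_gt0 => //; exact: ltW.
  rewrite bpF_flip // lef_pV2 ?posrE //.
  have Hp : 0 < H ^+ D by rewrite exprn_gt0.
  rewrite /bpF ler_pdivlMr; last by rewrite addr_gt0 // mulr_gt0.
  have : 0 <= (p - q) * (H + H ^+ D) by rewrite mulr_ge0 ?subr_ge0 // addr_ge0 // ltW.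
  by lra.
have sq (y : R) : 0 < y -> bpF p s q D y = y ->
    bpg p q D y ^+ 2 = s ^+ 2 + 4 * (p * q - s ^+ 2) * (y ^+ D.+1 / (1 + y ^+ D.+1) ^+ 2).
  move=> y0 Fy.
  have e : s + q * y ^+ D = y * (p + s * y ^+ D) by apply/bpF_eq => //; exact: ltW.
  have d0 : 0 < 1 + y ^+ D.+1 by rewrite addr_gt0 // exprn_gt0.
  have e2 : (p * y + q * y ^+ D) ^+ 2 = (s * (1 - y ^+ D.+1)) ^+ 2 + 4 * (p * q) * y ^+ D.+1.
    have -> : s * (1 - y ^+ D.+1) = p * y - q * y ^+ D by rewrite exprS; lra.
    by rewrite [y ^+ D.+1]exprS; ring.
  rewrite /bpg expr_div_n e2; move: (y ^+ D.+1) d0 => w d0.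
  by field; rewrite gt_eqF.
suff : bpg p q D L ^+ 2 <= bpg p q D H ^+ 2.
  by rewrite ler_pXn2r // nnegrE bpg_ge0 // ltW.
rewrite !sq //.
rewrite lerD2l ler_wpM2l ?mulr_ge0 ?subr_ge0 //.
have w1 : 0 < L ^+ D.+1 by rewrite exprn_gt0.
have w2 : L ^+ D.+1 <= H ^+ D.+1 by rewrite lerXn // ltW.
have w3 : L ^+ D.+1 * H ^+ D.+1 <= 1.
  have LH2 : L * H <= 1.
    by have := LH1; rewrite -(ler_pM2r H0) mulVf // gt_eqF.
  by rewrite -exprMn exprn_ile1 // mulr_ge0 // ltW.
move: (L ^+ D.+1) (H ^+ D.+1) w1 w2 w3 => a b a0 ab ab1.
rewrite ler_pdivrMr ?exprn_gt0 //; last lra.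
rewrite mulrAC ler_pdivlMr ?exprn_gt0 //; last lra.
have : 0 <= (b - a) * (1 - a * b) by rewrite mulr_ge0 // subr_ge0.
by rewrite !expr2; lra.
Qed.

(** Here the AM-GM bound is seen to be sharp: the right side is half the value in [star_bound], each
    edge being counted at both ends. *)
Lemma bpslope_fix (R : realType) (p s q : R) D (y y' : R) : 0 <= p -> 0 < s -> 0 <= q ->
  0 < y -> 0 < y' -> bpF p s q D y = y' ->
  (p * q - s ^+ 2) * bpslope p s q D y = (D.+1)%:R / 2 * (s * (bpg p q D y' - s)).
Proof.
move=> p0 s0 q0 yp yp' Fy.
rewrite /bpslope [LHS]mulrCA; congr (_ * _).
have U0 := bpU_gt0 D p0 s0 yp.
have eV : s + q * y ^+ D = y' * (p + s * y ^+ D) by apply/bpF_eq.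
rewrite eV /bpg.
have d0 : 0 < 1 + y' ^+ D.+1 by rewrite addr_gt0 // exprn_gt0.
have k1 : (p * q - s ^+ 2) * y ^+ D = (p + s * y ^+ D) * (p * y' - s).
  have -> : (p + s * y ^+ D) * (p * y' - s) = p * (y' * (p + s * y ^+ D)) - s * (p + s * y ^+ D) by ring.
  by rewrite -eV; ring.
have k2 : (p * q - s ^+ 2) = (p + s * y ^+ D) * (q - s * y').
  have -> : (p + s * y ^+ D) * (q - s * y') = q * (p + s * y ^+ D) - s * (y' * (p + s * y ^+ D)) by ring.
  by rewrite -eV; ring.
clear eV Fy.
move: (y ^+ D) U0 k1 k2 => z U0 k1 k2.
rewrite !exprMn.
transitivity (s * (((p * q - s ^+ 2) * z) + (p * q - s ^+ 2) * y' ^+ D) * (p + s * z) ^+ D /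
   ((p + s * z) ^+ D.+1 + y' ^+ D.+1 * (p + s * z) ^+ D.+1)).
  by rewrite mulrA; congr (_ / _); ring.
rewrite k1 k2; move: (p + s * z) U0 => u U0.
have un : u ^+ D != 0 by rewrite expf_neq0 // gt_eqF.
rewrite !exprS in d0 *; move: (u ^+ D) (y' ^+ D) un d0 => v w un d0.
have -> : u * v + y' * w * (u * v) = u * v * (1 + y' * w) by ring.
have u0 : u != 0 by rewrite gt_eqF.
have d1 : 1 + y' * w != 0 by rewrite gt_eqF.
by field; rewrite un u0 d1.
Qed.

Lemma expR_jensen2 (R : realType) (a b x y : R) : 0 <= a -> 0 <= b -> 0 < a + b ->
  (a + b) * expR ((a * x + b * y) / (a + b)) <= a * expR x + b * expR y.
Proof.
move=> a0 b0 ab; set m := _ / _.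
have em : m * (a + b) = a * x + b * y by rewrite divfK // gt_eqF.
have k (t : R) : expR m * (1 + (t - m)) <= expR t.
  by rewrite -[X in _ <= expR X](subrKC m) expRD ler_pM2l ?expR_gt0 // expR_ge1Dx.
have h1 := ler_wpM2l a0 (k x); have h2 := ler_wpM2l b0 (k y).
apply: le_trans (lerD h1 h2).
have -> : a * (expR m * (1 + (x - m))) + b * (expR m * (1 + (y - m))) =
  expR m * ((a + b) + (a * x + b * y - m * (a + b))) by ring.
by rewrite em subrr addr0 mulrC.
Qed.

(** For fixed [y], [ln (bpE p s q D y)] is convex in [ln s]: Jensen inside each of [U] and [V], then
    between their powers, gives the tangent line directly. *)
Lemma bpE_convex (R : realType) (p s q : R) D (y t : R) : 0 <= p -> 0 < s -> 0 <= q ->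
  0 < y -> ln (bpE p s q D y) / 2 + t * bpslope p s q D y <=
  ln (bpE p (s * expR t) q D y) / 2.
Proof.
move=> p0 s0 q0 y0.
have s1 : 0 < s * expR t by rewrite mulr_gt0 ?expR_gt0.
have U0 := bpU_gt0 D p0 s0 y0; have V0 := bpV_gt0 D s0 q0 y0.
have z0 : 0 < y ^+ D by rewrite exprn_gt0.
suff : bpE p s q D y * expR (2 * (t * bpslope p s q D y)) <= bpE p (s * expR t) q D y.
  have E1 : 0 < bpE p s q D y by apply: bpE_gt0.
  have E2 : 0 < bpE p (s * expR t) q D y by apply: bpE_gt0.
  have e0 := expR_gt0 (2 * (t * bpslope p s q D y)).
  rewrite -ler_ln ?posrE //; last by rewrite mulr_gt0.
  by rewrite lnM ?posrE // expRK; lra.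
have d0 : 0 <= ((1 + y ^+ D.+1) ^+ D)^-1.
  by rewrite invr_ge0 exprn_ge0 // addr_ge0 // exprn_ge0 // ltW.
rewrite /bpE mulrAC ler_wpM2r //.
rewrite /bpslope; move: (y ^+ D) z0 U0 V0 => z z0 U0 V0.
set U := p + s * z in U0 *; set V := s + q * z in V0 *.
have sz : 0 < s * z by rewrite mulr_gt0.
have j1 : U * expR (s * z * t / U) <= p + s * expR t * z.
  have := @expR_jensen2 R p (s * z) 0 t p0 (ltW sz) U0.
  by rewrite mulr0 add0r expR0 mulr1 -/U mulrAC [s * expR t * z]mulrAC.
have j2 : V * expR (s * t / V) <= s * expR t + q * z.
  have qz : 0 <= q * z by rewrite mulr_ge0 // ltW.
  have := @expR_jensen2 R s (q * z) t 0 (ltW s0) qz V0.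
  by rewrite mulr0 addr0 expR0 mulr1 -/V.
have N0 : 0 < U ^+ D.+1 + V ^+ D.+1 by rewrite addr_gt0 // exprn_gt0.
have := @expR_jensen2 R (U ^+ D.+1) (V ^+ D.+1) ((D.+1)%:R * (s * z * t / U)) ((D.+1)%:R * (s * t / V))
  (exprn_ge0 _ (ltW U0)) (exprn_ge0 _ (ltW V0)) N0.
have -> : (U ^+ D.+1 * ((D.+1)%:R * (s * z * t / U)) + V ^+ D.+1 * ((D.+1)%:R * (s * t / V))) /
   (U ^+ D.+1 + V ^+ D.+1) =
   2 * (t * ((D.+1)%:R / 2 * (s * (U ^+ D * z + V ^+ D) / (U ^+ D.+1 + V ^+ D.+1)))).
  move: N0; rewrite !exprS; move: (U ^+ D) (V ^+ D) => A B N0.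
  by field; rewrite !gt_eqF.
move=> h; apply: le_trans h _.
rewrite !expRM_natl -!exprMn lerD // lerXn // mulr_ge0 ?expR_ge0 // ltW //.
Qed.

(** Sharp to leading order at the far ends of both paths: for [s -> 0] it matches a constant
    configuration, for [s -> oo] an alternating one. *)
Lemma bpE_ub (R : realType) (p s q m : R) D (y : R) : (0 < D)%N -> 0 <= p -> 0 < s -> 0 <= q ->
  p <= m -> q <= m -> 0 < y -> bpE p s q D y <= (s + m) ^+ D.+1.
Proof.
move=> D0 p0 s0 q0 pm qm y0; have m0 : 0 <= m by lra.
have d0 : 0 < 1 + y ^+ D.+1 by rewrite addr_gt0 // exprn_gt0.
rewrite /bpE ler_pdivrMr ?exprn_gt0 //.
have z1 : 1 + (y ^+ D) ^+ D.+1 <= (1 + y ^+ D.+1) ^+ D.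
  rewrite -exprM mulnC exprM; case: D D0 d0 => // n _ d0.
  have := @sum_pow_le R n 1 (y ^+ n.+2); rewrite expr1n; apply=> //.
  by rewrite exprn_ge0 // ltW.
apply: (@le_trans _ _ ((s + m) ^+ D.+1 * (1 + (y ^+ D) ^+ D.+1))); last first.
  by rewrite ler_wpM2l // exprn_ge0 //; lra.
have z0 : 0 <= y ^+ D by rewrite exprn_ge0 // ltW.
move: (y ^+ D) z0 {z1} => z z0.
have c1 := @convex_pow R D m s 1 z m0 (ltW s0) ler01 z0.
have c2 := @convex_pow R D s m 1 z (ltW s0) m0 ler01 z0.
rewrite !expr1n !mulr1 in c1 c2.
have t1 : (p + s * z) ^+ D.+1 <= (m + s * z) ^+ D.+1.
  by rewrite lerXn ?lerD2r // addr_ge0 // mulr_ge0 // ltW.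
have t2 : (s + q * z) ^+ D.+1 <= (s + m * z) ^+ D.+1.
  by rewrite lerXn ?lerD2l ?ler_wpM2r // addr_ge0 ?mulr_ge0 // ltW.
rewrite [m + s]addrC in c1.
apply: le_trans (lerD (le_trans t1 c1) (le_trans t2 c2)) _.
by rewrite [(s + m) ^+ D.+1]exprS; move: ((s + m) ^+ D) (z ^+ D.+1) => A B; lra.
Qed.

(** For these weights the matrix has rank one and [F] is constantly [b / a]. *)
Lemma bpE_product (R : realType) (a b : R) D : 0 < a -> 0 < b ->
  bpE (a ^+ 2) (a * b) (b ^+ 2) D (b / a) = (a ^+ D.+1 + b ^+ D.+1) ^+ 2.
Proof.
move=> a0 b0.
have an : a ^+ D != 0 by rewrite expf_neq0 // gt_eqF.
have an' : a != 0 by rewrite gt_eqF.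
set T := a ^+ D.+1 + b ^+ D.+1.
have T0 : 0 < T by rewrite addr_gt0 // exprn_gt0.
have e0 : a + b * (b / a) ^+ D = T / a ^+ D.
  by rewrite /T expr_div_n !exprS; field.
rewrite /bpE.
have -> : a ^+ 2 + a * b * (b / a) ^+ D = a * (T / a ^+ D) by rewrite -e0; ring.
have -> : a * b + b ^+ 2 * (b / a) ^+ D = b * (T / a ^+ D) by rewrite -e0; ring.
have -> : 1 + (b / a) ^+ D.+1 = T / a ^+ D.+1.
  by rewrite expr_div_n /T mulrDl divff // expf_neq0.
rewrite !exprMn -mulrDl -/T !exprVn -!exprM mulnC [T ^+ D.+1]exprS expr2.
by field; rewrite !expf_neq0 // gt_eqF.
Qed.

(** For [p = 0] the first linear form can be arbitrarily small compared with [e], so the excess is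
    absorbed in [e / s] times the second form, which is at least [s]. *)
Lemma bpE_perturb (R : realType) (p s q e : R) D (y : R) : 0 <= p -> 0 < s -> 0 <= q ->
  0 <= e -> 0 < y -> bpE (p + e) s q D y <= (1 + e / s) ^+ D.+1 * bpE p s q D y.
Proof.
move=> p0 s0 q0 e0 y0; rewrite /bpE mulrA ler_wpM2r //.
  by rewrite invr_ge0 exprn_ge0 // addr_ge0 // exprn_ge0 // ltW.
have : 0 <= y ^+ D by rewrite exprn_ge0 // ltW.
move: (y ^+ D) => z z0.
have eta0 : 0 <= e / s by rewrite divr_ge0 // ltW.
have qz := mulr_ge0 q0 z0; have sz := mulr_ge0 (ltW s0) z0.
have t1 : p + e + s * z <= 1 * (p + s * z) + e / s * (s + q * z).
  have : 0 <= e / s * (q * z) by rewrite mulr_ge0.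
  have : e / s * s = e by rewrite divfK // gt_eqF.
  lra.
have U0 : 0 <= p + s * z by lra.
have V0 : 0 <= s + q * z by lra.
have t2 := @convex_pow R D 1 (e / s) _ _ ler01 eta0 U0 V0.
have t3 : (p + e + s * z) ^+ D.+1 <= (1 * (p + s * z) + e / s * (s + q * z)) ^+ D.+1.
  by rewrite lerXn //; lra.
have e1 : 1 <= (1 + e / s) ^+ D by rewrite exprn_ege1 //; lra.
have UU : 0 <= (p + s * z) ^+ D.+1 by rewrite exprn_ge0.
have VV : 0 <= (s + q * z) ^+ D.+1 by rewrite exprn_ge0.
rewrite [(1 + e / s) ^+ D.+1]exprS.
apply: le_trans (lerD (le_trans t3 t2) (lexx _)) _.
clear t1 t2 t3.
move: ((1 + e / s) ^+ D) ((p + s * z) ^+ _) ((s + q * z) ^+ _) e1 UU VV => A B C A1 B0 C0.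
move: (e / s) eta0 => n n0.
have h1 : 0 <= A * n * B by rewrite !mulr_ge0 //; lra.
have h2 : 0 <= (A - 1) * C by rewrite mulr_ge0 //; lra.
lra.
Qed.

(** * Partition functions on locally tree-like graphs *)

(* From here on [set0], [setT], [setU], ... are the operations on finite sets. *)
From mathcomp Require Import all_boot all_order all_algebra.
Import Order.TTheory GRing.Theory Num.Theory.
Local Close Scope classical_set_scope.
Local Open Scope ring_scope.

(** * Sums over part of the spins *)

Section PartialSums.
Variables (R : realType) (n : nat).
Local Notation C := {ffun 'I_n -> bool}.
Implicit Types (S T : {set 'I_n}) (f g : C -> R) (t u : C).

Definition mix S t u : C := [ffun i => if i \in S then t i else u i].

(* A sum over the spins in [S], the others being those of [u]; every term is counted
   [2 ^ (n - #|S|)] times, hence the factors [N] below. *)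
Definition psum S f u : R := \sum_(t : C) f (mix S t u).

Definition indep S f := forall t u, f (mix S t u) = f u.

Local Notation N := (#|{: C}|%:R : R).

Lemma psumT f u : psum setT f u = \sum_t f t.
Proof.
by apply: eq_bigr => t _; congr f; apply/ffunP => i; rewrite ffunE inE.
Qed.

(** Exchanging the spins in [S] between two configurations is an involution on pairs. *)
Lemma sum_mix S f : \sum_t \sum_u f (mix S u t) = N * \sum_t f t.
Proof.
rewrite pair_big /=.
pose h (x : C * C) := (mix S x.2 x.1, mix S x.1 x.2).
have hK : involutive h.
  move=> [t u]; congr (_, _); apply/ffunP => i; by rewrite !ffunE; case: (i \in S).
rewrite (reindex_inj (inv_inj hK)) /=.
have e (x : C * C) : mix S (h x).2 (h x).1 = x.1.
  by apply/ffunP => i; rewrite !ffunE; case: (i \in S).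
under eq_bigr do rewrite e.
rewrite -(pair_big xpredT xpredT (fun t (_ : C) => f t)) /= mulr_sumr.
by apply: eq_bigr => t _; rewrite sumr_const mulr_natl.
Qed.

Lemma psum_psum S T f u : T \subset S -> psum S (psum T f) u = N * psum S f u.
Proof.
move=> TS; rewrite /psum -(sum_mix T (fun x => f (mix S x u))).
apply: eq_bigr => t _; apply: eq_bigr => x _; congr f; apply/ffunP => i.
by rewrite !ffunE; case: ifP => // iT; rewrite (subsetP TS).
Qed.

Lemma psumMr S f g u : indep S g -> psum S (fun x => f x * g x) u = psum S f u * g u.
Proof. by move=> Sg; rewrite /psum mulr_suml; apply: eq_bigr => t _; rewrite Sg. Qed.

Lemma indep_psum S T f : [disjoint S & T] -> indep T f -> indep T (psum S f).
Proof.
move=> dST Tf t u; apply: eq_bigr => x _; rewrite -[RHS](Tf t); congr f.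
apply/ffunP => i; rewrite !ffunE; case: ifP => // iS.
by rewrite (disjointFr dST iS).
Qed.

Lemma indepM S f g : indep S f -> indep S g -> indep S (fun x => f x * g x).
Proof. by move=> hf hg t u; rewrite hf hg. Qed.

Lemma indep_prod (I : Type) (r : seq I) (P : pred I) S (f : I -> C -> R) :
  (forall i, P i -> indep S (f i)) -> indep S (fun x => \prod_(i <- r | P i) f i x).
Proof. by move=> h t u; apply: eq_bigr => i Pi; rewrite h. Qed.

Lemma psum_ext S f g u : (forall x, f x = g x) -> psum S f u = psum S g u.
Proof. by move=> h; apply: eq_bigr. Qed.

Lemma psumZ S (a : R) f u : psum S (fun x => a * f x) u = a * psum S f u.
Proof. by rewrite /psum mulr_sumr. Qed.

Lemma psumD S f g u : psum S (fun x => f x + g x) u = psum S f u + psum S g u.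
Proof. by rewrite /psum big_split. Qed.

Lemma psum_ge0 S f u : (forall x, 0 <= f x) -> 0 <= psum S f u.
Proof. by move=> h; apply: sumr_ge0. Qed.

Lemma psum_le S f g u : (forall x, f x <= g x) -> psum S f u <= psum S g u.
Proof. by move=> h; apply: ler_sum. Qed.

(** Fubini over disjoint blocks: no factor depends on the block of another, so each may be summed
    over its own block, at the price of one multiplicity [N] per block. *)
Lemma psum_prod_seq (I : eqType) (r : seq I) (T : I -> {set 'I_n}) (f : I -> C -> R) S g u :
  uniq r -> (forall i, i \in r -> T i \subset S) ->
  (forall i j, i \in r -> j \in r -> i != j -> [disjoint T i & T j]) ->
  (forall i j, i \in r -> j \in r -> i != j -> indep (T i) (f j)) ->
  (forall i, i \in r -> indep (T i) g) ->
  N ^+ size r * psum S (fun x => (\prod_(i <- r) f i x) * g x) u =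
  psum S (fun x => (\prod_(i <- r) psum (T i) (f i) x) * g x) u.
Proof.
elim: r g => [|i r IH] g; first by move=> *; rewrite mul1r; apply: psum_ext => x; rewrite !big_nil.
move=> /= /andP[ir ur] TS dT iT ig.
have ne j : j \in r -> i != j by move=> jr; apply: contraNneq ir => ->.
have jin j : j \in r -> j \in i :: r by move=> jr; rewrite inE jr orbT.
have ii : i \in i :: r by rewrite inE eqxx.
transitivity (N ^+ size r * psum S (fun x => (\prod_(j <- r) f j x) * (psum (T i) (f i) x * g x)) u).
  rewrite exprSr -mulrA -(@psum_psum S (T i)); last exact: TS.
  congr (_ * _); apply: psum_ext => x.
  rewrite (@psum_ext _ _ (fun x => f i x * ((\prod_(j <- r) f j x) * g x))); last first.
    by move=> y; rewrite big_cons mulrA.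
  rewrite psumMr; first by rewrite mulrCA.
  apply: indepM; last exact: ig.
  by move=> t y; apply: eq_big_seq => j jr; apply: iT => //; [exact: jin | exact: ne].
rewrite IH //.
- by apply: psum_ext => x; rewrite big_cons mulrCA mulrA.
- by move=> j jr; apply: TS; exact: jin.
- by move=> j k jr kr; apply: dT; exact: jin.
- by move=> j k jr kr; apply: iT; exact: jin.
- move=> j jr; apply: indepM; last by apply: ig; exact: jin.
  apply: indep_psum; first by apply: dT => //; [exact: jin | exact: ne].
  by apply: iT => //; [exact: jin | rewrite eq_sym; exact: ne].
Qed.

Lemma psum_prod (m : nat) (T : 'I_m -> {set 'I_n}) (f : 'I_m -> C -> R) S g u :
  (forall i, T i \subset S) ->
  (forall i j, i != j -> [disjoint T i & T j]) ->
  (forall i j, i != j -> indep (T i) (f j)) ->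
  (forall i, indep (T i) g) ->
  N ^+ m * psum S (fun x => (\prod_i f i x) * g x) u =
  psum S (fun x => (\prod_i psum (T i) (f i) x) * g x) u.
Proof.
move=> TS dT iT ig.
have e (F : 'I_m -> C -> R) : psum S (fun x => \prod_i F i x * g x) u =
    psum S (fun x => \prod_(i <- enum 'I_m) F i x * g x) u.
  by apply: psum_ext => x; rewrite big_enum.
rewrite !e -psum_prod_seq ?enum_uniq ?size_enum_ord //.
- by move=> i j _ _; exact: dT.
- by move=> i j _ _; exact: iT.
Qed.

Definition spin_is (i : 'I_n) (b : bool) (x : C) : R := (x i == b)%:R.

Lemma sum_spin_is (i : 'I_n) : \sum_x spin_is i true x = \sum_x spin_is i false x.
Proof.
pose h (x : C) : C := [ffun j => ~~ x j].
have hK : involutive h by move=> x; apply/ffunP => j; rewrite !ffunE negbK.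
rewrite (reindex_inj (inv_inj hK)); apply: eq_bigr => x _.
by rewrite /spin_is ffunE; case: (x i).
Qed.

Lemma sum_spin_is_gt0 (i : 'I_n) : 0 < \sum_x spin_is i true x.
Proof.
rewrite (bigD1 [ffun=> true]) //= ltr_pwDl //.
  by rewrite /spin_is ffunE eqxx ltr01.
by apply: sumr_ge0 => x _; rewrite ler0n.
Qed.

(** The constant is the same for both values of [b], so it drops out of message ratios. *)
Lemma psum_spin (i : 'I_n) (b : bool) S g u : i \in S -> indep [set i] g ->
  N * psum S (fun x => spin_is i b x * g x) u = (\sum_x spin_is i true x) * psum S g u.
Proof.
move=> iS ig; rewrite -(@psum_psum S [set i]) ?sub1set // -psumZ.
apply: psum_ext => x; rewrite psumMr //; congr (_ * _).
transitivity (\sum_x spin_is i b x); last by case: b; rewrite // sum_spin_is.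
by apply: eq_bigr => t _; rewrite /spin_is ffunE inE eqxx.
Qed.

Lemma confN_gt0 : 0 < N.
Proof. by rewrite ltr0n; apply/card_gt0P; exists [ffun=> true]. Qed.

End PartialSums.

(** * Messages on a tree inside a graph *)

Section TreeWeights.
Variables (R : realType) (n : nat) (psi : bool -> bool -> R) (D T : nat).
Variables (e : seq nat -> 'I_n) (c : 'I_n -> {ffun 'I_n -> bool} -> R).
Local Notation C := {ffun 'I_n -> bool}.
Local Notation tv := (tree_vertex D.+1).
Local Notation N := (#|{: C}|%:R : R).
Local Notation p := (psi true true).
Local Notation s := (psi true false).
Local Notation q := (psi false false).
Hypothesis psi_sym : forall a b, psi a b = psi b a.
Hypothesis psi_ge0 : forall a b, 0 <= psi a b.
Hypothesis e_inj : forall w w', tv w -> (size w <= T)%N -> tv w' -> (size w' <= T)%N ->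
  e w = e w' -> w = w'.
Hypothesis c_node : forall w x, tv w -> (0 < size w < T)%N ->
  c (e w) x = \prod_(a < D) psi (x (e w)) (x (e (rcons w a))).
Hypothesis c_root : forall x, (0 < T)%N ->
  c (e [::]) x = \prod_(a < D.+1) psi (x (e [::])) (x (e [:: nat_of_ord a])).
Hypothesis c_ge0 : forall i x, 0 <= c i x.

Lemma tv_cat w v : tv w -> (0 < size w)%N -> tv (w ++ v) = all (fun b => (b < D)%N) v.
Proof. by case: w => [//|a w] /= /andP[-> wD] _; rewrite all_cat wD. Qed.

Lemma tv_rcons w a : tv w -> (0 < size w)%N -> (a < D)%N -> tv (rcons w a).
Proof. by move=> tw w0 aD; rewrite -cats1 tv_cat //= aD. Qed.

(* [inner k w] is the set of the vertices at depth less than [k] in the subtree rooted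
   at [e w]; [c i] is the product of the edge weights from [i] to its children. *)
Fixpoint inner k w : {set 'I_n} :=
  if k is k'.+1 then e w |: \bigcup_(a < D) inner k' (rcons w a) else set0.

Lemma mem_inner k w x : x \in inner k w ->
  exists v, [/\ x = e (w ++ v), all (fun b => (b < D)%N) v & (size v < k)%N].
Proof.
elim: k w => [|k IH] w /=; first by rewrite inE.
rewrite in_setU1 => /orP[/eqP ->|/bigcupP[a _ /IH[v [-> vD sv]]]].
  by exists [::]; rewrite cats0.
by exists (nat_of_ord a :: v); rewrite /= ltn_ord vD -cats1 -catA.
Qed.

(** The depth bound is [<= k] where [inner] has [< k]: the weights at depth [k - 1] read the spins
    of their children at depth [k]. *)
Definition away k w (X : {set 'I_n}) :=
  forall v, all (fun b => (b < D)%N) v -> (size v <= k)%N -> e (w ++ v) \notin X.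

Definition tw k w (x : C) : R := \prod_(i in inner k w) c i x.

Lemma mix_away (X : {set 'I_n}) i t u : i \notin X -> mix X t u i = u i.
Proof. by rewrite ffunE => /negbTE ->. Qed.

Lemma indep_tw k w X : tv w -> (0 < size w)%N -> (size w + k <= T)%N ->
  away k w X -> indep X (tw k w).
Proof.
move=> tvw w0 wk aw t u; apply: eq_bigr => i /mem_inner[v [-> vD sv]].
have tvv : tv (w ++ v) by rewrite tv_cat.
have sz : (0 < size (w ++ v) < T)%N by rewrite size_cat; lia.
rewrite !c_node //; apply: eq_bigr => a _; rewrite !mix_away //.
  by rewrite -cats1 -catA; apply: aw; rewrite ?all_cat ?vD /= ?ltn_ord // size_cat addn1.
by apply: aw => //; exact: ltnW.
Qed.

Lemma away_inner k w a b : tv w -> (0 < size w)%N -> (size w + k.+1 <= T)%N ->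
  (a < D)%N -> (b < D)%N -> a != b -> away k (rcons w a) (inner k (rcons w b)).
Proof.
move=> tvw w0 wk aD bD ab v vD vk; apply/negP => /mem_inner[v' [ee vD' vk']].
have := e_inj _ _ _ _ ee; rewrite -!cats1 -!catA !size_cat /= !tv_cat //= aD bD.
move=> /(_ vD _ vD' _); have h1 : (size w + (size v).+1 <= T)%N by lia.
have h2 : (size w + (size v').+1 <= T)%N by lia.
move=> /(_ h1 h2) /eqP; rewrite eqseq_cat // eqxx /= eqseq_cons => /andP[/eqP abe _].
by rewrite abe eqxx in ab.
Qed.

Lemma away_self k w a : tv w -> (0 < size w)%N -> (size w + k.+1 <= T)%N ->
  (a < D)%N -> away k (rcons w a) [set e w].
Proof.
move=> tvw w0 wk aD v vD vk; rewrite inE; apply/eqP => ee.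
have := e_inj _ _ _ _ ee; rewrite -!cats1 -!catA !size_cat /= !tv_cat //= aD.
move=> /(_ vD); have h1 : (size w + (size v).+1 <= T)%N by lia.
have h2 : (size w <= T)%N by lia.
move=> /(_ h1 tvw h2) /(congr1 size); rewrite size_cat /=; lia.
Qed.

Lemma away_disjoint k w (X : {set 'I_n}) : away k w X -> [disjoint inner k w & X].
Proof.
move=> aw; rewrite disjoint_subset; apply/subsetP => x /mem_inner[v [-> vD sv]].
by rewrite inE; apply: aw => //; exact: ltnW.
Qed.

Lemma tw_rec k w x : tv w -> (0 < size w)%N -> (size w + k.+1 <= T)%N ->
  tw k.+1 w x = c (e w) x * \prod_(a < D) tw k (rcons w a) x.
Proof.
move=> tvw w0 wk; rewrite /tw /= big_setU1 /=; last first.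
  apply/bigcupP => -[a _ eI].
  have /away_disjoint /disjointFr := @away_self k w a tvw w0 wk (ltn_ord a).
  by move=> /(_ _ eI); rewrite inE eqxx.
congr (_ * _); rewrite partition_disjoint_bigcup // => a b ab.
by apply: away_disjoint; apply: away_inner.
Qed.

(* The message from [e w] before ([msgm]) and after ([msgp]) passing through the edge
   to its parent. *)
Definition msgm b k w u : R := psum (inner k w) (fun x => spin_is R (e w) b x * tw k w x) u.
Definition msgp b k w u : R := psum (inner k w) (fun x => psi b (x (e w)) * tw k w x) u.

Lemma tw_ge0 k w x : 0 <= tw k w x.
Proof. by apply: prodr_ge0 => i _. Qed.

Lemma msgm_ge0 b k w u : 0 <= msgm b k w u.
Proof. by apply: psum_ge0 => x; rewrite mulr_ge0 ?tw_ge0 // ler0n. Qed.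

Lemma msgp_split (f : bool -> R) k w u :
  psum (inner k w) (fun x => f (x (e w)) * tw k w x) u =
  f true * msgm true k w u + f false * msgm false k w u.
Proof.
rewrite /msgm -!psumZ -psumD; apply: psum_ext => x; rewrite /spin_is.
by case: (x (e w)); rewrite /= !(mul1r, mul0r, mulr0, addr0, add0r).
Qed.

Lemma msgpE b k w u : msgp b k w u = psi b true * msgm true k w u + psi b false * msgm false k w u.
Proof. exact: msgp_split. Qed.

Lemma msgp_ge0 b k w u : 0 <= msgp b k w u.
Proof. by rewrite msgpE addr_ge0 // mulr_ge0 ?msgm_ge0. Qed.

Lemma indep_spin (X : {set 'I_n}) i b : i \notin X -> indep X (spin_is R i b).
Proof. by move=> iX t u; rewrite /spin_is mix_away. Qed.

Lemma indep_edge X k w (f : bool -> R) : tv w -> (0 < size w)%N -> (size w + k <= T)%N ->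
  away k w X -> indep X (fun x => f (x (e w)) * tw k w x).
Proof.
move=> tvw w0 wk aw; apply: indepM; last exact: indep_tw.
move=> t u; rewrite mix_away //; have := aw [::]; rewrite cats0; exact.
Qed.

(** Pinning the spin at [e w] separates the branches below it. The factors other than the product of
    passed messages are the same for both spins. *)
Lemma msgm_rec b k w u : tv w -> (0 < size w)%N -> (size w + k.+1 <= T)%N ->
  N ^+ D.+1 * msgm b k.+1 w u = (\sum_x spin_is R (e w) true x) *
    psum (inner k.+1 w) (fun x => \prod_(a < D) msgp b k (rcons w a) x) u.
Proof.
move=> tvw w0 wk.
have ew : e w \in inner k.+1 w by rewrite /= in_setU1 eqxx.
have tva (a : 'I_D) : tv (rcons w a) by apply: tv_rcons.
have sa (a : 'I_D) : (0 < size (rcons w a))%N by rewrite size_rcons.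
have ka (a : 'I_D) : (size (rcons w a) + k <= T)%N by rewrite size_rcons; lia.
rewrite -(psum_spin b) //; last first.
  apply: indep_prod => a _; apply: indep_psum.
    by apply: away_disjoint; apply: away_self.
  by apply: indep_edge => //; apply: away_self.
rewrite exprS -mulrA; congr (_ * _).
rewrite /msgm (@psum_ext _ _ _ _ (fun x => \prod_(a < D) (psi b (x (e (rcons w a))) * tw k (rcons w a) x) *
    spin_is R (e w) b x)); last first.
  move=> x; rewrite tw_rec // mulrA [RHS]mulrC big_split /= mulrA; congr (_ * _).
  rewrite /spin_is; case: eqP => [xb|]; last by rewrite !mul0r.
  by rewrite c_node ?xb //; lia.
rewrite (@psum_prod _ _ _ (fun a : 'I_D => inner k (rcons w a))).
- by apply: psum_ext => x; rewrite mulrC.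
- move=> a; apply/subsetP => x xa /=; rewrite in_setU1; apply/orP; right.
  by apply/bigcupP; exists a.
- by move=> a b' ab; apply: away_disjoint; apply: away_inner.
- by move=> a b' ab; apply: indep_edge => //; apply: away_inner; rewrite // eq_sym.
- move=> a; apply: indep_spin; apply/negP => ea.
  have /away_disjoint /disjointFr := @away_self k w a tvw w0 wk (ltn_ord a).
  by move=> /(_ _ ea); rewrite inE eqxx.
Qed.

(** Multiplied out, because a message can vanish when an edge weight is zero. The bound is uniform
    in the outer spins [u], so nothing is assumed about the graph beyond the ball. *)
Definition box_lo k l := forall w u, tv w -> (0 < size w)%N -> (size w + k <= T)%N ->
  l * msgp true k w u <= msgp false k w u.
Definition box_hi k h := forall w u, tv w -> (0 < size w)%N -> (size w + k <= T)%N ->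
  msgp false k w u <= h * msgp true k w u.

Lemma msgm_lo k l w u : 0 <= l -> box_lo k l -> tv w -> (0 < size w)%N ->
  (size w + k.+1 <= T)%N -> l ^+ D * msgm true k.+1 w u <= msgm false k.+1 w u.
Proof.
move=> l0 lo tvw w0 wk.
have N0 : 0 < N ^+ D.+1 by rewrite exprn_gt0 // confN_gt0.
rewrite -(ler_pM2l N0) mulrCA !msgm_rec // mulrCA ler_pM2l ?sum_spin_is_gt0 //.
rewrite -psumZ; apply: psum_le => x.
rewrite -[D in l ^+ D]card_ord -prodr_const -big_split /=.
apply: ler_prod => a _; rewrite mulr_ge0 ?msgp_ge0 //=.
by apply: lo; rewrite ?size_rcons ?tv_rcons //; lia.
Qed.

Lemma msgm_hi k h w u : 0 <= h -> box_hi k h -> tv w -> (0 < size w)%N ->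
  (size w + k.+1 <= T)%N -> msgm false k.+1 w u <= h ^+ D * msgm true k.+1 w u.
Proof.
move=> h0 hi tvw w0 wk.
have N0 : 0 < N ^+ D.+1 by rewrite exprn_gt0 // confN_gt0.
rewrite -(ler_pM2l N0) [leRHS]mulrCA !msgm_rec // [leRHS]mulrCA ler_pM2l ?sum_spin_is_gt0 //.
rewrite -psumZ; apply: psum_le => x.
rewrite -[D in h ^+ D]card_ord -prodr_const -big_split /=.
apply: ler_prod => a _; rewrite msgp_ge0 /=.
by apply: hi; rewrite ?size_rcons ?tv_rcons //; lia.
Qed.

(** The deviation of the passed messages from ratio [F y] is the determinant times the deviation of
    the incoming ones from [y ^+ D], up to a positive factor. Its sign decides whether lower and
    upper bounds are preserved or exchanged. *)
Lemma bpF_msg (y a b : R) : 0 < s -> 0 < y ->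
  (p + s * y ^+ D) * ((s * a + q * b) - bpF p s q D y * (p * a + s * b)) =
  (p * q - s ^+ 2) * (b - y ^+ D * a).
Proof.
move=> s0 y0; have := bpU_gt0 D (psi_ge0 true true) s0 y0; rewrite /bpF.
by move: (y ^+ D) => z U0; field; rewrite gt_eqF.
Qed.

Lemma box_step_ferro_lo k (l : R) : 0 < s -> s ^+ 2 <= p * q -> 0 < l ->
  box_lo k l -> box_lo k.+1 (bpF p s q D l).
Proof.
move=> s0 fe l0 lo w u tvw w0 wk; rewrite !msgpE [psi false true]psi_sym -subr_ge0.
rewrite -(pmulr_rge0 _ (bpU_gt0 D (psi_ge0 true true) s0 l0)) bpF_msg //.
by rewrite mulr_ge0 ?subr_ge0 // msgm_lo // ltW.
Qed.

Lemma box_step_ferro_hi k (h : R) : 0 < s -> s ^+ 2 <= p * q -> 0 < h ->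
  box_hi k h -> box_hi k.+1 (bpF p s q D h).
Proof.
move=> s0 fe l0 lo w u tvw w0 wk; rewrite !msgpE [psi false true]psi_sym -subr_le0.
rewrite -(pmulr_rle0 _ (bpU_gt0 D (psi_ge0 true true) s0 l0)) bpF_msg //.
by rewrite mulr_ge0_le0 ?subr_ge0 ?subr_le0 // msgm_hi // ltW.
Qed.

Lemma box_step_anti_lo k (h : R) : 0 < s -> p * q <= s ^+ 2 -> 0 < h ->
  box_hi k h -> box_lo k.+1 (bpF p s q D h).
Proof.
move=> s0 fe l0 lo w u tvw w0 wk; rewrite !msgpE [psi false true]psi_sym -subr_ge0.
rewrite -(pmulr_rge0 _ (bpU_gt0 D (psi_ge0 true true) s0 l0)) bpF_msg //.
by rewrite mulr_le0 ?subr_le0 // msgm_hi // ltW.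
Qed.

Lemma box_step_anti_hi k (l : R) : 0 < s -> p * q <= s ^+ 2 -> 0 < l ->
  box_lo k l -> box_hi k.+1 (bpF p s q D l).
Proof.
move=> s0 fe l0 lo w u tvw w0 wk; rewrite !msgpE [psi false true]psi_sym -subr_le0.
rewrite -(pmulr_rle0 _ (bpU_gt0 D (psi_ge0 true true) s0 l0)) bpF_msg //.
by rewrite mulr_le0_ge0 ?subr_le0 ?subr_ge0 // msgm_lo // ltW.
Qed.

Lemma box_base_ferro k : 0 < s -> s ^+ 2 <= p * q -> 0 < p ->
  box_lo k (s / p) /\ box_hi k (q / s).
Proof.
move=> s0 fe p0; split=> w u tvw w0 wk; rewrite !msgpE [psi false true]psi_sym.
- rewrite mulrAC ler_pdivrMr // -subr_ge0.
  have -> a b : (s * a + q * b) * p - s * (p * a + s * b) = (p * q - s ^+ 2) * b by ring.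
  by rewrite mulr_ge0 ?subr_ge0 ?msgm_ge0.
- rewrite mulrAC ler_pdivlMr // -subr_ge0.
  have -> a b : q * (p * a + s * b) - (s * a + q * b) * s = (p * q - s ^+ 2) * a by ring.
  by rewrite mulr_ge0 ?subr_ge0 ?msgm_ge0.
Qed.

Lemma box_base_anti k : 0 < s -> p * q <= s ^+ 2 -> box_lo k (q / s).
Proof.
move=> s0 fe w u tvw w0 wk; rewrite !msgpE [psi false true]psi_sym.
rewrite mulrAC ler_pdivrMr // -subr_ge0.
have -> a b : (s * a + q * b) * s - q * (p * a + s * b) = (s ^+ 2 - p * q) * a by ring.
by rewrite mulr_ge0 ?subr_ge0 ?msgm_ge0.
Qed.

Section Root.
Variables (k : nat) (rest : C -> R).
Hypothesis Tk : T = k.+1.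
Hypothesis rest_ge0 : forall x, 0 <= rest x.
Hypothesis rest_root : indep [set e [::]] rest.
Hypothesis rest_inner : forall a : 'I_D.+1, indep (inner k [:: nat_of_ord a]) rest.
Local Notation v := (e [::]).
Local Notation ch a := [:: nat_of_ord a].

Lemma away_inner_root (a b : 'I_D.+1) : a != b -> away k (ch a) (inner k (ch b)).
Proof.
move=> ab w wD wk; apply/negP => /mem_inner[w' [ee wD' wk']].
have := e_inj _ _ _ _ ee; rewrite /= !ltn_ord wD wD' Tk !ltnS /= wk ltnW //.
move=> /(_ isT isT isT isT) [abe _].
by move/eqP: ab; apply; apply: val_inj.
Qed.

Lemma away_self_root (a : 'I_D.+1) : away k (ch a) [set v].
Proof.
move=> w wD wk; rewrite inE; apply/eqP => ee.
by have := e_inj _ _ _ _ ee; rewrite /= !ltn_ord wD Tk !ltnS /= wk => /(_ isT isT isT isT).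
Qed.

Lemma root_sum (b : bool) (f : 'I_D.+1 -> bool -> R) :
  N ^+ D.+2 * \sum_x spin_is R v b x * (\prod_(a < D.+1) (f a (x (e (ch a))) * tw k (ch a) x)) * rest x =
  (\sum_x spin_is R v true x) *
  \sum_x (\prod_(a < D.+1) psum (inner k (ch a)) (fun x => f a (x (e (ch a))) * tw k (ch a) x) x) * rest x.
Proof.
have tva (a : 'I_D.+1) : tv (ch a) by rewrite /= ltn_ord.
have sa (a : 'I_D.+1) : (size (ch a) + k <= T)%N by rewrite Tk.
pose u0 : C := [ffun=> true].
rewrite -(psumT (fun x => (\prod_(a < D.+1) psum (inner k (ch a)) (fun x => f a (x (e (ch a))) * tw k (ch a) x) x) * rest x) u0).
rewrite -(psum_spin b) ?inE //; last first.
  apply: indepM => //; apply: indep_prod => a _; apply: indep_psum.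
    by apply: away_disjoint; apply: away_self_root.
  by apply: indep_edge => //; apply: away_self_root.
rewrite exprS -mulrA; congr (_ * _).
rewrite -(psumT _ u0).
rewrite (@psum_ext _ _ _ _ (fun x => (\prod_(a < D.+1) (f a (x (e (ch a))) * tw k (ch a) x)) * (spin_is R v b x * rest x))); last first.
  by move=> x; rewrite -mulrA mulrCA.
rewrite (@psum_prod _ _ _ (fun a : 'I_D.+1 => inner k (ch a))).
- by apply: psum_ext => x; rewrite mulrCA.
- by move=> a; exact: subsetT.
- by move=> a b' ab; apply: away_disjoint; apply: away_inner_root.
- by move=> a b' ab; apply: indep_edge => //; apply: away_inner_root; rewrite // eq_sym.
- move=> a; apply: indepM => //; apply: indep_spin; apply/negP => ea.
  have /away_disjoint /disjointFr := @away_self_root a.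
  by move=> /(_ _ ea); rewrite inE eqxx.
Qed.

Definition rootW (x : C) : R := c v x * (\prod_(a < D.+1) tw k (ch a) x) * rest x.

Lemma rootW_split (F : C -> R) :
  \sum_x rootW x * F x =
  \sum_x spin_is R v true x * (\prod_(a < D.+1) (psi true (x (e (ch a))) * tw k (ch a) x)) * rest x * F x +
  \sum_x spin_is R v false x * (\prod_(a < D.+1) (psi false (x (e (ch a))) * tw k (ch a) x)) * rest x * F x.
Proof.
rewrite -big_split; apply: eq_bigr => x _ /=; rewrite -mulrDl; congr (_ * _).
rewrite -mulrDl /rootW; congr (_ * _); rewrite c_root ?Tk // -big_split /= /spin_is.
by case: (x v); rewrite /= !(mul1r, mul0r, addr0, add0r).
Qed.

(** After the branches are summed out, both sides are sums over the remaining spins, with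
    nonnegative weights [rest], of the two sides of [star_bound]. *)
Lemma star_ineq (l h : R) : (0 < D)%N -> 0 < s -> 0 < l -> box_lo k l -> box_hi k h ->
  (D.+1)%:R * (s * (Num.min (bpg p q D l) (bpg p q D h) - s)) * \sum_x rootW x <=
  (p * q - s ^+ 2) * \sum_x rootW x * \sum_(a < D.+1) (x v != x (e (ch a)))%:R.
Proof.
move=> D0 s0 l0 lo hi.
set K := \sum_x spin_is R v true x.
have K0 : 0 < K by rewrite sum_spin_is_gt0.
have NN : 0 < N ^+ D.+2 by rewrite exprn_gt0 // confN_gt0.
have eZ : N ^+ D.+2 * \sum_x rootW x = K * \sum_x (\prod_(a < D.+1) msgp true k (ch a) x +
    \prod_(a < D.+1) msgp false k (ch a) x) * rest x.
  have -> : \sum_x rootW x = \sum_x rootW x * 1 by apply: eq_bigr => x _; rewrite mulr1.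
  rewrite rootW_split.
  under eq_bigr do rewrite mulr1. under [X in _ + X]eq_bigr do rewrite mulr1.
  rewrite mulrDr (root_sum true (fun _ => psi true)) (root_sum false (fun _ => psi false)).
  rewrite -mulrDr -big_split /=; congr (_ * _).
  by apply: eq_bigr => x _; rewrite -mulrDl.
have eX b : N ^+ D.+2 * \sum_x spin_is R v b x *
     (\prod_(a < D.+1) (psi b (x (e (ch a))) * tw k (ch a) x)) * rest x *
     \sum_(a < D.+1) (x v != x (e (ch a)))%:R =
   K * \sum_x (\sum_(a < D.+1) (s * msgm (~~ b) k (ch a) x * \prod_(j < D.+1 | j != a) msgp b k (ch j) x)) * rest x.
  under eq_bigr do rewrite mulr_sumr.
  rewrite exchange_big /= mulr_sumr.
  under [X in _ = _ * X]eq_bigr do rewrite mulr_suml.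
  rewrite [X in _ = _ * X]exchange_big /= mulr_sumr; apply: eq_bigr => a _.
  (* The disagreement along the edge to child [a] is inserted as a modified weight of that edge, so
     that [root_sum] applies again. *)
  pose f (j : 'I_D.+1) (y : bool) : R := if j == a then psi b y * (b != y)%:R else psi b y.
  transitivity (N ^+ D.+2 * \sum_x spin_is R v b x *
     (\prod_(j < D.+1) (f j (x (e (ch j))) * tw k (ch j) x)) * rest x).
    congr (_ * _); apply: eq_bigr => x _; rewrite mulrAC; congr (_ * _).
    rewrite /spin_is; case: eqP => [->|]; last by rewrite !mul0r.
    rewrite !mul1r (bigD1 a) //= [in RHS](bigD1 a) //= /f eqxx.
    rewrite [in RHS](eq_bigr (fun i : 'I_D.+1 => psi b (x (e (ch i))) * tw k (ch i) x)); last first.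
      by move=> j /negbTE ->.
    by rewrite mulrAC; congr (_ * _); rewrite mulrAC.
  rewrite root_sum; congr (_ * _); apply: eq_bigr => x _; congr (_ * _).
  rewrite (bigD1 a) //=; congr (_ * _); last first.
    by apply: eq_bigr => j /negbTE ja; rewrite /f ja.
  rewrite msgp_split /f eqxx; case: b {f} => /=;
    by rewrite ?[psi false true]psi_sym !(mulr1, mulr0, mul0r, addr0, add0r).
have eN : N ^+ D.+2 * \sum_x rootW x * \sum_(a < D.+1) (x v != x (e (ch a)))%:R =
   K * \sum_x (\sum_(a < D.+1) (s * msgm false k (ch a) x * \prod_(j < D.+1 | j != a) msgp true k (ch j) x) +
      \sum_(a < D.+1) (s * msgm true k (ch a) x * \prod_(j < D.+1 | j != a) msgp false k (ch j) x)) * rest x.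
  rewrite rootW_split mulrDr !eX -mulrDr -big_split /=; congr (_ * _).
  by apply: eq_bigr => x _; rewrite mulrDl.
rewrite -(ler_pM2l NN) mulrCA eZ [leRHS]mulrCA eN.
rewrite mulrCA [leRHS]mulrCA ler_pM2l // !mulr_sumr; apply: ler_sum => x _.
rewrite [leLHS]mulrA [leRHS]mulrA ler_wpM2r // -big_split /=.
have := @star_bound R p q D D0 (psi_ge0 _ _) (psi_ge0 _ _) s l h
  (fun a => msgm true k (ch a) x) (fun a => msgm false k (ch a) x) s0 l0
  (fun a => msgm_ge0 _ _ _ _) (fun a => msgm_ge0 _ _ _ _).
have eU a : p * msgm true k (ch a) x + s * msgm false k (ch a) x = msgp true k (ch a) x.
  by rewrite msgpE.
have eV a : s * msgm true k (ch a) x + q * msgm false k (ch a) x = msgp false k (ch a) x.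
  by rewrite msgpE [psi false true]psi_sym.
have tva (a : 'I_D.+1) : tv (ch a) by rewrite /= ltn_ord.
move=> /(_ _ _)/=.
under eq_bigr do rewrite eU. under [X in _ * (_ + X)]eq_bigr do rewrite eV.
move=> st; apply: le_trans (st _ _) _.
- by move=> a; rewrite eU eV; apply: lo; rewrite // Tk.
- by move=> a; rewrite eU eV; apply: hi; rewrite // Tk.
- rewrite le_eqVlt; apply/orP; left; apply/eqP; congr (_ * _); apply: eq_bigr => a _.
  congr (_ * _ + _ * _); apply: eq_bigr => j _; [exact: eU | exact: eV].
Qed.

End Root.
End TreeWeights.

(** * From tree-like balls to trees of words *)

Definition gibbsW (R : realType) (psi : bool -> bool -> R) n (G : graph n)
  (x : {ffun 'I_n -> bool}) : R :=
  \prod_(e : 'I_n * 'I_n | (nat_of_ord e.1 < nat_of_ord e.2)%N && adj G e.1 e.2)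
     psi (x e.1) (x e.2).

Definition nbr_disagree (R : realType) n (G : graph n) (v : 'I_n) (x : {ffun 'I_n -> bool}) : R :=
  \sum_(j | adj G v j) (x v != x j)%:R.

Lemma orient_prod (R : realType) (psi : bool -> bool -> R) n (G : graph n)
    (o : rel 'I_n) (x : {ffun 'I_n -> bool}) :
  simple_graph G -> (forall a b, psi a b = psi b a) ->
  (forall i j, adj G i j -> o j i = ~~ o i j) ->
  gibbsW psi G x = \prod_i \prod_(j | adj G i j && o i j) psi (x i) (x j).
Proof.
move=> [Gs Gi] ps oN; rewrite pair_big_dep /= /gibbsW.
rewrite (bigID (fun e : 'I_n * 'I_n => o e.1 e.2)) /=.
rewrite [RHS](bigID (fun e : 'I_n * 'I_n => (e.1 < e.2)%N)) /=; congr (_ * _).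
  by apply: eq_bigl => e; case: (_ < _)%N; case: (adj _ _ _); case: (o _ _).
rewrite (reindex_inj (h := fun e : 'I_n * 'I_n => (e.2, e.1))) /=; last by move=> [a b] [c d] [-> ->].
apply: eq_big => [[i j]|[i j] _] /=; last exact: ps.
rewrite Gs; case aij: (adj G i j); last by rewrite andbF.
rewrite (oN _ _ aij) negbK andbT /=.
have ij : i != j by apply: contraTneq aij => ->; exact: Gi.
by rewrite andbC -leqNgt ltn_neqAle eq_sym ij.
Qed.

Lemma indep_sub (R : realType) n (X Y : {set 'I_n}) (f : {ffun 'I_n -> bool} -> R) :
  X \subset Y -> indep Y f -> indep X f.
Proof.
move=> XY fY t u; rewrite -[RHS](fY (mix X t u)); congr f; apply/ffunP => i.
rewrite [RHS]ffunE; case: ifP => // iY; rewrite ffunE; case: ifP => // iX.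
by rewrite (subsetP XY) in iY.
Qed.

Lemma ballset_self n (G : graph n) t v : v \in ballset G t v.
Proof. by elim: t => [|t IH] /=; rewrite !inE ?IH. Qed.

Lemma ballset_mono n (G : graph n) t t' v : (t <= t')%N -> ballset G t v \subset ballset G t' v.
Proof.
move=> /subnKC <-; elim: (t' - t)%N => [|m IH]; first by rewrite addn0.
by rewrite addnS /= (subset_trans IH) // subsetUl.
Qed.

Lemma ballset_adj n (G : graph n) t v u w : u \in ballset G t v -> adj G u w ->
  w \in ballset G t.+1 v.
Proof.
by move=> ub uw /=; rewrite !inE; apply/orP; right; apply/existsP; exists u; rewrite ub.
Qed.

Section BallTree.
Variables (R : realType) (n : nat) (G : graph n) (psi : bool -> bool -> R) (D k : nat).
Variables (v : 'I_n) (f : 'I_n -> seq nat).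
Hypothesis Gsimple : simple_graph G.
Hypothesis psi_sym : forall a b, psi a b = psi b a.
Hypothesis psi_ge0 : forall a b, 0 <= psi a b.
Local Notation T := k.+1.
Local Notation B := (ballset G T v).
Local Notation tv := (tree_vertex D.+1).
Hypothesis fv : f v = [::].
Hypothesis f_inj : {in B &, injective f}.
Hypothesis f_tv : forall u, u \in B -> tv (f u) && (size (f u) <= T)%N.
Hypothesis f_surj : forall w, tv w -> (size w <= T)%N -> exists2 u, u \in B & f u = w.
Hypothesis f_adj : forall u u', u \in B -> u' \in B -> adj G u u' = tree_adj (f u) (f u').
Local Notation C := {ffun 'I_n -> bool}.

Let Gsym i j : adj G i j = adj G j i := Gsimple.1 i j.
Let Girr i : ~~ adj G i i := Gsimple.2 i.

Definition tree_pos (w : seq nat) : 'I_n := odflt v [pick u in B | f u == w].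
Local Notation e := tree_pos.

Lemma tree_posP w : tv w -> (size w <= T)%N -> e w \in B /\ f (e w) = w.
Proof.
move=> tw sw; rewrite /e; case: pickP => [u /andP[uB /eqP fu]|none] //=.
by have [u uB fu] := f_surj tw sw; have := none u; rewrite uB fu eqxx.
Qed.

Lemma tree_posK u : u \in B -> e (f u) = u.
Proof.
move=> uB; have /andP[t1 t2] := f_tv uB; have [eB fe] := tree_posP t1 t2.
exact: f_inj.
Qed.

Lemma tree_pos_inj w w' : tv w -> (size w <= T)%N -> tv w' -> (size w' <= T)%N ->
  e w = e w' -> w = w'.
Proof.
move=> t1 s1 t2 s2 ee.
by rewrite -(tree_posP t1 s1).2 ee (tree_posP t2 s2).2.
Qed.

Lemma tree_pos_root : e [::] = v.
Proof. by rewrite -fv tree_posK // ballset_self. Qed.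

Definition branch (w : seq nat) : nat := if w is [::] then D.+1 else D.

Lemma tv_rconsE w a : tv (rcons w a) = tv w && (a < branch w)%N.
Proof.
by case: w => [|b w] /=; rewrite ?andbT // all_rcons [(a < D)%N && _]andbC andbA.
Qed.

(** The isomorphism is given on adjacency only; induction along parents recovers distances from word
    lengths. This keeps the neighbours of non-boundary vertices in the ball. *)
Lemma depth_ball m u : u \in B -> size (f u) = m -> u \in ballset G m v.
Proof.
elim: m u => [|m IH] u uB su.
  have -> : u = v by apply: f_inj => //; [exact: ballset_self | rewrite fv; apply: size0nil].
  exact: ballset_self.
have /andP[t1 t2] := f_tv uB.
move: su t1 t2; case/lastP fu: (f u) => [//|w a]; rewrite size_rcons => -[sw].
rewrite tv_rconsE => /andP[tw aw] sT.
have [eB fe] := tree_posP tw (ltnW sT).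
apply: (@ballset_adj _ _ _ _ (e w)); first by apply: IH; rewrite ?fe.
rewrite f_adj // fe fu /tree_adj /tree_child size_rcons eqxx /=.
by rewrite -cats1 take_size_cat // eqxx.
Qed.

Lemma nbr_ball u j : u \in B -> (size (f u) < T)%N -> adj G u j -> j \in B.
Proof.
move=> uB su uj; apply: (subsetP (ballset_mono G v su)).
by apply: ballset_adj uj; apply: depth_ball.
Qed.

(* Edges of the ball point away from [v]. *)
Definition orient (i j : 'I_n) : bool :=
  if (i \in B) && (j \in B) then (size (f i) < size (f j))%N else (i < j)%N.

Lemma orientN i j : adj G i j -> orient j i = ~~ orient i j.
Proof.
move=> ij; rewrite /orient [(j \in B) && _]andbC; case: ifP => [/andP[iB jB]|_].
  move: ij; rewrite f_adj // /tree_adj /tree_child => /orP[|] /andP[/eqP ss _]; lia.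
have nij : i != j by apply: contraTneq ij => ->; exact: Girr.
have nij' : nat_of_ord i <> j by move=> h; case/eqP: nij; exact: val_inj.
lia.
Qed.

Definition cw (i : 'I_n) (x : C) : R := \prod_(j | adj G i j && orient i j) psi (x i) (x j).

Lemma gibbsW_cw x : gibbsW psi G x = \prod_i cw i x.
Proof. by apply: orient_prod => // i j; exact: orientN. Qed.

Lemma cw_ge0 i x : 0 <= cw i x.
Proof. by apply: prodr_ge0. Qed.

Lemma child_mem w j : tv w -> (size w < T)%N ->
  (adj G (e w) j && orient (e w) j) = (j \in [set e (rcons w (nat_of_ord a)) | a : 'I_(branch w)]).
Proof.
move=> tw sw; have [eB fe] := tree_posP tw (ltnW sw).
apply/andP/imsetP => [[aj oj]|[a _ ->]].
  have jB : j \in B by apply: nbr_ball aj => //; rewrite fe.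
  move: oj; rewrite /orient eB jB /= fe => oj.
  move: aj; rewrite f_adj // fe /tree_adj /tree_child => /orP[|] /andP[/eqP ss /eqP tk]; last lia.
  have : size (drop (size w) (f j)) = 1%N by rewrite size_drop ss; lia.
  case dr : (drop _ _) => [//|a [|//]] _.
  have fj : f j = rcons w a by rewrite -(cat_take_drop (size w) (f j)) tk dr cats1.
  have /andP[] := f_tv jB; rewrite fj tv_rconsE => /andP[_ ab] _.
  by exists (Ordinal ab) => //=; rewrite -fj tree_posK.
have tr : tv (rcons w a) by rewrite tv_rconsE tw ltn_ord.
have sr : (size (rcons w a) <= T)%N by rewrite size_rcons.
have [rB fr] := tree_posP tr sr.
split.
  rewrite f_adj // fe fr /tree_adj /tree_child size_rcons eqxx /=.
  by rewrite -cats1 take_size_cat // eqxx.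
by rewrite /orient eB rB /= fe fr size_rcons.
Qed.

Lemma child_inj w : tv w -> (size w < T)%N ->
  {in [set: 'I_(branch w)] &, injective (fun a : 'I_(branch w) => e (rcons w (nat_of_ord a)))}.
Proof.
move=> tw sw a b _ _ ee; have := tree_pos_inj _ _ _ _ ee.
rewrite !tv_rconsE !size_rcons tw !ltn_ord /= => /(_ isT sw isT sw) /rcons_inj [ab].
exact: val_inj.
Qed.

Lemma child_big (T' : Type) (idx : T') (op : Monoid.com_law idx) (F : 'I_n -> T') w :
  tv w -> (size w < T)%N ->
  \big[op/idx]_(j | adj G (e w) j && orient (e w) j) F j =
  \big[op/idx]_(a < branch w) F (e (rcons w (nat_of_ord a))).
Proof.
move=> tw sw; rewrite (eq_bigl _ _ (fun j => child_mem j tw sw)) big_imset /=.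
  by apply: eq_bigl => a; rewrite inE.
by move=> a b _ _; apply: child_inj; rewrite ?inE.
Qed.

Lemma cw_node w x : tv w -> (0 < size w < T)%N ->
  cw (e w) x = \prod_(a < D) psi (x (e w)) (x (e (rcons w a))).
Proof.
by move=> tw /andP[w0 sw]; rewrite /cw child_big //; case: w w0 {tw sw}.
Qed.

Lemma cw_root x : (0 < T)%N ->
  cw (e [::]) x = \prod_(a < D.+1) psi (x (e [::])) (x (e [:: nat_of_ord a])).
Proof. by move=> _; rewrite /cw child_big. Qed.

Local Notation inner := (inner D e).
Local Notation ch a := [:: nat_of_ord a].

Definition insideset : {set 'I_n} := e [::] |: \bigcup_(a < D.+1) inner k (ch a).

Lemma mem_inner_cat m w u : all (fun b => (b < D)%N) u -> (size u < m)%N -> e (w ++ u) \in inner m w.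
Proof.
elim: m w u => [//|m IH] w [|a u] /=; first by rewrite cats0 in_setU1 eqxx.
move=> /andP[aD uD] um; rewrite in_setU1; apply/orP; right.
apply/bigcupP; exists (Ordinal aD) => //=.
by rewrite -cat_rcons; apply: IH.
Qed.

Lemma inside_mem w : tv w -> (size w <= k)%N -> e w \in insideset.
Proof.
case: w => [|a w] /=; first by rewrite in_setU1 eqxx.
move=> /andP[aD wD] sw; rewrite in_setU1; apply/orP; right.
by apply/bigcupP; exists (Ordinal aD) => //=; apply: (@mem_inner_cat k [:: a]).
Qed.

Lemma insideP i : i \in insideset -> exists w, [/\ i = e w, tv w & (size w <= k)%N].
Proof.
rewrite in_setU1 => /orP[/eqP ->|/bigcupP[a _ /mem_inner[u [-> uD su]]]].
  by exists [::].
by exists (nat_of_ord a :: u); rewrite /= ltn_ord uD.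
Qed.

Definition outside (x : C) : R := \prod_(i | i \notin insideset) cw i x.

(** Edges are charged to their end nearer to [v], so an edge charged to an outside vertex cannot
    lead inside: its tail would be nearer to [v] than its inside head, hence inside as well. *)
Lemma outside_indep : indep insideset outside.
Proof.
move=> t u; apply: eq_bigr => i iI; apply: eq_bigr => j /andP[aij oij].
have jI : j \notin insideset.
  apply/negP => /insideP[w [je tw sw]]; move/negP: iI; apply.
  have [jB fj] := tree_posP tw (leqW sw).
  rewrite -je in jB fj.
  have iB : i \in B by apply: (@nbr_ball j) => //; rewrite ?fj // Gsym.
  have /andP[ti _] := f_tv iB.
  rewrite -(tree_posK iB); apply: inside_mem => //.
  by move: oij; rewrite /orient iB jB /= fj => h; apply: leq_trans sw; exact: ltnW.
by rewrite !ffunE (negbTE iI) (negbTE jI).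
Qed.

Lemma gibbsW_root x : gibbsW psi G x = rootW D e cw k outside x.
Proof.
rewrite gibbsW_cw (bigID (mem insideset)) /= /rootW; congr (_ * _).
rewrite /insideset big_setU1 /=; last first.
  apply/bigcupP => -[a _ eI].
  have /away_disjoint /disjointFr := @away_self_root n D T e tree_pos_inj k erefl a.
  by move=> /(_ _ eI); rewrite inE eqxx.
congr (_ * _); rewrite partition_disjoint_bigcup // => a b ab.
by apply: away_disjoint; apply: (@away_inner_root n D T e tree_pos_inj k erefl).
Qed.

Lemma root_nbr_big (T' : Type) (idx : T') (op : Monoid.com_law idx) (F : 'I_n -> T') :
  \big[op/idx]_(j | adj G v j) F j = \big[op/idx]_(a < D.+1) F (e (ch a)).
Proof.
rewrite -(@child_big _ _ _ F [::]) // tree_pos_root.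
apply: eq_bigl => j; case vj: (adj G v j) => //=.
have vB : v \in B by exact: ballset_self.
have jB : j \in B by apply: nbr_ball vj => //; rewrite fv.
by rewrite /orient vB jB fv /=; move: vj; rewrite f_adj // fv /tree_adj /tree_child; case: (f j).
Qed.

Lemma disagree_root x : nbr_disagree R G v x = \sum_(a < D.+1) (x (e [::]) != x (e (ch a)))%:R.
Proof. by rewrite /nbr_disagree root_nbr_big tree_pos_root. Qed.

Lemma star_ball (l h : R) : (0 < D)%N -> 0 < psi true false -> 0 < l ->
  box_lo psi D T e cw k l -> box_hi psi D T e cw k h ->
  (D.+1)%:R * (psi true false * (Num.min (bpg (psi true true) (psi false false) D l)
     (bpg (psi true true) (psi false false) D h) - psi true false)) * \sum_x gibbsW psi G x <=
  (psi true true * psi false false - psi true false ^+ 2) *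
    \sum_x gibbsW psi G x * nbr_disagree R G v x.
Proof.
move=> D0 s0 l0 lo hi.
have sub (a : 'I_D.+1) : inner k (ch a) \subset insideset.
  by apply/subsetP => i ii; rewrite in_setU1; apply/orP; right; apply/bigcupP; exists a.
have sub0 : [set e [::]] \subset insideset by rewrite sub1set in_setU1 eqxx.
have out0 x : 0 <= outside x by apply: prodr_ge0 => i _; exact: cw_ge0.
have := @star_ineq R n psi D T e cw psi_sym psi_ge0 tree_pos_inj cw_node cw_root cw_ge0 k outside
  erefl out0 (indep_sub sub0 outside_indep)
  (fun a => indep_sub (sub a) outside_indep) l h D0 s0 l0 lo hi.
under eq_bigr do rewrite -gibbsW_root.
by under [X in _ <= _ * X]eq_bigr do rewrite -gibbsW_root -disagree_root.
Qed.

Local Notation p := (psi true true).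
Local Notation s := (psi true false).
Local Notation q := (psi false false).
Local Notation F := (bpF p s q D).

Lemma star_ball_ferro (l h : nat -> R) : (0 < D)%N -> 0 < s -> s ^+ 2 <= p * q -> 0 < p ->
  l 0%N = s / p -> h 0%N = q / s -> (forall t, l t.+1 = F (l t)) ->
  (forall t, h t.+1 = F (h t)) -> (forall t, 0 < l t <= h t) ->
  (D.+1)%:R * (s * (Num.min (bpg p q D (l k)) (bpg p q D (h k)) - s)) * \sum_x gibbsW psi G x <=
  (p * q - s ^+ 2) * \sum_x gibbsW psi G x * nbr_disagree R G v x.
Proof.
move=> D0 s0 fe p0 l0 h0 lS hS lh.
have lt0 t : 0 < l t by have /andP[] := lh t.
have ht0 t : 0 < h t by have /andP[h1] := lh t; apply: lt_le_trans.
suff [lo hi] : box_lo psi D T e cw k (l k) /\ box_hi psi D T e cw k (h k) by apply: star_ball.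
suff key j : box_lo psi D T e cw j (l j) /\ box_hi psi D T e cw j (h j) by exact: key.
elim: j => [|m [IH1 IH2]]; first by rewrite l0 h0; apply: box_base_ferro => //; exact: cw_ge0.
rewrite lS hS; split.
- by apply: box_step_ferro_lo => //; [exact: tree_pos_inj | exact: cw_node | exact: cw_ge0].
- by apply: box_step_ferro_hi => //; [exact: tree_pos_inj | exact: cw_node | exact: cw_ge0].
Qed.

(** One level more than in the ferromagnet: the upper bound [F (q / s)] holds only after one step of
    the recursion. *)
Lemma star_ball_anti (m : nat) (l h : nat -> R) : k = m.+1 ->
  (0 < D)%N -> 0 < s -> p * q < s ^+ 2 ->
  l 0%N = q / s -> h 0%N = F (q / s) -> (forall t, l t.+1 = F (h t)) ->
  (forall t, h t.+1 = F (l t)) -> (forall t, 0 < l t <= h t) ->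
  (D.+1)%:R * (s * (Num.min (bpg p q D (l m)) (bpg p q D (h m)) - s)) * \sum_x gibbsW psi G x <=
  (p * q - s ^+ 2) * \sum_x gibbsW psi G x * nbr_disagree R G v x.
Proof.
move=> km D0 s0 /ltW fe l0 h0 lS hS lh.
have lt0 t : 0 < l t by have /andP[] := lh t.
have ht0 t : 0 < h t by have /andP[h1] := lh t; apply: lt_le_trans.
suff [lo hi] : box_lo psi D T e cw k (l m) /\ box_hi psi D T e cw k (h m) by apply: star_ball.
have base j : box_lo psi D T e cw j (q / s) by apply: box_base_anti => //; exact: cw_ge0.
have key j : box_lo psi D T e cw j.+1 (l j) /\ box_hi psi D T e cw j.+1 (h j).
  elim: j => [|j [IH1 IH2]].
    rewrite l0 h0; split; first exact: base.
    by apply: box_step_anti_hi => //; [exact: tree_pos_inj | exact: cw_node | exact: cw_ge0 | rewrite -l0].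
  rewrite lS hS; split.
  - by apply: box_step_anti_lo => //; [exact: tree_pos_inj | exact: cw_node | exact: cw_ge0].
  - by apply: box_step_anti_hi => //; [exact: tree_pos_inj | exact: cw_node | exact: cw_ge0].
by have := key m; rewrite -km.
Qed.

End BallTree.

(** * The mean number of disagreeing edges *)

Definition ew (R : realType) (p s q : R) (a b : bool) : R :=
  if a then (if b then p else s) else (if b then s else q).

Definition Zed (R : realType) (p s q : R) n (G : graph n) : R :=
  \sum_x gibbsW (ew p s q) G x.

Definition edisagree (R : realType) n (G : graph n) (x : {ffun 'I_n -> bool}) : R :=
  \sum_(e : 'I_n * 'I_n | (nat_of_ord e.1 < nat_of_ord e.2)%N && adj G e.1 e.2)
     (x e.1 != x e.2)%:R.

Definition mdisagree (R : realType) (p s q : R) n (G : graph n) : R :=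
  (\sum_x gibbsW (ew p s q) G x * edisagree R G x) / Zed p s q G.

Lemma ew_sym (R : realType) (p s q : R) a b : ew p s q a b = ew p s q b a.
Proof. by case: a; case: b. Qed.

Lemma ew_ge0 (R : realType) (p s q : R) a b : 0 <= p -> 0 <= s -> 0 <= q -> 0 <= ew p s q a b.
Proof. by case: a; case: b. Qed.

Lemma gibbsW_ge0 (R : realType) (p s q : R) n (G : graph n) x :
  0 <= p -> 0 <= s -> 0 <= q -> 0 <= gibbsW (ew p s q) G x.
Proof. by move=> *; apply: prodr_ge0 => e _; exact: ew_ge0. Qed.

Lemma big_edges (T : Type) (idx : T) (op : Monoid.com_law idx) n (G : graph n)
    (F : 'I_n -> 'I_n -> T) : simple_graph G ->
  \big[op/idx]_(e : 'I_n * 'I_n | (nat_of_ord e.1 < nat_of_ord e.2)%N && adj G e.1 e.2)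
     op (F e.1 e.2) (F e.2 e.1) = \big[op/idx]_i \big[op/idx]_(j | adj G i j) F i j.
Proof.
move=> [Gs Gi]; rewrite big_split /= pair_big_dep /=.
rewrite [RHS](bigID (fun e : 'I_n * 'I_n => (e.1 < e.2)%N)) /=; congr (op _ _).
  by apply: eq_bigl => e; rewrite andbC.
rewrite (reindex_inj (h := fun e : 'I_n * 'I_n => (e.2, e.1))) /=; last by move=> [a b] [c d] [-> ->].
apply: eq_bigl => -[i j] /=; rewrite Gs; case aij: (adj G i j); last by rewrite andbF.
have ij : i != j by apply: contraTneq aij => ->; exact: Gi.
by rewrite andbT /= -leqNgt ltn_neqAle eq_sym ij.
Qed.

Lemma sum_nbr_disagree (R : realType) n (G : graph n) x : simple_graph G ->
  \sum_v nbr_disagree R G v x = 2 * edisagree R G x.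
Proof.
move=> Gs; rewrite /nbr_disagree -big_edges // /edisagree mulr_sumr.
by apply: eq_bigr => e _ /=; rewrite [x e.2 == _]eq_sym mulr_natl mulr2n.
Qed.

Lemma degE n (G : graph n) v : deg G v = (\sum_(j | adj G v j) 1)%N.
Proof.
rewrite sum1_card /deg; apply: eq_card => j.
exact: asboolb.
Qed.

Lemma nbr_disagree_le (R : realType) n (G : graph n) v x :
  0 <= nbr_disagree R G v x <= (deg G v)%:R.
Proof.
rewrite sumr_ge0 //= /nbr_disagree degE natr_sum.
by apply: ler_sum => j _; rewrite lern1 leq_b1.
Qed.

Lemma Zed_gt0 (R : realType) (p s q : R) n (G : graph n) :
  0 <= p -> 0 <= s -> 0 <= q -> 0 < p \/ 0 < q -> 0 < Zed p s q G.
Proof.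
move=> p0 s0 q0 pq.
have key b : 0 < ew p s q b b -> 0 < Zed p s q G.
  move=> eb; rewrite /Zed (bigD1 [ffun=> b]) //= ltr_pwDl //.
    by apply: prodr_gt0 => e _; rewrite !ffunE.
  by apply: sumr_ge0 => x _; exact: gibbsW_ge0.
by case: pq => h; [apply: (key true) | apply: (key false)].
Qed.

Lemma gibbsW_scale (R : realType) (p s q t : R) n (G : graph n) x :
  gibbsW (ew p (s * expR t) q) G x = gibbsW (ew p s q) G x * expR (t * edisagree R G x).
Proof.
rewrite /edisagree mulr_sumr expR_sum -big_split; apply: eq_bigr => e _ /=.
by case: (x e.1); case: (x e.2); rewrite /= ?mulr0 ?mulr1 ?expR0 ?mulr1.
Qed.

Lemma expR_jensen (R : realType) (I : finType) (w y : I -> R) :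
  (forall i, 0 <= w i) -> 0 < \sum_i w i ->
  (\sum_i w i) * expR ((\sum_i w i * y i) / \sum_i w i) <= \sum_i w i * expR (y i).
Proof.
move=> w0 W0; set W := \sum_i w i in W0 *; set m := _ / W.
have em : m * W = \sum_i w i * y i by rewrite divfK // gt_eqF.
have k (t : R) : expR m * (1 + (t - m)) <= expR t.
  by rewrite -[X in _ <= expR X](subrKC m) expRD ler_pM2l ?expR_gt0 // expR_ge1Dx.
apply: (@le_trans _ _ (\sum_i w i * (expR m * (1 + (y i - m))))); last first.
  by apply: ler_sum => i _; rewrite ler_wpM2l.
have -> : \sum_i w i * (expR m * (1 + (y i - m))) =
   expR m * (W + (\sum_i w i * y i - m * W)).
  rewrite /W !mulr_sumr -sumrB -big_split /= mulr_sumr; apply: eq_bigr => i _; ring.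
by rewrite -em subrr addr0 mulrC.
Qed.

Lemma lnZ_convex (R : realType) (p s q t : R) n (G : graph n) :
  0 <= p -> 0 < s -> 0 <= q -> 0 < p \/ 0 < q ->
  ln (Zed p s q G) + t * mdisagree p s q G <= ln (Zed p (s * expR t) q G).
Proof.
move=> p0 s0 q0 pq; have Z0 := Zed_gt0 G p0 (ltW s0) q0 pq.
have s1 : 0 < s * expR t by rewrite mulr_gt0 // expR_gt0.
have Z1 := Zed_gt0 G p0 (ltW s1) q0 pq.
have W0 x := gibbsW_ge0 G x p0 (ltW s0) q0.
have := expR_jensen (fun x => t * edisagree R G x) W0 Z0.
rewrite -/(Zed p s q G).
have -> : \sum_i gibbsW (ew p s q) G i * expR (t * edisagree R G i) = Zed p (s * expR t) q G.
  by apply: eq_bigr => x _; rewrite gibbsW_scale.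
have -> : (\sum_i gibbsW (ew p s q) G i * (t * edisagree R G i)) / Zed p s q G =
   t * mdisagree p s q G.
  rewrite /mdisagree mulrA mulr_sumr; congr (_ / _).
  by apply: eq_bigr => x _; rewrite mulrCA.
move=> h; have E0 := expR_gt0 (t * mdisagree p s q G).
rewrite -ler_ln ?posrE ?mulr_gt0 // in h.
by rewrite lnM ?posrE // expRK in h.
Qed.

Section StarGraph.
Variables (R : realType) (p s q : R) (D : nat).
Hypotheses (D0 : (0 < D)%N) (p0 : 0 <= p) (s0 : 0 < s) (q0 : 0 <= q).
Local Notation F := (bpF p s q D).
Local Notation g := (bpg p q D).

Lemma star_ferro n (G : graph n) v k (l h : nat -> R) :
  simple_graph G -> ball_iso_tree G D.+1 k.+1 v -> s ^+ 2 <= p * q -> 0 < p ->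
  l 0%N = s / p -> h 0%N = q / s -> (forall t, l t.+1 = F (l t)) ->
  (forall t, h t.+1 = F (h t)) -> (forall t, 0 < l t <= h t) ->
  (D.+1)%:R * (s * (Num.min (g (l k)) (g (h k)) - s)) * Zed p s q G <=
  (p * q - s ^+ 2) * \sum_x gibbsW (ew p s q) G x * nbr_disagree R G v x.
Proof.
move=> Gs [f [fv finj ftv fsurj fadj]] fe p0' l0 h0 lS hS lh.
apply: (@star_ball_ferro R n G (ew p s q) D k v f) => //; first exact: ew_sym.
by move=> a b; apply: ew_ge0 => //; exact: ltW.
Qed.

Lemma star_anti n (G : graph n) v k (l h : nat -> R) :
  simple_graph G -> ball_iso_tree G D.+1 k.+2 v -> p * q < s ^+ 2 ->
  l 0%N = q / s -> h 0%N = F (q / s) -> (forall t, l t.+1 = F (h t)) ->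
  (forall t, h t.+1 = F (l t)) -> (forall t, 0 < l t <= h t) ->
  (D.+1)%:R * (s * (Num.min (g (l k)) (g (h k)) - s)) * Zed p s q G <=
  (p * q - s ^+ 2) * \sum_x gibbsW (ew p s q) G x * nbr_disagree R G v x.
Proof.
move=> Gs [f [fv finj ftv fsurj fadj]] fe l0 h0 lS hS lh.
apply: (@star_ball_anti R n G (ew p s q) D k.+1 v f) => //; first exact: ew_sym.
by move=> a b; apply: ew_ge0 => //; exact: ltW.
Qed.

End StarGraph.

Definition degdev (R : realType) d n (G : graph n) : R := \sum_v `|(deg G v)%:R - d%:R|.

Definition nbad n (E : 'I_n -> Prop) : nat := #|[set v | ~~ `[< E v >] ]|.

Lemma nbadE (R : realType) n (E : 'I_n -> Prop) :
  (nbad E)%:R = \sum_v (~~ `[< E v >])%:R :> R.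
Proof.
rewrite /nbad -sum1_card natr_sum big_mkcond /=; apply: eq_bigr => v _.
by rewrite inE; case: asboolP.
Qed.

Section MeanDisagree.
Variables (R : realType) (p s q : R) (d n : nat) (G : graph n) (E : 'I_n -> Prop).
Hypotheses (p0 : 0 <= p) (s0 : 0 < s) (q0 : 0 <= q) (pq : 0 < p \/ 0 < q).
Hypothesis Gs : simple_graph G.
Local Notation Z := (Zed p s q G).
Local Notation A v := ((\sum_x gibbsW (ew p s q) G x * nbr_disagree R G v x) / Z).

Lemma mdisagree_sum : 2 * mdisagree p s q G = \sum_v A v.
Proof.
rewrite /mdisagree mulrA mulr_sumr -mulr_suml exchange_big /=; congr (_ / _).
by apply: eq_bigr => x _; rewrite -mulr_sumr sum_nbr_disagree // mulrCA.
Qed.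

Lemma A_range v : 0 <= A v <= (deg G v)%:R.
Proof.
have Z0 := Zed_gt0 G p0 (ltW s0) q0 pq.
have W0 x := gibbsW_ge0 G x p0 (ltW s0) q0.
rewrite divr_ge0 ?(ltW Z0) //=; last first.
  by apply: sumr_ge0 => x _; rewrite mulr_ge0 //; have /andP[] := nbr_disagree_le R G v x.
rewrite ler_pdivrMr // /Zed mulr_sumr; apply: ler_sum => x _.
by rewrite mulrC ler_wpM2r //; have /andP[] := nbr_disagree_le R G v x.
Qed.

Lemma mdisagree_ge (O : R) : (forall v, E v -> d%:R * O <= A v) ->
  n%:R * (d%:R / 2 * O) - d%:R / 2 * `|O| * (nbad E)%:R <= mdisagree p s q G.
Proof.
move=> good.
suff : n%:R * (d%:R * O) - d%:R * `|O| * (nbad E)%:R <= 2 * mdisagree p s q G by lra.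
rewrite mdisagree_sum nbadE mulr_sumr.
have -> : n%:R * (d%:R * O) = \sum_(v < n) d%:R * O by rewrite sumr_const card_ord mulr_natl.
rewrite -sumrB; apply: ler_sum => v _.
have /andP[A0 _] := A_range v.
case: asboolP => Ev /=; first by rewrite mulr0 subr0; apply: good.
have h1 := ler_norm O.
have := ler_wpM2l (ler0n R d) h1; lra.
Qed.

(** At a bad vertex the disagreement is controlled only by the degree, whence the degree deviation;
    the lower bound uses nonnegativity there instead. *)
Lemma mdisagree_le (O : R) : (forall v, E v -> A v <= d%:R * O) ->
  mdisagree p s q G <= n%:R * (d%:R / 2 * O) + d%:R / 2 * (1 + `|O|) * (nbad E)%:R + degdev R d G.
Proof.
move=> good.
have dev0 : 0 <= degdev R d G by apply: sumr_ge0.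
suff : 2 * mdisagree p s q G <= n%:R * (d%:R * O) + d%:R * (1 + `|O|) * (nbad E)%:R + degdev R d G by lra.
rewrite mdisagree_sum nbadE mulr_sumr.
have -> : n%:R * (d%:R * O) = \sum_(v < n) d%:R * O by rewrite sumr_const card_ord mulr_natl.
rewrite /degdev -!big_split /=; apply: ler_sum => v _.
have /andP[_ A1] := A_range v.
have n0 := normr_ge0 ((deg G v)%:R - d%:R : R).
case: asboolP => Ev /=; first by have := good v Ev; lra.
have h1 : - O <= `|O| by rewrite ler_normr lexx orbT.
have h2 := ler_norm ((deg G v)%:R - d%:R : R).
have := ler_wpM2l (ler0n R d) h1; lra.
Qed.

End MeanDisagree.

(** * Explicit bounds at the ends of the path *)

Section EndPoints.
Variables (R : realType) (n : nat) (G : graph n) (d : nat).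
Hypothesis Gs : simple_graph G.
Local Notation edge e := ((nat_of_ord e.1 < nat_of_ord e.2)%N && adj G e.1 e.2).
Local Notation dev := (degdev R d G).

Definition nedges : R := \sum_(e : 'I_n * 'I_n | edge e) 1.

Lemma nedgesE : 2 * nedges = \sum_v (deg G v)%:R.
Proof.
transitivity (\sum_i \sum_(j | adj G i j) (1 : R)).
  rewrite -big_edges // /nedges mulr_sumr; apply: eq_bigr => e _ /=; ring.
by apply: eq_bigr => v _; rewrite degE natr_sum.
Qed.

Lemma degdev_ge0 : 0 <= dev. Proof. by apply: sumr_ge0. Qed.

Lemma nedges_ge (a : R) : n%:R * (d%:R / 2 * a) - `|a| * dev <= nedges * a.
Proof.
suff : - (`|a| * dev) <= (2 * nedges - n%:R * d%:R) * a.
  have := mulr_ge0 (normr_ge0 a) degdev_ge0; lra.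
have h : `|2 * nedges - n%:R * d%:R| <= dev.
  rewrite nedgesE; have -> : n%:R * d%:R = \sum_(v < n) d%:R :> R.
    by rewrite sumr_const card_ord mulr_natl.
  by rewrite -sumrB ler_norm_sum.
have := ler_wpM2l (normr_ge0 a) h; rewrite -normrM mulrC => h2.
have := ler_norm (- ((2 * nedges - n%:R * d%:R) * a)); rewrite normrN; lra.
Qed.

Lemma bad_edges (E : 'I_n -> Prop) :
  \sum_(e : 'I_n * 'I_n | edge e) ((~~ `[< E e.1 >])%:R + (~~ `[< E e.2 >])%:R) <=
  d%:R * (nbad E)%:R + dev :> R.
Proof.
rewrite (big_edges _ (fun i _ => (~~ `[< E i >])%:R : R)) // nbadE mulr_sumr -big_split /=.
apply: ler_sum => v _; rewrite sumr_const.
have -> : #|[pred j | adj G v j]| = deg G v by rewrite degE sum1_card.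
case: asboolP => Ev /=; first by rewrite mul0rn mulr0 add0r.
rewrite mulr1; have := ler_norm ((deg G v)%:R - d%:R : R); lra.
Qed.

Lemma lnZ_plus (p s q : R) : 0 < p -> 0 <= s -> 0 <= q ->
  n%:R * (d%:R / 2 * ln p) - `|ln p| * dev <= ln (Zed p s q G).
Proof.
move=> p0 s0 q0; apply: le_trans (nedges_ge _) _.
have Z0 := Zed_gt0 G (ltW p0) s0 q0 (or_introl p0).
have e1 : gibbsW (ew p s q) G [ffun=> true] = expR (nedges * ln p).
  rewrite /nedges mulr_suml expR_sum; apply: eq_bigr => e _.
  by rewrite !ffunE /= mul1r lnK // posrE.
rewrite -[X in X <= _]expRK -e1 ler_ln ?posrE //; last by rewrite e1 expR_gt0.
rewrite /Zed (bigD1 [ffun=> true]) //= lerDl.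
by apply: sumr_ge0 => x _; apply: gibbsW_ge0 => //; exact: ltW.
Qed.

Lemma lnZ_alternating (p s q : R) (tau : 'I_n -> bool) (E : 'I_n -> Prop) :
  0 <= p -> 0 < s -> 0 < q -> (forall v j, E v -> adj G v j -> tau j = ~~ tau v) ->
  n%:R * (d%:R / 2 * ln s) - (2 * `|ln s| + `|ln q|) * (d%:R * (nbad E)%:R + dev) <=
  ln (Zed p s q G).
Proof.
move=> p0 s0 q0 alt.
have Z0 := Zed_gt0 G p0 (ltW s0) (ltW q0) (or_intror q0).
(* The colouring [tau] itself could have plus-plus edges, of weight [p], possibly zero. A plus is
   kept only if all neighbours are coloured minus; every edge is then [+-] or [--], and [--] edges
   have an end outside [E]. *)
pose x : {ffun 'I_n -> bool} := [ffun v => tau v && [forall j, adj G v j ==> ~~ tau j]].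
pose y (e : 'I_n * 'I_n) : R := if x e.1 == x e.2 then ln q else ln s.
have noPP e : edge e -> ~~ (x e.1 && x e.2).
  move=> /andP[_ a12]; apply/negP; rewrite !ffunE => /andP[/andP[_ /forallP h1] /andP[t2 _]].
  by have := h1 e.2; rewrite a12 t2.
have eW : gibbsW (ew p s q) G x = expR (\sum_(e : 'I_n * 'I_n | edge e) y e).
  rewrite expR_sum; apply: eq_bigr => e /noPP; rewrite /y.
  by case: (x e.1); case: (x e.2) => //= _; rewrite lnK // posrE.
have bad e : edge e -> x e.1 = x e.2 -> 1 <= (~~ `[< E e.1 >])%:R + (~~ `[< E e.2 >])%:R :> R.
  move=> ee xx; case: (asboolP (E e.1)) => E1; case: (asboolP (E e.2)) => E2 /=; rewrite ?addr0 ?add0r //; last lra.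
  exfalso; have /andP[_ a12] := ee.
  have a21 : adj G e.2 e.1 by rewrite (Gs.1).
  have t12 := alt _ _ E1 a12; have := noPP e ee; rewrite -xx andbb.
  have full u : E u -> tau u -> x u.
    move=> Eu tu; rewrite ffunE tu /=; apply/forallP => j; apply/implyP => aj.
    by rewrite (alt u j) // tu.
  case t1: (tau e.1); first by rewrite full.
  by rewrite xx full // t12 t1.
have lnW : \sum_(e : 'I_n * 'I_n | edge e) y e <= ln (Zed p s q G).
  rewrite -[X in X <= _]expRK -eW ler_ln ?posrE //; last by rewrite eW expR_gt0.
  rewrite /Zed (bigD1 x) //= lerDl.
  by apply: sumr_ge0 => z _; apply: gibbsW_ge0 => //; exact: ltW.
apply: le_trans lnW.
set C := `|ln s| + `|ln q|.
have C0 : 0 <= C by rewrite addr_ge0.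
have h1 : \sum_(e : 'I_n * 'I_n | edge e) (ln s - C * ((~~ `[< E e.1 >])%:R + (~~ `[< E e.2 >])%:R)) <=
    \sum_(e : 'I_n * 'I_n | edge e) y e.
  apply: ler_sum => e ee; rewrite /y; case: eqP => xx.
    have := ler_wpM2l C0 (bad e ee xx); rewrite mulr1.
    have := ler_norm (ln s); have := ler_norm (- ln q); rewrite normrN /C; lra.
  have : 0 <= C * ((~~ `[< E e.1 >])%:R + (~~ `[< E e.2 >])%:R) by rewrite mulr_ge0 // addr_ge0.
  lra.
apply: le_trans h1; rewrite sumrB -mulr_sumr.
have -> : \sum_(e : 'I_n * 'I_n | edge e) ln s = nedges * ln s.
  by rewrite /nedges mulr_suml; apply: eq_bigr => e _; rewrite mul1r.
have h2 := ler_wpM2l C0 (bad_edges E).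
have h3 := nedges_ge (ln s).
have h4 : 0 <= `|ln s| * (d%:R * (nbad E)%:R) by rewrite !mulr_ge0.
rewrite /C in h2 *; lra.
Qed.

Lemma gibbsW_prod (psi : bool -> bool -> R) (u : bool -> R) x :
  gibbsW (fun a b => psi a b * u a * u b) G x = gibbsW psi G x * \prod_v u (x v) ^+ deg G v.
Proof.
have -> : \prod_v u (x v) ^+ deg G v = \prod_v \prod_(j | adj G v j) u (x v).
  by apply: eq_bigr => v _; rewrite prodr_const degE sum1_card.
rewrite -big_edges // -big_split; apply: eq_bigr => e _ /=; by rewrite mulrA.
Qed.

Lemma Zed_product (a b : R) :
  Zed (a ^+ 2) (a * b) (b ^+ 2) G = \prod_v (a ^+ deg G v + b ^+ deg G v).
Proof.
pose u (c : bool) := if c then a else b.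
transitivity (\sum_(x : {ffun 'I_n -> bool}) \prod_v u (x v) ^+ deg G v).
  apply: eq_bigr => x _; have := gibbsW_prod (fun _ _ => 1) u x.
  rewrite [X in _ = X * _]big1 ?mul1r // => <-; apply: eq_bigr => e _.
  by case: (x e.1); case: (x e.2); rewrite /= mul1r ?expr2 // mulrC.
rewrite -(bigA_distr_bigA (fun v c => u c ^+ deg G v)) /=; apply: eq_bigr => v _.
by rewrite big_bool /= addrC.
Qed.

Lemma pow_dev (a : R) m : 0 < a ->
  a ^+ m <= a ^+ d * expR (`|ln a| * `|m%:R - d%:R|).
Proof.
move=> a0; have eX k : a ^+ k = expR (ln a * k%:R) by rewrite mulrC expRM_natl lnK ?posrE.
rewrite !eX -expRD ler_expR.
have := ler_norm (ln a * (m%:R - d%:R)); rewrite normrM; lra.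
Qed.

Lemma lnZ_product (a b : R) : 0 < a -> 0 < b ->
  ln (Zed (a ^+ 2) (a * b) (b ^+ 2) G) <=
  n%:R * ln (a ^+ d + b ^+ d) + (`|ln a| + `|ln b|) * dev.
Proof.
move=> a0 b0; set C := `|ln a| + `|ln b|; set T := a ^+ d + b ^+ d.
have T0 : 0 < T by rewrite addr_gt0 // exprn_gt0.
have C0 : 0 <= C by rewrite addr_ge0.
have Z0 : 0 < Zed (a ^+ 2) (a * b) (b ^+ 2) G.
  by rewrite Zed_product; apply: prodr_gt0 => v _; rewrite addr_gt0 // exprn_gt0.
have -> : n%:R * ln T + C * dev = \sum_v (ln T + C * `|(deg G v)%:R - d%:R|).
  by rewrite big_split /= sumr_const card_ord mulr_natl /degdev mulr_sumr.
rewrite -[leRHS]expRK ler_ln ?posrE ?expR_gt0 // expR_sum Zed_product.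
apply: ler_prod => v _; rewrite addr_ge0 ?exprn_ge0 ?(ltW a0) ?(ltW b0) //= expRD lnK ?posrE // /T mulrDl.
have mono (c : R) : 0 < c -> `|ln c| <= C ->
    c ^+ deg G v <= c ^+ d * expR (C * `|(deg G v)%:R - d%:R|).
  move=> c0 cC; apply: le_trans (pow_dev _ c0) _.
  by rewrite ler_pM2l ?exprn_gt0 // ler_expR ler_wpM2r.
by rewrite lerD // mono // /C ?lerDl ?lerDr.
Qed.

Lemma Zed_flip (p s q : R) : Zed p s q G = Zed q s p G.
Proof.
pose h (x : {ffun 'I_n -> bool}) : {ffun 'I_n -> bool} := [ffun j => ~~ x j].
have hK : involutive h by move=> x; apply/ffunP => j; rewrite !ffunE negbK.
rewrite /Zed (reindex_inj (inv_inj hK)) /=; apply: eq_bigr => x _; apply: eq_bigr => e _.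
by rewrite !ffunE; case: (x e.1); case: (x e.2).
Qed.

Lemma Zed_mono (p p' s q : R) : 0 <= p -> 0 <= s -> 0 <= q -> p <= p' ->
  Zed p s q G <= Zed p' s q G.
Proof.
move=> p0 s0 q0 pp; apply: ler_sum => x _; apply: ler_prod => e _; rewrite ew_ge0 //=.
by case: (x e.1); case: (x e.2).
Qed.

(** Moving a factor [u b] from the vertex to each incident edge is exact at degree [d]; elsewhere it
    leaves a power [d - deg] of [u b]. *)
Lemma lnZpart_gauge (psi : bool -> bool -> R) (u : bool -> R) (p s q : R) :
  (forall b, 0 < u b) -> (forall a b, ew p s q a b = psi a b * u a * u b) ->
  0 <= p -> 0 <= s -> 0 <= q -> 0 < p \/ 0 < q ->
  `|ln (Zpart psi (fun b => u b ^+ d) G) - ln (Zed p s q G)| <=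
  (`|ln (u true)| + `|ln (u false)|) * dev.
Proof.
move=> u0 eqw p0 s0 q0 pq; set C := (X in _ <= X * _).
have Z0 := Zed_gt0 G p0 s0 q0 pq.
have C0 : 0 <= C by rewrite addr_ge0.
have uC b : `|ln (u b)| <= C by case: b; rewrite /C ?lerDl ?lerDr.
have W0 x := gibbsW_ge0 G x p0 s0 q0.
have eWp x : gibbsW (ew p s q) G x = gibbsW psi G x * \prod_v u (x v) ^+ deg G v.
  by rewrite -gibbsW_prod; apply: eq_bigr => e _; exact: eqw.
pose r x : R := \sum_v (ln (u (x v)) * (d%:R - (deg G v)%:R)).
have eX b k : u b ^+ k = expR (ln (u b) * k%:R) by rewrite mulrC expRM_natl lnK ?posrE.
have eT x : gibbsW psi G x * \prod_v u (x v) ^+ d = gibbsW (ew p s q) G x * expR (r x).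
  rewrite eWp -mulrA /r expR_sum -big_split /=; congr (_ * _); apply: eq_bigr => v _.
  by rewrite !eX -expRD; congr expR; ring.
have rC x : `|r x| <= C * dev.
  rewrite /r /degdev mulr_sumr; apply: le_trans (ler_norm_sum _ _ _) _; apply: ler_sum => v _.
  by rewrite normrM distrC ler_wpM2r.
have eZ : Zpart psi (fun b => u b ^+ d) G = \sum_x gibbsW (ew p s q) G x * expR (r x).
  by apply: eq_bigr => x _; rewrite -eT.
have up : Zpart psi (fun b => u b ^+ d) G <= Zed p s q G * expR (C * dev).
  rewrite eZ /Zed mulr_suml; apply: ler_sum => x _; rewrite ler_wpM2l // ler_expR.
  by apply: le_trans (ler_norm _) (rC x).
have lo : Zed p s q G * expR (- (C * dev)) <= Zpart psi (fun b => u b ^+ d) G.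
  rewrite eZ /Zed mulr_suml; apply: ler_sum => x _; rewrite ler_wpM2l // ler_expR.
  by rewrite lerNl; apply: le_trans (rC x); rewrite -normrN ler_norm.
have Zp0 : 0 < Zpart psi (fun b => u b ^+ d) G.
  by apply: lt_le_trans lo; rewrite mulr_gt0 ?expR_gt0.
have E0 t : 0 < expR t := expR_gt0 (t : R).
rewrite -ler_ln ?posrE ?mulr_gt0 // in up; rewrite -ler_ln ?posrE ?mulr_gt0 // in lo.
rewrite lnM ?posrE // expRK in up; rewrite lnM ?posrE // expRK in lo.
by rewrite ler_norml; apply/andP; split; lra.
Qed.

End EndPoints.

Lemma deg_ball_tree n (G : graph n) D v : simple_graph G ->
  ball_iso_tree G D.+1 1 v -> deg G v = D.+1.
Proof.
move=> Gs [f [fv finj ftv fsurj fadj]].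
by rewrite degE (@root_nbr_big n G D 0 v f) // sum1_card card_ord.
Qed.

(** * Averages over the random graph *)

Definition ev (Q : nat -> Prop) := exists N : nat, forall n, (N <= n)%N -> Q n.

Lemma evI (Q1 Q2 : nat -> Prop) : ev Q1 -> ev Q2 -> ev (fun n => Q1 n /\ Q2 n).
Proof.
move=> [N1 h1] [N2 h2]; exists (maxn N1 N2) => n; rewrite geq_max => /andP[a b].
by split; [exact: h1 | exact: h2].
Qed.

Lemma evS (Q1 Q2 : nat -> Prop) : (forall n, Q1 n -> Q2 n) -> ev Q1 -> ev Q2.
Proof. by move=> h [N hN]; exists N => n /hN /h. Qed.

Lemma ev_gt0 : ev (fun n => (0 < n)%N).
Proof. by exists 1%N. Qed.

Lemma cvg_ev (R : realType) (u : nat -> R) (l : R) : (u @ \oo --> l)%classic ->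
  forall e : R, 0 < e -> ev (fun n => `|u n - l| < e).
Proof.
move=> /cvgrPdist_lt h e e0; have [N _ hN] := h e e0.
by exists N => n Nn; rewrite distrC; apply: hN.
Qed.

Lemma ev_cvg (R : realType) (u : nat -> R) (l : R) :
  (forall e : R, 0 < e -> ev (fun n => `|u n - l| <= e)) -> (u @ \oo --> l)%classic.
Proof.
move=> h; apply/cvgrPdist_le => e e0; have [N hN] := h e e0.
by exists N => // n Nn; rewrite distrC; apply: hN.
Qed.

Section Law.
Variables (R : realType) (P : forall n, graph n -> R).
Hypothesis HP : forall n, graph_law (@P n).

(* [EE X] is [E_n(X) / n]. *)
Definition EE n (X : graph n -> R) : R := n%:R^-1 * \sum_G P G * X G.

Lemma EE_le n (X Y : graph n -> R) : (forall G, simple_graph G -> X G <= Y G) -> EE X <= EE Y.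
Proof.
move=> h; have [P0 _ Ps] := HP n; rewrite ler_wpM2l ?invr_ge0 //; apply: ler_sum => G _.
have := P0 G; rewrite le_eqVlt => /orP[/eqP <-|Pg]; first by rewrite !mul0r.
by rewrite ler_pM2l //; apply: h; exact: Ps.
Qed.

Lemma EED n (X Y : graph n -> R) : EE (fun G => X G + Y G) = EE X + EE Y.
Proof.
by rewrite /EE -mulrDr -big_split /=; congr (_ * _); apply: eq_bigr => G _; rewrite mulrDr.
Qed.

Lemma EEZ n (a : R) (X : graph n -> R) : EE (fun G => a * X G) = a * EE X.
Proof.
by rewrite /EE mulrCA; congr (_ * _); rewrite mulr_sumr; apply: eq_bigr => G _; rewrite mulrCA.
Qed.

Lemma EEn n (a : R) : (0 < n)%N -> EE (fun _ : graph n => n%:R * a) = a.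
Proof.
move=> n0; have [_ P1 _] := HP n.
by rewrite /EE -mulr_suml P1 mul1r mulKf // pnatr_eq0 -lt0n.
Qed.

Lemma EE_ge0 n (X : graph n -> R) : (forall G, 0 <= X G) -> 0 <= EE X.
Proof.
move=> h; have [P0 _ _] := HP n; rewrite mulr_ge0 ?invr_ge0 //.
by apply: sumr_ge0 => G _; rewrite mulr_ge0.
Qed.

Lemma card_classical n (Q : 'I_n -> Prop) :
  #|classical_sets.in_set (fun v => `[< Q v >] : Prop)| = (\sum_v `[< Q v >])%N.
Proof.
rewrite -sum1_card big_mkcond /=; apply: eq_bigr => v _.
have -> : (v \in classical_sets.in_set (fun v => `[< Q v >] : Prop)) = `[< Q v >] by exact: asboolb.
by case: `[< Q v >].
Qed.

Lemma prob_EE n (E : graph n -> 'I_n -> Prop) :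
  prob_vertex (@P n) E = EE (fun G => \sum_v `[< E G v >]%:R).
Proof.
rewrite /prob_vertex /EE mulr_sumr; apply: eq_bigr => G _.
have -> : (#|[set v | `[< E G v >] ]%classic|)%:R = \sum_v `[< E G v >]%:R :> R.
  by rewrite -natr_sum; congr (_%:R); exact: card_classical.
by rewrite mulrA mulrC.
Qed.

Lemma EE_nbad n (E : graph n -> 'I_n -> Prop) : (0 < n)%N ->
  EE (fun G => (nbad (E G))%:R) = 1 - prob_vertex (@P n) E.
Proof.
move=> n0; apply/eqP; rewrite eq_sym subr_eq; apply/eqP.
transitivity (EE (fun _ : graph n => n%:R * 1)); first by rewrite EEn.
rewrite prob_EE -EED; congr (_ * _); apply: eq_bigr => G _; congr (_ * _).
rewrite nbadE -big_split mulr1 -[X in X%:R = _](card_ord n) -sum1_card natr_sum.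
by apply: eq_bigr => v _; case: `[< _ >]; rewrite /= ?addr0 ?add0r.
Qed.

Section Local.
Variables (D : nat).
Hypothesis us : uniformly_sparse P.
Hypothesis lc : converges_locally_to_Td P D.+1.

Lemma EE_bad_tree T (e : R) : 0 < e ->
  ev (fun n => EE (fun G : graph n => (nbad (ball_iso_tree G D.+1 T))%:R) <= e).
Proof.
move=> e0; have := evI ev_gt0 (cvg_ev (lc T) e0); apply: evS => n [n0].
rewrite EE_nbad // => h; have := ler_norm (- (prob_vertex (@P n) (fun G v => ball_iso_tree G D.+1 T v) - 1)).
rewrite normrN; lra.
Qed.

(** A vertex whose unit ball is a tree has degree exactly [D.+1]. The others are few: those of
    degree below [L] contribute at most [c] each, and the rest is covered by the sparsity tail. *)
Lemma EE_degdev (e : R) : 0 < e -> ev (fun n => EE (fun G : graph n => degdev R D.+1 G) <= e).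
Proof.
move=> e0; have e2 : 0 < e / 2 by lra.
have [L /(_ L (leqnn L)) sp] := us e2.
set c : R := L%:R + (D.+1)%:R.
have c0 : 0 < c by rewrite ltr_wpDl // ltr0n.
have e3 : 0 < e / 2 / c by rewrite divr_gt0.
have := evI sp (EE_bad_tree 1 e3); apply: evS => n [h1 h2].
pose tail (G : graph n) : R := \sum_v (if (L <= deg G v)%N then (deg G v)%:R else 0).
have eT : sparse_tail (@P n) L = EE tail.
  rewrite /sparse_tail /EE mulr_sumr; apply: eq_bigr => G _.
  by rewrite mulrA mulrC.
apply: (@le_trans _ _ (EE (fun G => c * (nbad (ball_iso_tree G D.+1 1))%:R + tail G))).
  apply: EE_le => G Gs; rewrite nbadE mulr_sumr -big_split; apply: ler_sum => v _ /=.
  case: asboolP => bt /=.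
    rewrite (deg_ball_tree Gs bt) subrr normr0 mulr0 add0r; by case: ifP.
  rewrite mulr1; apply: le_trans (ler_normB _ _) _; rewrite !ger0_norm //.
  case: ifP => Ld; first by rewrite /c; have := ler0n R L; lra.
  rewrite addr0 /c lerD2r ler_nat ltnW // ltnNge Ld //.
rewrite EED EEZ -eT.
have := ler_wpM2l (ltW c0) h2; rewrite [c * (e / 2 / c)]mulrC divfK ?gt_eqF //; lra.
Qed.

End Local.

Definition alt_good n (G : graph n) (tau : 'I_n -> bool) D v :=
  ball_iso_ctree G tau D.+1 1 colTplus v \/ ball_iso_ctree G tau D.+1 1 colTminus v.

Lemma alt_goodP n (G : graph n) (tau : 'I_n -> bool) D v j :
  alt_good G tau D v -> adj G v j -> tau j = ~~ tau v.
Proof.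
move=> ag vj.
have vB : v \in ballset G 1 v by exact: ballset_self.
have jB : j \in ballset G 1 v by apply: (@ballset_adj _ _ 0 _ v) => //; exact: ballset_self.
have key (f : 'I_n -> seq nat) : f v = [::] -> adj G v j = tree_adj (f v) (f j) -> size (f j) = 1%N.
  by move=> fv; rewrite vj fv /tree_adj /tree_child /=; case: (f j) => [|y [|z w]].
case: ag => -[f [[fv finj ftv fsurj fadj] fcol]]; rewrite !fcol //;
  by have := key f fv (fadj v j vB jB); rewrite /colTplus /colTminus fv => -> .
Qed.

(** The two coloured events exclude each other, because they give the root different colours, so
    their limiting probabilities [1 / 2] add up to 1. *)
Lemma EE_bad_alt D (tau : forall n, graph n -> 'I_n -> bool) :
  (forall t : nat,
      ((fun n : nat => prob_vertex (@P n)
          (fun G v => ball_iso_ctree G (tau n G) D.+1 t colTplus v)) @ \oo --> (1 / 2 : R))%classic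
      /\
      ((fun n : nat => prob_vertex (@P n)
          (fun G v => ball_iso_ctree G (tau n G) D.+1 t colTminus v)) @ \oo --> (1 / 2 : R))%classic) ->
  forall e : R, 0 < e ->
  ev (fun n => EE (fun G : graph n => (nbad (alt_good G (tau n G) D))%:R) <= e).
Proof.
move=> h e e0; have [h1 h2] := h 1%N; have e2 : 0 < e / 2 by lra.
have := evI ev_gt0 (evI (cvg_ev h1 e2) (cvg_ev h2 e2)); apply: evS => n [n0 [a1 a2]].
rewrite EE_nbad //.
have -> : prob_vertex (@P n) (fun G v => alt_good G (tau n G) D v) =
  prob_vertex (@P n) (fun G v => ball_iso_ctree G (tau n G) D.+1 1 colTplus v) +
  prob_vertex (@P n) (fun G v => ball_iso_ctree G (tau n G) D.+1 1 colTminus v).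
  rewrite !prob_EE -EED; congr (_ * _); apply: eq_bigr => G _; congr (_ * _).
  rewrite -big_split; apply: eq_bigr => v _ /=.
  case: (asboolP (ball_iso_ctree G (tau n G) D.+1 1 colTplus v)) => b1;
  case: (asboolP (ball_iso_ctree G (tau n G) D.+1 1 colTminus v)) => b2;
  case: asboolP => b3 /=; rewrite ?addr0 ?add0r //; try by [case: b3; left|case: b3; right|case: b3].
  - exfalso; case: b1 => f1 [[fv1 _ _ _ _] c1]; case: b2 => f2 [[fv2 _ _ _ _] c2].
    have vB : v \in ballset G 1 v by exact: ballset_self.
    by have := c1 v vB; rewrite (c2 v vB) /colTplus /colTminus fv1 fv2.
have n1 := ler_norm (- (prob_vertex (@P n) (fun G v => ball_iso_ctree G (tau n G) D.+1 1 colTplus v) - 1 / 2)).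
have n2 := ler_norm (- (prob_vertex (@P n) (fun G v => ball_iso_ctree G (tau n G) D.+1 1 colTminus v) - 1 / 2)).
rewrite !normrN in n1 n2; lra.
Qed.

End Law.

(* A discrete comparison of slopes: [f] grows at least as fast as its slopes at
   left endpoints, [phi] at most as fast as its slopes at right endpoints, and
   the two Riemann sums telescope. *)
Section Telescope.
Variables (R : realType) (f : nat -> R -> R) (Q : R -> R -> R -> Prop) (a b C : R).
Hypothesis Qfun : forall r phi g phi' g', Q r phi g -> Q r phi' g' -> phi = phi'.
Hypothesis Qbound : forall r phi g, Q r phi g -> `|g| <= C.
Hypothesis Qcmp : forall r r' phi g phi' g', r < r' -> Q r phi g -> Q r' phi' g' ->
  phi' - phi <= (r' - r) * g'.
Hypothesis Qstep : forall r, a <= r < b -> exists phi g, Q r phi g /\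
  forall dl e, 0 < dl -> 0 < e -> ev (fun n => dl * (g - e) <= f n (r + dl) - f n r).

(** The right and left Riemann sums of the slopes differ only by their extreme terms, whence
    [dl * (g' - g)]. *)
Lemma telescope_steps (dl e : R) m r phi g phi' g' : 0 < dl -> 0 < e -> a <= r ->
  r + m%:R * dl <= b -> Q r phi g ->
  (forall dl e, 0 < dl -> 0 < e -> ev (fun n => dl * (g - e) <= f n (r + dl) - f n r)) ->
  Q (r + m%:R * dl) phi' g' -> (0 < m)%N ->
  ev (fun n => phi' - phi - dl * (g' - g) - m%:R * (dl * e) <= f n (r + m%:R * dl) - f n r).
Proof.
move=> dl0 e0; elim: m r phi g => [//|m IH] r phi g ar rb Qr Sr Qr' _.
have step := Sr dl e dl0 e0.
have md0 : 0 <= m%:R * dl by rewrite mulr_ge0 // ltW.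
have eS : r + m.+1%:R * dl = r + dl + m%:R * dl by rewrite -natr1; ring.
have [m0|m0] := posnP m.
  subst m; rewrite mul1r in Qr' rb *; move: step; apply: evS => n h.
  have := Qcmp (_ : r < r + dl) Qr Qr'; lra.
have rdb : a <= r + dl < b.
  rewrite eS in rb; have : 0 < m%:R * dl by rewrite mulr_gt0 // ltr0n.
  lra.
have [phi1 [g1 [Q1 S1]]] := Qstep rdb.
rewrite eS in rb Qr' *.
have ar1 : a <= r + dl by lra.
have := evI step (IH _ _ _ ar1 rb Q1 S1 Qr' m0); apply: evS => n [h1 h2].
have := Qcmp (_ : r < r + dl) Qr Q1; rewrite -natr1.
move=> /(_ ltac:(lra)); lra.
Qed.

(** [Q] determines the value but perhaps not the slope, since several maximisers may coexist; hence
    a relation with [Qfun] for the value only. *)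
Lemma telescope phia ga phib gb (eta : R) : a < b -> Q a phia ga -> Q b phib gb -> 0 < eta ->
  ev (fun n => phib - phia - eta <= f n b - f n a).
Proof.
move=> ab Qa Qb eta0.
have aab : a <= a < b by lra.
have [phi [g [Q1 S1]]] := Qstep aab.
have C0 : 0 <= C by apply: le_trans (Qbound Qa).
have ba : 0 < b - a by lra.
(* The mesh [(b - a) / m] makes the leftover [dl * (2 * C)] at most [eta / 2]; the step errors [e]
   add up to the other half. *)
pose m := (Num.truncn (4 * C * (b - a) / eta)).+1.
have mlt : 4 * C * (b - a) / eta < m%:R by rewrite /m truncnS_gt.
have m0 : 0 < m%:R :> R by rewrite ltr0n.
pose dl := (b - a) / m%:R; pose e := eta / 2 / (b - a).
have dl0 : 0 < dl by rewrite divr_gt0.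
have e0 : 0 < e by rewrite !divr_gt0.
have mdl : m%:R * dl = b - a by rewrite mulrC divfK // gt_eqF.
have eb : a + m%:R * dl = b by rewrite mdl; lra.
have Qb' : Q (a + m%:R * dl) phib gb by rewrite eb.
have leb : a + m%:R * dl <= b by rewrite eb.
have := telescope_steps dl0 e0 (lexx a) leb Q1 S1 Qb' (ltn0Sn _); apply: evS => n.
rewrite eb (Qfun Q1 Qa); apply: le_trans.
have h1 : m%:R * (dl * e) = eta / 2 by rewrite mulrA mdl /e mulrC divfK // gt_eqF.
have h2 : dl * (2 * C) <= eta / 2.
  rewrite /dl mulrAC ler_pdivrMr //; rewrite ltr_pdivrMr // in mlt; lra.
have h3 : gb - g <= 2 * C.
  have := Qbound Q1; have := Qbound Qb; rewrite !ler_norml; lra.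
have := ler_wpM2l (ltW dl0) h3; lra.
Qed.

End Telescope.

(** * Comparison of increments and the limit of the free energy *)

Definition bpmax (R : realType) (p s q : R) D (M : R) :=
  0 < M /\ forall y : R, 0 < y -> bpE p s q D y <= bpE p s q D M.

Lemma bpg_continuous (R : realType) (p q : R) D (y : R) : 0 < y ->
  {for y, continuous (bpg p q D)}%classic.
Proof.
move=> y0; apply: continuousM.
  apply: continuousD; apply: continuousM; try exact: cst_continuous.
    exact: cvg_id.
  exact: exprn_continuous.
apply: continuousV; first by rewrite gt_eqF // addr_gt0 // exprn_gt0.
by apply: continuousD; [exact: cst_continuous | exact: exprn_continuous].
Qed.

Lemma min_bpg_ev (R : realType) (p q : R) D (l h : nat -> R) (L H c e : R) :
  0 < L -> 0 < H -> (l @ \oo --> L)%classic -> (h @ \oo --> H)%classic ->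
  c <= bpg p q D L -> c <= bpg p q D H -> 0 < e ->
  exists k, c - e <= Num.min (bpg p q D (l k)) (bpg p q D (h k)).
Proof.
move=> L0 H0 lL hH cL cH e0.
have c1 : ((bpg p q D \o l) @ \oo --> bpg p q D L)%classic.
  by apply: continuous_cvg => //; exact: bpg_continuous.
have c2 : ((bpg p q D \o h) @ \oo --> bpg p q D H)%classic.
  by apply: continuous_cvg => //; exact: bpg_continuous.
have [N hN] := evI (cvg_ev c1 e0) (cvg_ev c2 e0).
exists N; have [a1 a2] := hN N (leqnn N); rewrite le_min /=.
move: a1 a2; rewrite /= !ltr_norml => a1 a2; apply/andP; split; lra.
Qed.

Lemma bpslope_range (R : realType) (p s q : R) D (y : R) : 0 <= p -> 0 < s -> 0 <= q -> 0 < y ->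
  0 <= bpslope p s q D y <= (D.+1)%:R / 2.
Proof.
move=> p0 s0 q0 y0; have U0 := bpU_gt0 D p0 s0 y0; have V0 := bpV_gt0 D s0 q0 y0.
have z0 : 0 < y ^+ D by rewrite exprn_gt0.
have N0 : 0 < (p + s * y ^+ D) ^+ D.+1 + (s + q * y ^+ D) ^+ D.+1.
  by rewrite addr_gt0 // exprn_gt0.
have d0 : 0 <= (D.+1)%:R / 2 :> R by rewrite divr_ge0.
have UD : 0 <= (p + s * y ^+ D) ^+ D by rewrite exprn_ge0 // ltW.
have VD : 0 <= (s + q * y ^+ D) ^+ D by rewrite exprn_ge0 // ltW.
rewrite /bpslope; apply/andP; split.
  by rewrite mulr_ge0 // divr_ge0 ?(ltW N0) // mulr_ge0 ?(ltW s0) // addr_ge0 // mulr_ge0 // ltW.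
rewrite -[leRHS]mulr1 ler_wpM2l // ler_pdivrMr // mul1r !exprS.
move: (y ^+ D) z0 UD VD {U0 V0 N0} => z z0.
move: ((p + s * z) ^+ D) ((s + q * z) ^+ D) => A B A0 B0.
have h1 := mulr_ge0 p0 A0; have h2 := mulr_ge0 (mulr_ge0 q0 (ltW z0)) B0; lra.
Qed.

Lemma bpE_product_max (R : realType) (a b : R) D (y : R) : 0 < a -> 0 < b -> 0 < y ->
  bpE (a ^+ 2) (a * b) (b ^+ 2) D y <= (a ^+ D.+1 + b ^+ D.+1) ^+ 2.
Proof.
move=> a0 b0 y0.
have d0 : 0 < 1 + y ^+ D.+1 by rewrite addr_gt0 // exprn_gt0.
rewrite /bpE ler_pdivrMr ?exprn_gt0 //.
have -> : a ^+ 2 + a * b * y ^+ D = a * (a + b * y ^+ D) by ring.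
have -> : a * b + b ^+ 2 * y ^+ D = b * (a + b * y ^+ D) by ring.
rewrite !exprMn -mulrDl expr2 -mulrA ler_pM2l; last by rewrite addr_gt0 // exprn_gt0.
by apply: holder_pow => //; exact: ltW.
Qed.

Section CoreLimit.
Variables (R : realType) (P : forall n, graph n -> R) (D : nat).
Hypothesis HP : forall n, graph_law (@P n).
Hypothesis us : uniformly_sparse P.
Hypothesis lc : converges_locally_to_Td P D.+1.
Hypothesis D1 : (1 < D)%N.
Local Notation d := (D.+1).
Local Notation EE := (EE P).

Definition fe (p s q : R) (n : nat) : R := EE (fun G : graph n => ln (Zed p s q G)).

Let D0 : (0 < D)%N := ltnW D1.

Lemma fe_tangent (p s q t : R) n : 0 <= p -> 0 < s -> 0 <= q -> 0 < p \/ 0 < q ->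
  fe p s q n + t * EE (fun G : graph n => mdisagree p s q G) <= fe p (s * expR t) q n.
Proof.
move=> p0 s0 q0 pq; rewrite -EEZ -EED; apply: EE_le => // G _.
exact: lnZ_convex.
Qed.

Lemma ferro_step (p s q : R) : 0 < s -> 0 < q -> q <= p -> s ^+ 2 < p * q ->
  exists M, bpmax p s q D M /\ forall dl e : R, 0 < dl -> 0 < e ->
    ev (fun n => dl * (bpslope p s q D M - e) <= fe p (s * expR dl) q n - fe p s q n).
Proof.
move=> s0 q0 qp sk; have p0 : 0 < p by lra.
have k0 : 0 < p * q - s ^+ 2 by rewrite subr_gt0.
have [l [h [L [H [[l0 h0] [lS hS] [lh LH] [lL hH] [FL FH Lmin Hmax]]]]]] :=
  ferro_box D p0 s0 q0 (ltW sk).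
have /andP[L0 LH'] := LH.
have H0 : 0 < H by lra.
have [_ Lmaxi] := ferro_max D1 s0 q0 qp (ltW sk) L0 FL Lmin.
have gLH := bpg_ferro s0 q0 qp (ltW sk) L0 LH' FL FH Lmin.
exists L; split; first by split.
move=> dl e dl0 e0.
pose A : R := (D.+1)%:R / 2; have A0 : 0 < A by rewrite divr_gt0 // ltr0n.
have As0 : 0 < A * s by rewrite mulr_gt0.
have eps0 : 0 < e / 2 * (p * q - s ^+ 2) / (A * s) by rewrite divr_gt0 // mulr_gt0 //; lra.
have [k ck] := min_bpg_ev L0 H0 lL hH (lexx _) gLH eps0.
set c := Num.min _ _ in ck.
(* The disagreement per edge guaranteed at a vertex with a tree-like ball. The radius is fixed by
   [e] before the tolerated fraction [b1] of bad vertices, which depends on [O]. *)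
pose O := s * (c - s) / (p * q - s ^+ 2).
have slopeO : bpslope p s q D L - e / 2 <= A * O.
  have sl := bpslope_fix (ltW p0) s0 (ltW q0) L0 L0 FL.
  rewrite -(ler_pM2l k0) mulrBr sl -/A.
  have -> : (p * q - s ^+ 2) * (A * O) = A * (s * (c - s)).
    by rewrite /O mulrCA [_ * (s * (c - s) / _)]mulrC divfK // gt_eqF.
  have eA : A * s * (e / 2 * (p * q - s ^+ 2) / (A * s)) = e / 2 * (p * q - s ^+ 2).
    by rewrite mulrC divfK // gt_eqF.
  have := ler_wpM2l (ltW As0) ck; rewrite mulrBr eA; lra.
pose b1 := e / 2 / (A * `|O| + 1).
have AO0 : 0 < A * `|O| + 1 by rewrite ltr_wpDl // mulr_ge0 // ltW.
have b10 : 0 < b1 by rewrite !divr_gt0 //.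
have := evI ev_gt0 (EE_bad_tree HP lc k.+1 b10); apply: evS => n [n0 bad].
have tan := fe_tangent dl n (ltW p0) s0 (ltW q0) (or_introl p0).
have md : A * O - A * `|O| * EE (fun G : graph n => (nbad (ball_iso_tree G d k.+1))%:R) <=
    EE (fun G : graph n => mdisagree p s q G).
  rewrite -{1}(EEn HP (A * O) n0) -mulNr -EEZ -EED; apply: EE_le => // G Gs.
  rewrite mulNr; apply: mdisagree_ge => //; [exact: ltW | exact: ltW | by left|].
  move=> v good.
  have st := star_ferro D0 (ltW p0) s0 (ltW q0) Gs good (ltW sk) p0 l0 h0 lS hS lh.
  have Z0 := Zed_gt0 G (ltW p0) (ltW s0) (ltW q0) (or_introl p0).
  rewrite ler_pdivlMr // -(ler_pM2l k0); apply: le_trans st.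
  by rewrite /O -/c le_eqVlt; apply/orP; left; apply/eqP; field; rewrite gt_eqF.
have h1 := ler_wpM2l (mulr_ge0 (ltW A0) (normr_ge0 O)) bad.
have h2 : A * `|O| * b1 <= e / 2.
  rewrite /b1 mulrCA ler_piMr //; first lra.
  by rewrite ler_pdivrMr // mul1r; lra.
have : dl * (bpslope p s q D L - e) <= dl * EE (fun G : graph n => mdisagree p s q G).
  by rewrite ler_pM2l //; lra.
lra.
Qed.

(** Dividing by the negative determinant turns the star inequality into an upper bound on the
    disagreement, which bounds [ln Z] from below when [s] decreases. *)
Lemma anti_step (p s q : R) : 0 <= p -> 0 < s -> 0 < q -> p * q < s ^+ 2 ->
  exists M, bpmax p s q D M /\ forall dl e : R, 0 < dl -> 0 < e ->
    ev (fun n => dl * (- bpslope p s q D M - e) <= fe p (s * expR (- dl)) q n - fe p s q n).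
Proof.
move=> p0 s0 q0 sk.
have k0 : 0 < s ^+ 2 - p * q by rewrite subr_gt0.
have [l [h [L [H [[l0 h0] [lS hS] [lh LH] [lL hH] [FL FH Lmin Hmax]]]]]] :=
  anti_box D p0 s0 q0 sk.
have /andP[L0 LH'] := LH.
have H0 : 0 < H by lra.
have [_ Hmaxi] := anti_max D1 p0 s0 q0 sk L0 LH' FL FH Lmin Hmax.
have gLH := bpg_anti p0 s0 (ltW q0) L0 H0 FL FH.
exists H; split; first by split.
move=> dl e dl0 e0.
pose A : R := (D.+1)%:R / 2; have A0 : 0 < A by rewrite divr_gt0 // ltr0n.
have As0 : 0 < A * s by rewrite mulr_gt0.
have eps0 : 0 < e / 2 * (s ^+ 2 - p * q) / (A * s) by rewrite divr_gt0 // mulr_gt0 //; lra.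
have gLH' : bpg p q D L <= bpg p q D H by rewrite gLH.
have [k ck] := min_bpg_ev L0 H0 lL hH (lexx _) gLH' eps0.
set c := Num.min _ _ in ck.
pose O := s * (c - s) / (p * q - s ^+ 2).
have kn : p * q - s ^+ 2 != 0 by rewrite lt_eqF // subr_lt0.
have kO : (p * q - s ^+ 2) * (A * O) = A * (s * (c - s)).
  by rewrite /O mulrCA [_ * (s * (c - s) / _)]mulrC divfK.
have slopeO : A * O <= bpslope p s q D H + e / 2.
  have sl := bpslope_fix p0 s0 (ltW q0) H0 L0 FH.
  rewrite -(ler_pM2l k0).
  have eA : A * s * (e / 2 * (s ^+ 2 - p * q) / (A * s)) = e / 2 * (s ^+ 2 - p * q).
    by rewrite mulrC divfK // gt_eqF.
  have := ler_wpM2l (ltW As0) ck; rewrite mulrBr eA.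
  rewrite -/A in sl; lra.
pose C1 := A * (1 + `|O|) + 1.
have C10 : 0 < C1.
  rewrite /C1 ltr_wpDl // mulr_ge0 ?(ltW A0) // addr_ge0 //.
pose b1 := e / 4 / C1.
have b10 : 0 < b1 by rewrite !divr_gt0.
have e4 : 0 < e / 4 by lra.
have := evI ev_gt0 (evI (EE_bad_tree HP lc k.+2 b10) (EE_degdev HP us lc e4)).
apply: evS => n [n0 [bad dev]].
have tan := fe_tangent (- dl) n p0 s0 (ltW q0) (or_intror q0).
have md : EE (fun G : graph n => mdisagree p s q G) <= A * O +
    A * (1 + `|O|) * EE (fun G : graph n => (nbad (ball_iso_tree G d k.+2))%:R) +
    EE (fun G : graph n => degdev R d G).
  rewrite -{1}(EEn HP (A * O) n0) -EEZ -!EED; apply: EE_le => // G Gs.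
  apply: mdisagree_le => //; [exact: ltW | by right|].
  move=> v good.
  have st := star_anti D0 p0 s0 (ltW q0) Gs good sk l0 h0 lS hS lh.
  have Z0 := Zed_gt0 G p0 (ltW s0) (ltW q0) (or_intror q0).
  have eO : (p * q - s ^+ 2) * (d%:R * O * Zed p s q G) = d%:R * (s * (c - s)) * Zed p s q G.
    by rewrite /O; field.
  rewrite -/c -eO in st; rewrite ler_pdivrMr // -(ler_pM2l k0); move: st.
  by set S := \sum_(x : {ffun _}) _; lra.
have h1 : A * (1 + `|O|) * EE (fun G : graph n => (nbad (ball_iso_tree G d k.+2))%:R) <= e / 4.
  have AO : 0 <= A * (1 + `|O|) by rewrite mulr_ge0 ?(ltW A0) // addr_ge0.
  apply: le_trans (ler_wpM2l AO bad) _.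
  rewrite /b1 mulrCA ler_piMr //; first lra.
  by rewrite ler_pdivrMr // mul1r /C1; lra.
have : dl * EE (fun G : graph n => mdisagree p s q G) <= dl * (bpslope p s q D H + e).
  by rewrite ler_pM2l //; lra.
lra.
Qed.

Lemma lnE_eq (p s q M M' : R) : bpmax p s q D M -> bpmax p s q D M' ->
  bpE p s q D M = bpE p s q D M'.
Proof. by move=> [M0 h] [M0' h']; apply: le_anti; rewrite h' // h. Qed.

Lemma lnE_le (p s q M y : R) : 0 <= p -> 0 < s -> 0 <= q -> bpmax p s q D M -> 0 < y ->
  ln (bpE p s q D y) <= ln (bpE p s q D M).
Proof.
move=> p0 s0 q0 [M0 h] y0; rewrite ler_ln ?posrE; [exact: h | exact: bpE_gt0 | exact: bpE_gt0].
Qed.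

Lemma bp_tangent (p s q t M M' : R) : 0 <= p -> 0 < s -> 0 <= q ->
  bpmax p s q D M -> bpmax p (s * expR t) q D M' ->
  ln (bpE p s q D M) / 2 + t * bpslope p s q D M <= ln (bpE p (s * expR t) q D M') / 2.
Proof.
move=> p0 s0 q0 mM mM'; have s1 : 0 < s * expR t by rewrite mulr_gt0 // expR_gt0.
apply: le_trans (bpE_convex D t p0 s0 q0 mM.1) _.
have := lnE_le p0 s1 q0 mM' mM.1; lra.
Qed.

Lemma fe_product_ub (p q M e : R) : 0 < p -> 0 < q -> 0 < e ->
  bpmax p (Num.sqrt p * Num.sqrt q) q D M ->
  ev (fun n => fe p (Num.sqrt p * Num.sqrt q) q n <=
     ln (bpE p (Num.sqrt p * Num.sqrt q) q D M) / 2 + e).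
Proof.
move=> p0 q0 e0 mM; set a := Num.sqrt p in mM *; set b := Num.sqrt q in mM *.
have a0 : 0 < a by rewrite sqrtr_gt0.
have b0 : 0 < b by rewrite sqrtr_gt0.
have pa : p = a ^+ 2 by rewrite sqr_sqrtr // ltW.
have qb : q = b ^+ 2 by rewrite sqr_sqrtr // ltW.
clearbody a b; subst p q.
set C := `|ln a| + `|ln b| + 1.
have C0 : 0 < C by rewrite ltr_wpDl // addr_ge0.
have eC : 0 < e / C by rewrite divr_gt0.
have T0 : 0 < a ^+ d + b ^+ d by rewrite addr_gt0 // exprn_gt0.
have hM : ln (a ^+ d + b ^+ d) <= ln (bpE (a ^+ 2) (a * b) (b ^+ 2) D M) / 2.
  have ba0 : 0 < b / a by rewrite divr_gt0.
  have := lnE_le (ltW p0) (mulr_gt0 a0 b0) (ltW q0) mM ba0.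
  by rewrite bpE_product // lnXn // -mulr_natl; lra.
have := evI ev_gt0 (EE_degdev HP us lc eC); apply: evS => n [n0 dev].
have : fe (a ^+ 2) (a * b) (b ^+ 2) n <= ln (a ^+ d + b ^+ d) +
   (`|ln a| + `|ln b|) * EE (fun G : graph n => degdev R d G).
  rewrite -{1}(EEn HP (ln (a ^+ d + b ^+ d)) n0) -EEZ -EED; apply: EE_le => // G Gs.
  exact: lnZ_product.
have dv0 : 0 <= EE (fun G : graph n => degdev R d G).
  by apply: EE_ge0 => // G; apply: degdev_ge0.
have := ler_wpM2l (ltW C0) dev; rewrite [C * (e / C)]mulrC divfK ?gt_eqF // /C; lra.
Qed.

Lemma bpmax_product (p q : R) : 0 < p -> 0 < q ->
  exists M, bpmax p (Num.sqrt p * Num.sqrt q) q D M.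
Proof.
move=> p0 q0; set a := Num.sqrt p; set b := Num.sqrt q.
have a0 : 0 < a by rewrite sqrtr_gt0.
have b0 : 0 < b by rewrite sqrtr_gt0.
have pa : p = a ^+ 2 by rewrite sqr_sqrtr // ltW.
have qb : q = b ^+ 2 by rewrite sqr_sqrtr // ltW.
clearbody a b; subst p q; exists (b / a); split; first by rewrite divr_gt0.
by move=> y y0; rewrite bpE_product // bpE_product_max.
Qed.

(* [phi] and [g] are the maximal Bethe value and its slope at [s = expR r]. *)
Definition ferro_branch (p q r phi g : R) := exists M, [/\ bpmax p (expR r) q D M,
  phi = ln (bpE p (expR r) q D M) / 2 & g = bpslope p (expR r) q D M].

(** The right end may be the product point, where the strict inequality of [ferro_step] fails; steps
    start only to its left. *)
Lemma fe_ferro_increment (p q a b phia ga phib gb eta : R) : 0 < q -> q <= p ->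
  expR b ^+ 2 <= p * q -> a < b -> ferro_branch p q a phia ga -> ferro_branch p q b phib gb -> 0 < eta ->
  ev (fun n => phib - phia - eta <= fe p (expR b) q n - fe p (expR a) q n).
Proof.
move=> q0 qp bpq ab qa qb eta0; have p0 : 0 < p by lra.
apply: (@telescope R (fun n r => fe p (expR r) q n) (ferro_branch p q) a b ((D.+1)%:R / 2)) qa qb eta0 => //.
- by move=> r phi g phi' g' [M [mM -> _]] [M' [mM' -> _]]; rewrite (lnE_eq mM mM').
- move=> r phi g [M [mM _ ->]].
  have /andP[h1 h2] := bpslope_range D (ltW p0) (expR_gt0 r) (ltW q0) mM.1.
  by rewrite ger0_norm.
- move=> r r' phi g phi' g' rr [M [mM -> _]] [M' [mM' -> ->]].
  have eM : expR r = expR r' * expR (r - r') by rewrite -expRD; congr expR; ring.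
  rewrite eM in mM *.
  have := bp_tangent (ltW p0) (expR_gt0 r') (ltW q0) mM' mM; lra.
- move=> r rab; have r2 : expR r ^+ 2 < p * q.
    apply: lt_le_trans bpq; rewrite ltrXn ?expR_ge0 // ltr_expR; lra.
  have [M [mM st]] := ferro_step (expR_gt0 r) q0 qp r2.
  exists (ln (bpE p (expR r) q D M) / 2), (bpslope p (expR r) q D M).
  split; first by exists M.
  by move=> dl e dl0 e0; rewrite expRD; exact: st.
Qed.

(** The parameter is [- ln s], so that increasing [r] again moves towards the product point. *)
Definition anti_branch (p q r phi g : R) := exists M, [/\ bpmax p (expR (- r)) q D M,
  phi = ln (bpE p (expR (- r)) q D M) / 2 & g = - bpslope p (expR (- r)) q D M].

Lemma fe_anti_increment (p q a b phia ga phib gb eta : R) : 0 <= p -> 0 < q ->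
  p * q <= expR (- b) ^+ 2 -> a < b -> anti_branch p q a phia ga -> anti_branch p q b phib gb -> 0 < eta ->
  ev (fun n => phib - phia - eta <= fe p (expR (- b)) q n - fe p (expR (- a)) q n).
Proof.
move=> p0 q0 bpq ab Qaa Qb eta0.
apply: (@telescope R (fun n r => fe p (expR (- r)) q n) (anti_branch p q) a b ((D.+1)%:R / 2)) Qaa Qb eta0 => //.
- by move=> r phi g phi' g' [M [mM -> _]] [M' [mM' -> _]]; rewrite (lnE_eq mM mM').
- move=> r phi g [M [mM _ ->]].
  have /andP[h1 h2] := bpslope_range D p0 (expR_gt0 (- r)) (ltW q0) mM.1.
  by rewrite normrN ger0_norm.
- move=> r r' phi g phi' g' rr [M [mM -> _]] [M' [mM' -> ->]].
  have eM : expR (- r) = expR (- r') * expR (r' - r) by rewrite -expRD; congr expR; ring.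
  rewrite eM in mM *.
  have := bp_tangent p0 (expR_gt0 (- r')) (ltW q0) mM' mM; lra.
- move=> r rab; have r2 : p * q < expR (- r) ^+ 2.
    apply: le_lt_trans bpq _; rewrite ltrXn ?expR_ge0 // ltr_expR; lra.
  have [M [mM st]] := anti_step p0 (expR_gt0 (- r)) q0 r2.
  exists (ln (bpE p (expR (- r)) q D M) / 2), (- bpslope p (expR (- r)) q D M).
  split; first by exists M.
  by move=> dl e dl0 e0; rewrite opprD expRD; exact: st.
Qed.

Lemma sqrt_prod_sq (p q : R) : 0 <= p -> 0 <= q -> (Num.sqrt p * Num.sqrt q) ^+ 2 = p * q.
Proof. by move=> p0 q0; rewrite exprMn !sqr_sqrtr. Qed.

Lemma ln_add_le (x y : R) : 0 < x -> 0 <= y -> ln (x + y) <= ln x + y / x.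
Proof.
move=> x0 y0; have -> : x + y = x * (1 + y / x) by field; rewrite gt_eqF.
have yx : 0 <= y / x by rewrite divr_ge0 // ltW.
rewrite lnM ?posrE //; last by lra.
by rewrite lerD2l le_ln1Dx //; lra.
Qed.

Lemma lnE_ub (p s q m y : R) : 0 <= p -> 0 < s -> 0 <= q -> p <= m -> q <= m -> 0 < y ->
  ln (bpE p s q D y) / 2 <= (D.+1)%:R / 2 * ln (s + m).
Proof.
move=> p0 s0 q0 pm qm y0; have := bpE_ub D0 p0 s0 q0 pm qm y0.
have sm : 0 < s + m by lra.
rewrite -ler_ln ?posrE ?exprn_gt0 ?bpE_gt0 // lnXn // -mulr_natl; lra.
Qed.

Lemma fe_ferro_lim_le (p s q M e : R) : 0 < s -> 0 < q -> q <= p -> s ^+ 2 <= p * q ->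
  bpmax p s q D M -> 0 < e -> ev (fun n => `|fe p s q n - ln (bpE p s q D M) / 2| <= e).
Proof.
move=> s0 q0 qp spq mM e0; have p0 : 0 < p by lra.
have esr : s = expR (ln s) by rewrite lnK ?posrE.
have QM : ferro_branch p q (ln s) (ln (bpE p s q D M) / 2) (bpslope p s q D M).
  by exists M; rewrite -esr.
have up : ev (fun n => fe p s q n <= ln (bpE p s q D M) / 2 + e).
  set t := Num.sqrt p * Num.sqrt q.
  have t2 : t ^+ 2 = p * q by rewrite sqrt_prod_sq // ltW.
  have t0 : 0 < t by rewrite mulr_gt0 // sqrtr_gt0.
  have st : s <= t.
    by move: spq; rewrite -t2 ler_pXn2r // nnegrE ltW.
  move: st; rewrite le_eqVlt => /orP[/eqP st|st].
    by rewrite st in mM *; apply: fe_product_ub.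
  have [M' mM'] := bpmax_product p0 q0; rewrite -/t in mM'.
  have etr : t = expR (ln t) by rewrite lnK ?posrE.
  have QM' : ferro_branch p q (ln t) (ln (bpE p t q D M') / 2) (bpslope p t q D M').
    by exists M'; rewrite -etr.
  have e2 : 0 < e / 2 by lra.
  have lst : ln s < ln t by rewrite ltr_ln ?posrE.
  have b2 : expR (ln t) ^+ 2 <= p * q by rewrite -etr t2.
  have := evI (fe_ferro_increment q0 qp b2 lst QM QM' e2) (fe_product_ub p0 q0 e2 mM').
  rewrite -esr -etr -/t; apply: evS => n [h1 h2]; lra.
have low : ev (fun n => ln (bpE p s q D M) / 2 - e <= fe p s q n).
  (* The far end of the path: below [s], and so small that replacing [ln (x + p)] by [ln p] costs at
     most [e / 4]. *)
  pose x := Num.min (s / 2) (p * e / (2 * (D.+1)%:R)).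
  have d0 : 0 < (D.+1)%:R :> R by rewrite ltr0n.
  have x0 : 0 < x by rewrite lt_min !divr_gt0 ?mulr_gt0.
  have xs : x < s by apply: le_lt_trans (_ : s / 2 < _); [rewrite ge_min lexx | lra].
  have xp : (D.+1)%:R / 2 * (x / p) <= e / 4.
    rewrite mulrA ler_pdivrMr //.
    have : x <= p * e / (2 * (D.+1)%:R) by rewrite ge_min lexx orbT.
    rewrite ler_pdivlMr ?mulr_gt0 //; lra.
  have exr : x = expR (ln x) by rewrite lnK ?posrE.
  have x2 : x ^+ 2 < p * q by apply: lt_le_trans spq; rewrite ltrXn // ltW.
  have [Mx [mMx _]] := ferro_step x0 q0 qp x2.
  have QMx : ferro_branch p q (ln x) (ln (bpE p x q D Mx) / 2) (bpslope p x q D Mx).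
    by exists Mx; rewrite -exr.
  have e4 : 0 < e / 4 by lra.
  have lxs : ln x < ln s by rewrite ltr_ln ?posrE.
  have b2 : expR (ln s) ^+ 2 <= p * q by rewrite -esr.
  set C := `|ln p| + 1; have C0 : 0 < C by rewrite ltr_wpDl.
  have eC : 0 < e / 4 / C by rewrite divr_gt0.
  have := evI ev_gt0 (evI (fe_ferro_increment q0 qp b2 lxs QMx QM e4) (EE_degdev HP us lc eC)).
  rewrite -esr -exr; apply: evS => n [n0 [h1 h2]].
  have h3 := lnE_ub (ltW p0) x0 (ltW q0) (lexx p) qp mMx.1.
  have h4 : (D.+1)%:R / 2 * ln (x + p) <= (D.+1)%:R / 2 * (ln p + x / p).
    by rewrite ler_wpM2l ?divr_ge0 // addrC ln_add_le // ltW.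
  have h5 : (D.+1)%:R / 2 * ln p - `|ln p| * EE (fun G : graph n => degdev R d G) <= fe p x q n.
    rewrite -{1}(EEn HP ((D.+1)%:R / 2 * ln p) n0) -mulNr -EEZ -EED; apply: EE_le => // G Gs.
    by rewrite mulNr; apply: lnZ_plus => //; exact: ltW.
  have dv0 : 0 <= EE (fun G : graph n => degdev R d G).
    by apply: EE_ge0 => // G; apply: degdev_ge0.
  have := ler_wpM2l (ltW C0) h2; rewrite [C * (e / 4 / C)]mulrC divfK ?gt_eqF // /C; lra.
have := evI up low; apply: evS => n [h1 h2]; rewrite ler_norml; apply/andP; split; lra.
Qed.

Lemma fe_anti_ub_pos (p s q M e : R) : 0 < p -> 0 < s -> 0 < q -> p * q < s ^+ 2 ->
  bpmax p s q D M -> 0 < e -> ev (fun n => fe p s q n <= ln (bpE p s q D M) / 2 + e).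
Proof.
move=> p0 s0 q0 spq mM e0.
set t := Num.sqrt p * Num.sqrt q.
have t2 : t ^+ 2 = p * q by rewrite sqrt_prod_sq // ltW.
have t0 : 0 < t by rewrite mulr_gt0 // sqrtr_gt0.
have ts : t < s.
  by rewrite ltNge; apply/negP => st; have := lerXn 2 (ltW s0) st; rewrite t2; lra.
have esr : s = expR (- (- ln s)) by rewrite opprK lnK ?posrE.
have etr : t = expR (- (- ln t)) by rewrite opprK lnK ?posrE.
have QM : anti_branch p q (- ln s) (ln (bpE p s q D M) / 2) (- bpslope p s q D M).
  by exists M; rewrite -esr.
have [M' mM'] := bpmax_product p0 q0; rewrite -/t in mM'.
have QM' : anti_branch p q (- ln t) (ln (bpE p t q D M') / 2) (- bpslope p t q D M').
  by exists M'; rewrite -etr.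
have e2 : 0 < e / 2 by lra.
have lst : - ln s < - ln t by rewrite ltrN2 ltr_ln ?posrE.
have b2 : p * q <= expR (- - ln t) ^+ 2 by rewrite -etr t2.
have := evI (fe_anti_increment (ltW p0) q0 b2 lst QM QM' e2) (fe_product_ub p0 q0 e2 mM').
rewrite -esr -etr -/t; apply: evS => n [h1 h2]; lra.
Qed.

Lemma fe_anti_lim_le (p s q M e : R) : nearly_bipartite P D.+1 ->
  0 <= p -> 0 < s -> 0 < q -> p <= q -> p * q < s ^+ 2 ->
  bpmax p s q D M -> 0 < e -> ev (fun n => `|fe p s q n - ln (bpE p s q D M) / 2| <= e).
Proof.
move=> [tau nb] p0 s0 q0 pq spq mM e0.
have esr : s = expR (- (- ln s)) by rewrite opprK lnK ?posrE.
have QM : anti_branch p q (- ln s) (ln (bpE p s q D M) / 2) (- bpslope p s q D M).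
  by exists M; rewrite -esr.
have d0 : 0 < (D.+1)%:R :> R by rewrite ltr0n.
have up : ev (fun n => fe p s q n <= ln (bpE p s q D M) / 2 + e).
  have := p0; rewrite le_eqVlt => /orP[/eqP pe|p0']; last exact: fe_anti_ub_pos.
  subst p.
  (* For [p = 0] the product point would be [s = 0], so [p] is raised to a small [x]. The first
     bound keeps the change of the Bethe value within [e / 2], the second keeps the system
     anti-ferromagnetic. *)
  pose x := Num.min (s * e / (D.+1)%:R) (s ^+ 2 / (2 * q)).
  have s20 : 0 < s ^+ 2 by rewrite exprn_gt0.
  have x0 : 0 < x by rewrite lt_min !divr_gt0 ?mulr_gt0.
  have xq : x * q < s ^+ 2.
    have : x <= s ^+ 2 / (2 * q) by rewrite ge_min lexx orbT.
    rewrite ler_pdivlMr ?mulr_gt0 //; have := mulr_gt0 x0 q0; lra.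
  have [M1 [mM1 _]] := anti_step (ltW x0) s0 q0 xq.
  have e2 : 0 < e / 2 by lra.
  have := fe_anti_ub_pos x0 s0 q0 xq mM1 e2; apply: evS => n h1.
  have h2 : fe 0 s q n <= fe x s q n.
    apply: EE_le => // G _; rewrite ler_ln ?posrE; last 2 first.
    - exact: (Zed_gt0 G (lexx 0) (ltW s0) (ltW q0) (or_intror q0)).
    - exact: (Zed_gt0 G (ltW x0) (ltW s0) (ltW q0) (or_intror q0)).
    by apply: Zed_mono => //; exact: ltW.
  have h3 := bpE_perturb D (lexx 0) s0 (ltW q0) (ltW x0) mM1.1.
  rewrite add0r in h3.
  have xs0 : 0 <= x / s by rewrite divr_ge0 // ltW.
  have x1 : 0 < 1 + x / s by lra.
  have h4 : ln (bpE x s q D M1) <= (D.+1)%:R * ln (1 + x / s) + ln (bpE 0 s q D M1).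
    have E0 : 0 < bpE 0 s q D M1 by apply: bpE_gt0 => //; exact: mM1.1.
    have E1 : 0 < bpE x s q D M1 by apply: bpE_gt0 => //; [exact: ltW | exact: mM1.1].
    move: E0 E1 h3; move: (bpE 0 _ _ _ _) (bpE x _ _ _ _) => a b a0 b0.
    rewrite -ler_ln ?posrE ?mulr_gt0 ?exprn_gt0 // lnM ?posrE ?exprn_gt0 //.
    by rewrite lnXn // mulr_natl.
  have h5 := lnE_le (lexx 0) s0 (ltW q0) mM mM1.1.
  have h6 : (D.+1)%:R * ln (1 + x / s) <= e.
    have h7 : ln (1 + x / s) <= x / s by rewrite le_ln1Dx //; lra.
    apply: le_trans (ler_wpM2l (ltW d0) h7) _; rewrite mulrA ler_pdivrMr //.
    have : x <= s * e / (D.+1)%:R by rewrite ge_min lexx.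
    rewrite ler_pdivlMr //; lra.
  lra.
have low : ev (fun n => ln (bpE p s q D M) / 2 - e <= fe p s q n).
  (* The far end: beyond [s], and so large that [ln (S + q)] exceeds [ln S] by a negligible
     amount. *)
  pose S := 2 * s + 2 * (D.+1)%:R * q / e.
  have q1 : 0 < 2 * (D.+1)%:R * q / e by rewrite divr_gt0 // !mulr_gt0.
  have S0 : 0 < S by rewrite /S; lra.
  have sS : s < S by rewrite /S; lra.
  have qS : (D.+1)%:R / 2 * (q / S) <= e / 4.
    rewrite mulrA ler_pdivrMr //.
    have : 2 * (D.+1)%:R * q / e <= S by rewrite /S; lra.
    rewrite ler_pdivrMr //; lra.
  have eSr : S = expR (- (- ln S)) by rewrite opprK lnK ?posrE.
  have S2 : p * q < S ^+ 2 by apply: lt_trans spq _; rewrite ltrXn // ltW.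
  have [MS [mMS _]] := anti_step p0 S0 q0 S2.
  have QMS : anti_branch p q (- ln S) (ln (bpE p S q D MS) / 2) (- bpslope p S q D MS).
    by exists MS; rewrite -eSr.
  have e4 : 0 < e / 4 by lra.
  have lSs : - ln S < - ln s by rewrite ltrN2 ltr_ln ?posrE.
  have b2 : p * q <= expR (- - ln s) ^+ 2 by rewrite -esr ltW.
  set C := 2 * `|ln S| + `|ln q| + 1.
  have C0 : 0 < C by rewrite ltr_wpDl // addr_ge0 // mulr_ge0.
  have eC : 0 < e / 8 / C by rewrite !divr_gt0.
  have eC' : 0 < e / 8 / C / (D.+1)%:R by rewrite !divr_gt0.
  have := evI ev_gt0 (evI (fe_anti_increment p0 q0 b2 lSs QMS QM e4)
    (evI (EE_degdev HP us lc eC) (EE_bad_alt HP nb eC'))).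
  rewrite -esr -eSr; apply: evS => n [n0 [h1 [h2 h2']]].
  have h3 := lnE_ub p0 S0 (ltW q0) pq (lexx q) mMS.1.
  have h4 : (D.+1)%:R / 2 * ln (S + q) <= (D.+1)%:R / 2 * (ln S + q / S).
    by rewrite ler_wpM2l ?divr_ge0 // ln_add_le // ltW.
  set B := EE (fun G : graph n => (nbad (alt_good G (tau n G) D))%:R) in h2'.
  set V := EE (fun G : graph n => degdev R d G) in h2.
  have h5 : (D.+1)%:R / 2 * ln S - (2 * `|ln S| + `|ln q|) * ((D.+1)%:R * B + V) <= fe p S q n.
    rewrite -{1}(EEn HP ((D.+1)%:R / 2 * ln S) n0) -mulNr -!EEZ -!EED -EEZ -EED; apply: EE_le => // G Gs.
    rewrite mulNr; apply: lnZ_alternating => // v j; exact: alt_goodP.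
  have V0 : 0 <= V by apply: EE_ge0 => // G; apply: degdev_ge0.
  have B0 : 0 <= B by apply: EE_ge0 => // G.
  have h6 := ler_wpM2l (ltW C0) h2; rewrite [C * (e / 8 / C)]mulrC divfK ?gt_eqF // in h6.
  have h7 : C * ((D.+1)%:R * B) <= e / 8.
    have := ler_wpM2l (ltW d0) h2'; rewrite [_ * (_ / _ / _)]mulrC divfK ?gt_eqF // => h8.
    by have := ler_wpM2l (ltW C0) h8; rewrite [C * (e / 8 / C)]mulrC divfK ?gt_eqF.
  have DB := mulr_ge0 (ltW d0) B0; rewrite /C in h6 h7; lra.
have := evI up low; apply: evS => n [h1 h2]; rewrite ler_norml; apply/andP; split; lra.
Qed.

Lemma fe_flip (p s q : R) n : fe p s q n = fe q s p n.
Proof. by rewrite /fe; congr (_ * _); apply: eq_bigr => G _; rewrite Zed_flip. Qed.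

Lemma bpmax_flip (p s q M : R) : bpmax p s q D M -> bpmax q s p D M^-1.
Proof.
move=> [M0 h]; split; first by rewrite invr_gt0.
move=> y y0; rewrite bpE_flip // -[y]invrK bpE_flip ?invr_gt0 //.
by apply: h; rewrite invr_gt0.
Qed.

Lemma fe_ferro_lim (p s q M e : R) : 0 < p -> 0 < s -> 0 < q -> s ^+ 2 <= p * q ->
  bpmax p s q D M -> 0 < e -> ev (fun n => `|fe p s q n - ln (bpE p s q D M) / 2| <= e).
Proof.
move=> p0 s0 q0 spq mM e0; have [qp|/ltW pq] := leP q p; first exact: fe_ferro_lim_le.
have := fe_ferro_lim_le s0 p0 pq _ (bpmax_flip mM) e0; rewrite mulrC => /(_ spq).
by apply: evS => n; rewrite fe_flip bpE_flip //; exact: mM.1.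
Qed.

Lemma fe_anti_lim (p s q M e : R) : nearly_bipartite P D.+1 ->
  0 <= p -> 0 < s -> 0 <= q -> 0 < p \/ 0 < q -> p * q < s ^+ 2 ->
  bpmax p s q D M -> 0 < e -> ev (fun n => `|fe p s q n - ln (bpE p s q D M) / 2| <= e).
Proof.
move=> nb p0 s0 q0 pq0 spq mM e0; have [pq|qp] := leP p q.
  by apply: fe_anti_lim_le => //; case: pq0 => //; lra.
have p0' : 0 < p by lra.
have := fe_anti_lim_le nb q0 s0 p0' (ltW qp) _ (bpmax_flip mM) e0; rewrite mulrC => /(_ spq).
by apply: evS => n; rewrite fe_flip bpE_flip //; exact: mM.1.
Qed.

End CoreLimit.

(** * Bethe fixed points *)

Section Messages.
Variables (R : realType) (D : nat) (psi : bool -> bool -> R) (psib u : bool -> R).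
Hypotheses (u0 : forall b, 0 < u b) (psibE : forall b, psib b = u b ^+ D.+1).
Hypotheses (psiC : forall a b, psi a b = psi b a) (psi0 : forall a b, 0 <= psi a b).
Hypothesis s0 : 0 < psi true false.

Definition weight_pp := psi true true * u true * u true.
Definition weight_pm := psi true false * u true * u false.
Definition weight_mm := psi false false * u false * u false.

Local Notation F := (bpF weight_pp weight_pm weight_mm D).
Local Notation E := (bpE weight_pp weight_pm weight_mm D).

(** Of the [D.+1] factors [u b] in [psib b], [D] are absorbed in the incoming ratios [y]; the last
    one stays for the outgoing edge. *)
Definition msgdist (y : R) (b : bool) : R :=
  (if b then u true else u false * y ^+ D) / (u true + u false * y ^+ D).

Definition msgratio (h : bool -> R) : R :=
  (u false * msg psi h false) / (u true * msg psi h true).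

Lemma weight_pp_ge0 : 0 <= weight_pp. Proof. by rewrite !mulr_ge0 // ltW. Qed.
Lemma weight_pm_gt0 : 0 < weight_pm. Proof. by rewrite !mulr_gt0. Qed.
Lemma weight_mm_ge0 : 0 <= weight_mm. Proof. by rewrite !mulr_ge0 // ltW. Qed.

Lemma msgdist_den_gt0 (y : R) : 0 < y -> 0 < u true + u false * y ^+ D.
Proof. by move=> y0; rewrite addr_gt0 // mulr_gt0 // exprn_gt0. Qed.

Lemma msgdist_gt0 (y : R) b : 0 < y -> 0 < msgdist y b.
Proof.
move=> y0; rewrite divr_gt0 ?msgdist_den_gt0 //.
by case: b => //; rewrite mulr_gt0 // exprn_gt0.
Qed.

Lemma msgdist_Delta (y : R) : 0 < y -> Delta (msgdist y).
Proof.
move=> y0; split=> [b|]; first by rewrite ltW // msgdist_gt0.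
by rewrite /msgdist -mulrDl divff // gt_eqF // msgdist_den_gt0.
Qed.

Lemma msgdist_anti (y v : R) : 0 < y -> y <= v -> msgdist v true <= msgdist y true.
Proof.
move=> y0 yv; have v0 : 0 < v by apply: lt_le_trans yv.
rewrite /msgdist ler_pM2l // lef_pV2 ?posrE ?msgdist_den_gt0 //.
by rewrite lerD2l ler_pM2l // lerXn2r // nnegrE ltW.
Qed.

Lemma msg_true (y : R) : 0 < y ->
  u true * msg psi (msgdist y) true = (weight_pp + weight_pm * y ^+ D) / (u true + u false * y ^+ D).
Proof.
move=> y0; rewrite /msg /msgdist /weight_pp /weight_pm; field.
by rewrite gt_eqF // msgdist_den_gt0.
Qed.

Lemma msg_false (y : R) : 0 < y ->
  u false * msg psi (msgdist y) false = (weight_pm + weight_mm * y ^+ D) / (u true + u false * y ^+ D).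
Proof.
move=> y0; rewrite /msg /msgdist /weight_mm /weight_pm (psiC false true); field.
by rewrite gt_eqF // msgdist_den_gt0.
Qed.

Lemma msgratio_msgdist (y : R) : 0 < y -> msgratio (msgdist y) = F y.
Proof.
move=> y0; rewrite /msgratio msg_true // msg_false // /bpF.
have w0 := msgdist_den_gt0 y0; have U0 := bpU_gt0 D weight_pp_ge0 weight_pm_gt0 y0.
by field; rewrite !gt_eqF.
Qed.

Lemma BP_msgdist h : (forall b, 0 < msg psi h b) ->
  BP D.+1 psi psib h = msgdist (msgratio h).
Proof.
move=> m0; have ut := u0 true; have uf := u0 false; have mt := m0 true; have mf := m0 false.
have den : u true * (u true * msg psi h true) ^+ D + u false * (u false * msg psi h false) ^+ D != 0.
  by rewrite gt_eqF // addr_gt0 // mulr_gt0 // exprn_gt0 // mulr_gt0.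
have e b : psib b * msg psi h b ^+ D = u b * (u b * msg psi h b) ^+ D.
  by rewrite psibE exprS -mulrA -exprMn.
apply/funext => b; rewrite /BP /= !e /msgdist /msgratio expr_div_n.
have n1 : (u true * msg psi h true) ^+ D != 0 by rewrite expf_neq0 // gt_eqF // mulr_gt0.
move: n1 den; set a := _ ^+ D; set c := (u false * _) ^+ D => n1 den.
have den' : u true * a + u false * c = (u true + u false * (c / a)) * a by field.
have den2 : u true + u false * (c / a) != 0.
  by apply: contra_neq den => e0; rewrite den' e0 mul0r.
rewrite den'; case: b; rewrite -/a -/c invfM; field; rewrite n1.
  by [].
by [].
Qed.

Lemma msg_gt0_off h b : Delta h -> 0 < h (~~ b) -> 0 < msg psi h b.
Proof.
move=> [h0 _] hb; have sf : 0 < psi false true by rewrite psiC.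
by case: b hb => /= hb; rewrite /msg; [apply: ltr_wpDl | apply: ltr_pwDl];
   rewrite ?mulr_gt0 ?mulr_ge0.
Qed.

Lemma msg_gt0_diag h b : Delta h -> 0 < psi b b -> 0 < h b -> 0 < msg psi h b.
Proof.
by move=> [h0 _]; case: b => pb hb; rewrite /msg; [apply: ltr_pwDl | apply: ltr_wpDl];
   rewrite ?mulr_gt0 ?mulr_ge0.
Qed.

Lemma BP_gt0 h b : Delta h -> 0 < msg psi h b -> 0 < BP D.+1 psi psib h b.
Proof.
move=> [h0 _] mb; have m0 a : 0 <= msg psi h a by rewrite addr_ge0 // mulr_ge0.
have b0 a : 0 < psib a by rewrite psibE exprn_gt0.
have t0 a : 0 <= psib a * msg psi h a ^+ D by rewrite mulr_ge0 ?exprn_ge0 // ltW.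
have tb : 0 < psib b * msg psi h b ^+ D by rewrite mulr_gt0 // exprn_gt0.
by rewrite /BP divr_gt0 //=; case: b mb tb => mb tb; [apply: ltr_pwDl | apply: ltr_wpDl].
Qed.

Lemma Delta_gt0 (h : bool -> R) : Delta h -> 0 < h true \/ 0 < h false.
Proof.
move=> [h0 h1]; have := h0 true; rewrite le_eqVlt => /orP[/eqP e|]; last by left.
by right; move: h1; rewrite -e add0r => ->.
Qed.

(** Choose [a] with [psi a a > 0]. Mass at [~~ a] reaches [a] in the other message through the
    weight [+-], and returns to [a] in the first through [psi a a]; then mass at [a] produces mass
    at [~~ a]. *)
Lemma BP_pair_gt0 hp hm : 0 < psi true true \/ 0 < psi false false ->
  BP_fixed_pair D.+1 psi psib hp hm -> forall b, 0 < hp b /\ 0 < hm b.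
Proof.
move=> nd [dp dm ep em].
have [a pa] : exists a, 0 < psi a a by case: nd => ?; [exists true | exists false].
have ha h h' : Delta h -> Delta h' -> (forall b, h b = BP D.+1 psi psib h' b) ->
    (forall b, h' b = BP D.+1 psi psib h b) -> 0 < h a.
  move=> dh dh' eh eh'.
  have [//|] : 0 < h a \/ 0 < h (~~ a) by case: (a) (Delta_gt0 dh) => -[]; tauto.
  move=> hna; rewrite eh; apply: BP_gt0 => //; apply: msg_gt0_diag => //.
  by rewrite eh'; apply: BP_gt0 => //; apply: msg_gt0_off.
have pa0 := ha hp hm dp dm ep em; have ma0 := ha hm hp dm dp em ep.
move=> b; have [->//|ba] := eqVneq b a.
have {ba} eb : ~~ b = a by case: b ba; case: (a).
by rewrite ep em; split; apply: BP_gt0 => //; apply: msg_gt0_off; rewrite ?eb.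
Qed.

Lemma BP_pair_msgdist hp hm : 0 < psi true true \/ 0 < psi false false ->
  BP_fixed_pair D.+1 psi psib hp hm ->
  exists y v : R, [/\ 0 < y, 0 < v, F y = v, F v = y & hp = msgdist y /\ hm = msgdist v].
Proof.
move=> nd fx; have pos := BP_pair_gt0 nd fx; have [dp dm ep em] := fx.
have mp b : 0 < msg psi hp b by apply: msg_gt0_off => //; case: (pos (~~ b)).
have mm b : 0 < msg psi hm b by apply: msg_gt0_off => //; case: (pos (~~ b)).
have y0 : 0 < msgratio hm by rewrite divr_gt0 // mulr_gt0.
have v0 : 0 < msgratio hp by rewrite divr_gt0 // mulr_gt0.
have e1 : hp = msgdist (msgratio hm) by rewrite -BP_msgdist //; apply/funext.
have e2 : hm = msgdist (msgratio hp) by rewrite -BP_msgdist //; apply/funext.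
exists (msgratio hm), (msgratio hp); split=> //.
  by rewrite -msgratio_msgdist // -e1.
by rewrite -msgratio_msgdist // -e2.
Qed.

Lemma msgdist_BP_pair (y v : R) : 0 < y -> 0 < v -> F y = v -> F v = y ->
  BP_fixed_pair D.+1 psi psib (msgdist y) (msgdist v).
Proof.
move=> y0 v0 Fy Fv.
have m (z : R) b : 0 < z -> 0 < msg psi (msgdist z) b.
  by move=> z0; apply: msg_gt0_off; [exact: msgdist_Delta | exact: msgdist_gt0].
split; [exact: msgdist_Delta | exact: msgdist_Delta | move=> b | move=> b].
  by rewrite BP_msgdist ?msgratio_msgdist ?Fv // => c; exact: m.
by rewrite BP_msgdist ?msgratio_msgdist ?Fy // => c; exact: m.
Qed.

Lemma BP_fixed_pairE h : BP_fixed D.+1 psi psib h <-> BP_fixed_pair D.+1 psi psib h h.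
Proof. by split=> [[dh e]|[dh _ e _]]; split. Qed.

Lemma BP_fixed_msgdist h : 0 < psi true true \/ 0 < psi false false ->
  BP_fixed D.+1 psi psib h -> exists y : R, [/\ 0 < y, F y = y & h = msgdist y].
Proof.
move=> nd /BP_fixed_pairE /(BP_pair_msgdist nd)[y [v [y0 v0 Fy Fv [ey ev]]]].
have r := msgratio_msgdist y0; have r' := msgratio_msgdist v0.
by exists y; split=> //; rewrite -r -ey ev r' Fv.
Qed.

Lemma Phi1_Phi2 h : Phi1 D.+1 psi psib h = Phi2 D.+1 psi psib h h.
Proof. by rewrite /Phi1 /Phi2; lra. Qed.

(** By the cycle equations every sum is a power of a linear form times [1 + y ^+ D.+1] or
    [1 + v ^+ D.+1]; the terms specific to [v] then reduce to those of [E y]. *)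
Lemma Phi2_msgdist (y v : R) : 0 < y -> 0 < v -> F y = v -> F v = y ->
  Phi2 D.+1 psi psib (msgdist y) (msgdist v) = ln (E y) / 2.
Proof.
move=> y0 v0 Fy Fv; rewrite /Phi2 !psibE -!exprMn !msg_true // !msg_false //.
have p0 := weight_pp_ge0; have sg := weight_pm_gt0; have q0 := weight_mm_ge0.
have Uy := bpU_gt0 D p0 sg y0; have Uv := bpU_gt0 D p0 sg v0.
have wy := msgdist_den_gt0 y0; have wv := msgdist_den_gt0 v0.
have ey : weight_pm + weight_mm * y ^+ D = v * (weight_pp + weight_pm * y ^+ D) by apply/bpF_eq.
have ev : weight_pm + weight_mm * v ^+ D = y * (weight_pp + weight_pm * v ^+ D) by apply/bpF_eq.
have -> : msgdist y true * msg psi (msgdist v) true +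
          msgdist y false * msg psi (msgdist v) false =
    (weight_pp + weight_pm * v ^+ D) * (1 + y ^+ D.+1) /
      ((u true + u false * y ^+ D) * (u true + u false * v ^+ D)).
  have -> : msgdist y true * msg psi (msgdist v) true +
          msgdist y false * msg psi (msgdist v) false =
     (u true * msg psi (msgdist v) true + y ^+ D * (u false * msg psi (msgdist v) false)) /
       (u true + u false * y ^+ D).
    by rewrite /msgdist; field; rewrite gt_eqF.
  by rewrite msg_true // msg_false // ev exprS; field; rewrite !gt_eqF.
rewrite /bpE ey ev.
move: (weight_pp + weight_pm * y ^+ D) (weight_pp + weight_pm * v ^+ D) (u true + u false * y ^+ D)
  (u true + u false * v ^+ D) Uy Uv wy wv => Uy Uv wy wv Uy0 Uv0 wy0 wv0.
rewrite -!mulrA !exprMn.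
have f (a U w : R) : U ^+ D.+1 * w^-1 ^+ D.+1 + a ^+ D.+1 * (U ^+ D.+1 * w^-1 ^+ D.+1) =
  U ^+ D.+1 * (1 + a ^+ D.+1) * w^-1 ^+ D.+1 by ring.
rewrite !f.
have -> : Uy ^+ D.+1 + v ^+ D.+1 * Uy ^+ D.+1 = Uy ^+ D.+1 * (1 + v ^+ D.+1) by ring.
have y1 : 0 < 1 + y ^+ D.+1 by rewrite addr_gt0 // exprn_gt0.
have v1 : 0 < 1 + v ^+ D.+1 by rewrite addr_gt0 // exprn_gt0.
move: (1 + y ^+ D.+1) (1 + v ^+ D.+1) y1 v1 => y1 v1 y10 v10.
rewrite !lnM ?lnXn ?lnV ?posrE ?mulr_gt0 ?invr_gt0 ?exprn_gt0 ?mulr_gt0 ?invr_gt0 //.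
have -> : ln (wy * wv) = ln wy + ln wv by rewrite lnM.
have -> : ln (y1 ^+ D) = ln y1 * D%:R by rewrite lnXn // mulr_natr.
have e (a : R) : a *+ D.+1 = a * (D%:R + 1) by rewrite natr1 mulr_natr.
rewrite !e.
move: (ln _) (ln _) (ln _) (ln _) (ln _) (ln _) (D%:R) => a b c a' b' c' t.
by field.
Qed.

End Messages.

(** * Extremal fixed points and the free energy *)

Lemma sup_eq_max (R : realType) (A : set R) (x : R) :
  A x -> (forall y, A y -> y <= x) -> sup A = x.
Proof.
move=> Ax xub; apply/eqP; rewrite eq_le; apply/andP; split.
  by apply: ge_sup => //; exists x.
by apply: ub_le_sup => //; exists x.
Qed.

Lemma ferro_ext (R : realType) (p s q : R) D : (1 < D)%N -> 0 < p -> 0 < s -> 0 < q ->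
  s ^+ 2 <= p * q ->
  exists L H : R, [/\ 0 < L <= H, bpF p s q D L = L, bpF p s q D H = H,
    (forall y : R, 0 < y -> bpF p s q D y = y -> L <= y <= H) &
    bpmax p s q D (if q <= p then L else H)].
Proof.
move=> D1 p0 s0 q0 ferro.
have [l [h [L [H [_ _ [_ LH] _ [FL FH Lmin Hmax]]]]]] := ferro_box D p0 s0 q0 ferro.
have /andP[L0 LH'] := LH; have H0 : 0 < H by lra.
exists L, H; split=> // [y y0 Fy|]; first by rewrite Lmin ?Hmax // Fy.
case: ifP => [qp|/negbT]; first by have [] := ferro_max D1 s0 q0 qp ferro L0 FL Lmin.
rewrite -ltNge => /ltW pq; split=> // y y0.
have ferro' : s ^+ 2 <= q * p by rewrite mulrC.
have Hi0 : 0 < H^-1 by rewrite invr_gt0.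
have FHi : bpF q s p D H^-1 = H^-1 by rewrite bpF_flip // FH.
have Himin z : 0 < z -> bpF q s p D z <= z -> H^-1 <= z.
  move=> z0; have zi0 : 0 < z^-1 by rewrite invr_gt0.
  rewrite -[X in bpF _ _ _ _ X]invrK bpF_flip // => Fz.
  rewrite -(invrK z) lef_pV2 ?posrE //; apply: Hmax => //.
  by rewrite -lef_pV2 ?posrE ?invrK // bpF_gt0 // ltW.
have [_ /(_ y^-1)] := ferro_max D1 s0 p0 pq ferro' Hi0 FHi Himin.
by rewrite invr_gt0 !bpE_flip //; apply.
Qed.

Lemma anti_ext (R : realType) (p s q : R) D : (1 < D)%N -> 0 <= p -> 0 < s -> 0 <= q ->
  0 < p \/ 0 < q -> p * q < s ^+ 2 ->
  exists L H : R, [/\ 0 < L <= H, bpF p s q D L = H, bpF p s q D H = L,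
    (forall y : R, 0 < y -> bpF p s q D (bpF p s q D y) = y -> L <= y <= H) &
    bpmax p s q D L /\ bpmax p s q D H].
Proof.
move=> D1; wlog q0 : p q / 0 < q => [wh|] p0 s0 q0' pq anti.
  case: (pq) => [p0'|q0]; last exact: wh.
  have anti' : q * p < s ^+ 2 by rewrite mulrC.
  have [L [H [/andP[L0 LH] FL FH fx [mL mH]]]] := wh q p p0' q0' s0 p0 (or_intror p0') anti'.
  have H0 : 0 < H by lra.
  exists H^-1, L^-1; rewrite invr_gt0 H0 lef_pV2 ?posrE // !bpF_flip // FL FH.
  split=> // [y y0|].
    have yi0 : 0 < y^-1 by rewrite invr_gt0.
    have Fi0 : 0 < bpF q s p D y^-1 by apply: bpF_gt0.
    rewrite -{1}(invrK y) (bpF_flip _ _ _ _ yi0) bpF_flip // => Fy.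
    have /andP[a b] := fx _ yi0 (esym (canLR invrK (esym Fy))).
    by rewrite -(invrK y) !lef_pV2 ?posrE // b.
  by split; apply: bpmax_flip.
have [l [h [L [H [_ _ [_ LH] _ [FL FH Lmin Hmax]]]]]] := anti_box D p0 s0 q0 anti.
have /andP[L0 LH'] := LH; have H0 : 0 < H by lra.
have [eLH mH] := anti_max D1 p0 s0 q0 anti L0 LH' FL FH Lmin Hmax.
exists L, H; split=> // [y y0 Fy|]; first by rewrite Lmin ?Hmax // Fy.
by split; split=> // y y0; rewrite ?eLH mH.
Qed.

Lemma free_energy_cvg (R : realType) (D : nat) (psi : bool -> bool -> R) (u psib : bool -> R)
    (P : forall n, graph n -> R) (M : R) :
  (forall n, graph_law (P n)) -> uniformly_sparse P -> converges_locally_to_Td P D.+1 ->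
  (forall b, 0 < u b) -> (forall b, psib b = u b ^+ D.+1) -> (forall a b, psi a b = psi b a) ->
  (forall a b, 0 <= psi a b) -> 0 < weight_pp psi u \/ 0 < weight_mm psi u ->
  (forall e : R, 0 < e -> ev (fun n =>
     `|fe P (weight_pp psi u) (weight_pm psi u) (weight_mm psi u) n - M| <= e)) ->
  (free_energy_n psi psib P @ \oo --> M)%classic.
Proof.
move=> HP us lc u0 psibE psiC psi0 pq h; apply: ev_cvg => e e0.
pose c : R := `|ln (u true)| + `|ln (u false)| + 1.
have c0 : 0 < c by rewrite ltr_wpDl // addr_ge0.
have e2 : 0 < e / 2 by lra.
have e3 : 0 < e / 2 / c by rewrite divr_gt0.
have := evI (h _ e2) (EE_degdev HP us lc e3); apply: evS => n [h1 h2].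
have ge0 b b' : 0 <= psi b b' * u b * u b' by rewrite !mulr_ge0 // ltW.
have -> : psib = fun b => u b ^+ D.+1 by apply/funext.
have g G : simple_graph G -> `|ln (Zpart psi (fun b => u b ^+ D.+1) G) -
    ln (Zed (weight_pp psi u) (weight_pm psi u) (weight_mm psi u) G)| <= c * degdev R D.+1 G.
  move=> Gs; apply: le_trans (_ : _ <= (`|ln (u true)| + `|ln (u false)|) * degdev R D.+1 G) _.
    apply: lnZpart_gauge => //; try exact: ge0.
    by case=> -[] //=; rewrite psiC mulrAC.
  by rewrite ler_wpM2r ?degdev_ge0 // /c; lra.
have h3 := ler_wpM2l (ltW c0) h2; rewrite [c * (_ / c)]mulrC divfK ?gt_eqF // -EEZ in h3.
pose X (G : graph n) := ln (Zpart psi (fun b => u b ^+ D.+1) G).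
have a1 : EE P X <= EE P (fun G : graph n => ln (Zed (weight_pp psi u) (weight_pm psi u) (weight_mm psi u) G)) +
    EE P (fun G : graph n => c * degdev R D.+1 G).
  by rewrite -EED; apply: EE_le => // G /g; rewrite ler_norml /X; lra.
have a2 : EE P (fun G : graph n => ln (Zed (weight_pp psi u) (weight_pm psi u) (weight_mm psi u) G)) <= EE P X +
    EE P (fun G : graph n => c * degdev R D.+1 G).
  by rewrite -EED; apply: EE_le => // G /g; rewrite ler_norml /X; lra.
have -> : free_energy_n psi (fun b => u b ^+ D.+1) P n = EE P X by [].
move: h1; rewrite /fe !ler_norml; move: a1 a2 h3.
move: (EE P X) (EE P _) (EE P _) => a b e'; lra.
Qed.

From mathcomp Require Import all_classical all_reals all_analysis.
Import Order.TTheory GRing.Theory Num.Theory.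
Import numFieldNormedType.Exports.
Local Open Scope ring_scope.
Local Open Scope classical_set_scope.

Theorem theorem1p7 (R : realType) (d : nat) (psi : bool -> bool -> R) (psib : bool -> R)
  (P : forall n : nat, graph n -> R) :
  (3 <= d)%N ->
  spec_ok psi psib ->
  spin_nondegenerate psi ->
  (forall n, graph_law (P n)) ->
  uniformly_sparse P ->
  converges_locally_to_Td P d ->
  (* (a) spin_ferromagnetic case *)
  (spin_ferromagnetic psi ->
     free_energy_n psi psib P @ \oo --> PhiT d psi psib
     /\ exists hp hm : bool -> R,
          [/\ BP_fixed d psi psib hp, BP_fixed d psi psib hm,
              (forall h, BP_fixed d psi psib h -> h true <= hp true /\ hm true <= h true) &
              PhiT d psi psib =
                (if psi false false * powR (psib false) (2 / d%:R)
                      <= psi true true * powR (psib true) (2 / d%:R)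
                 then Phi1 d psi psib hp else Phi1 d psi psib hm)])
  /\
  (* (b) anti-spin_ferromagnetic case, nearly bipartite graphs *)
  (spin_antiferromagnetic psi -> nearly_bipartite P d ->
     free_energy_n psi psib P @ \oo --> PhiTpm d psi psib
     /\ exists pp pm qp qm : bool -> R,
          [/\ BP_fixed_pair d psi psib pp pm, BP_fixed_pair d psi psib qp qm,
              (forall hp hm, BP_fixed_pair d psi psib hp hm -> hp true <= pp true),
              (forall hp hm, BP_fixed_pair d psi psib hp hm -> hm true <= qm true) &
              PhiTpm d psi psib = Phi2 d psi psib pp pm
              /\ PhiTpm d psi psib = Phi2 d psi psib qp qm]).
Proof.
move=> d3 [psiC psi0 psib0] [s0 nd] HP us lc.
case: d d3 lc => [|D] // D1 lc; rewrite ltnS in D1; have D0 : (0 < D)%N := ltnW D1.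
have dn0 : D.+1%:R != 0 :> R by rewrite pnatr_eq0.
(* The [d]-th root lets a vertex weight be split equally among [d] edges. *)
pose u b := powR (psib b) (D.+1%:R^-1).
have u0 b : 0 < u b by rewrite powR_gt0.
have psibE b : psib b = u b ^+ D.+1.
  by rewrite -powR_mulrn ?ltW // -powRrM mulVf // powRr1 // ltW.
have u2 b : powR (psib b) (2 / D.+1%:R) = u b * u b.
  by rewrite -expr2 -powR_mulrn ?ltW // -powRrM mulrC.
have {}nd : 0 < psi true true \/ 0 < psi false false.
  by move: nd; rewrite lt_max => /orP.
set p := weight_pp psi u; set s := weight_pm psi u; set q := weight_mm psi u.
have gpq : 0 < p \/ 0 < q by case: nd => h; [left | right]; rewrite !mulr_gt0.
have p0 : 0 <= p := weight_pp_ge0 u0 psi0; have q0 : 0 <= q := weight_mm_ge0 u0 psi0.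
have sg : 0 < s := weight_pm_gt0 u0 s0.
have c0 : 0 < u true ^+ 2 * u false ^+ 2 by rewrite mulr_gt0 // exprn_gt0.
have pqE : p * q = psi true true * psi false false * (u true ^+ 2 * u false ^+ 2).
  by rewrite /p /q /weight_pp /weight_mm; ring.
have s2E : s ^+ 2 = psi true false ^+ 2 * (u true ^+ 2 * u false ^+ 2).
  by rewrite /s /weight_pm; ring.
pose pairP := BP_pair_msgdist u0 psibE psiC psi0 s0 nd.
pose mkpair := msgdist_BP_pair u0 psibE psiC psi0 s0.
pose PhiE := Phi2_msgdist u0 psibE psiC psi0 s0.
have lnE (y M : R) : bpmax p s q D M -> 0 < y ->
    ln (bpE p s q D y) / 2 <= ln (bpE p s q D M) / 2.
  by move=> [M0 Mm] y0; rewrite ler_pM2r ?invr_gt0 // ler_ln ?posrE ?bpE_gt0 // Mm.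
split=> [ferro | anti nb].
  have ferro' : s ^+ 2 <= p * q by rewrite pqE s2E ler_pM2r.
  have pq0 : 0 < p * q by apply: lt_le_trans ferro'; rewrite exprn_gt0.
  have p0' : 0 < p by rewrite lt_def p0 andbT; apply: contraTneq pq0 => ->; rewrite mul0r ltxx.
  have q0' : 0 < q by rewrite lt_def q0 andbT; apply: contraTneq pq0 => ->; rewrite mulr0 ltxx.
  have [L [H [/andP[L0 LH] FL FH fx mM]]] := ferro_ext D1 p0' sg q0' ferro'.
  have H0 : 0 < H by apply: lt_le_trans LH.
  set M := (if _ then _ else _) in mM.
  have [M0 FM] : 0 < M /\ bpF p s q D M = M by rewrite /M; case: ifP.
  have fixM (y : R) : 0 < y -> bpF p s q D y = y -> BP_fixed D.+1 psi psib (msgdist D u y).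
    by move=> y0 Fy; apply/BP_fixed_pairE; exact: mkpair.
  have Phi1E (y : R) : 0 < y -> bpF p s q D y = y ->
      Phi1 D.+1 psi psib (msgdist D u y) = ln (bpE p s q D y) / 2.
    by move=> y0 Fy; rewrite Phi1_Phi2; exact: PhiE.
  have fixP h : BP_fixed D.+1 psi psib h ->
      exists y : R, [/\ 0 < y, bpF p s q D y = y & h = msgdist D u y].
    exact: BP_fixed_msgdist.
  have PhiTE : PhiT D.+1 psi psib = ln (bpE p s q D M) / 2.
    apply: sup_eq_max; first by exists (msgdist D u M); [exact: fixM | exact: Phi1E].
    by move=> _ [h /fixP[y [y0 Fy ->]] <-]; rewrite Phi1E // lnE.
  split.
    rewrite PhiTE; apply: (free_energy_cvg HP us lc u0 psibE psiC psi0 gpq) => e e0.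
    exact: fe_ferro_lim.
  (* The ratio is minus over plus, so the smallest one, [L], has the largest mass at plus. *)
  exists (msgdist D u L), (msgdist D u H); split; [exact: fixM | exact: fixM | |].
    move=> h /fixP[y [y0 Fy ->]]; have /andP[Ly yH] := fx y y0 Fy.
    by split; apply: msgdist_anti.
  (* With [powR (psib b) (2 / d) = u b * u b] the case distinction becomes [q <= p], the one in
     [ferro_ext]. *)
  rewrite !u2 !Phi1E // PhiTE /M /p /q /weight_pp /weight_mm !mulrA.
  by case: ifP.
have anti' : p * q < s ^+ 2 by rewrite pqE s2E ltr_pM2r.
have [L [H [/andP[L0 LH] FL FH fx [mL mH]]]] := anti_ext D1 p0 sg q0 gpq anti'.
have H0 : 0 < H by apply: lt_le_trans LH.
have eLH : ln (bpE p s q D L) / 2 = ln (bpE p s q D H) / 2.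
  by apply/eqP; rewrite eq_le !lnE.
have PhiTE : PhiTpm D.+1 psi psib = ln (bpE p s q D L) / 2.
  apply: sup_eq_max.
    exists (msgdist D u L), (msgdist D u H); split; first exact: mkpair.
    by rewrite (PhiE _ _ L0 H0).
  move=> _ [hp [hm [/pairP[y [v [y0 v0 Fy Fv [-> ->]]]] ->]]].
  by rewrite (PhiE _ _ y0 v0) // lnE.
split.
  rewrite PhiTE; apply: (free_energy_cvg HP us lc u0 psibE psiC psi0 gpq) => e e0.
  exact: fe_anti_lim.
(* The cycle read from either of its two points: [L] first maximises the plus mass of the first
   component, [H] first that of the second. *)
exists (msgdist D u L), (msgdist D u H), (msgdist D u H), (msgdist D u L).
split; [exact: mkpair | exact: mkpair | | |].
- move=> hp hm /pairP[y [v [y0 v0 Fy Fv [-> _]]]]; apply: msgdist_anti => //.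
  by have /andP[] : L <= y <= H by apply: fx => //; rewrite Fy.
- move=> hp hm /pairP[y [v [y0 v0 Fy Fv [_ ->]]]]; apply: msgdist_anti => //.
  by have /andP[] : L <= v <= H by apply: fx => //; rewrite Fv.
by rewrite (PhiE _ _ L0 H0) // (PhiE _ _ H0 L0) // PhiTE eLH.
Qed.
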